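(* Let $n \in \{3,4\}$. Then the minimal nontrivial finite quotient of ${\rm SOut}\, F_n$, and also the minimal nonabelian finite quotient of ${\rm Out}\, F_n$, is the linear group ${\rm PSL}_n(\mathbb{Z}_2)$. That is: (1) ${\rm PSL}_n(\mathbb{Z}_2)$ is isomorphic to a quotient of ${\rm SOut}\, F_n$, and every nontrivial finite quotient $G$ of ${\rm SOut}\, F_n$ satisfies $|G| \ge |{\rm PSL}_n(\mathbb{Z}_2)|$, with equality only if $G \cong {\rm PSL}_n(\mathbb{Z}_2)$; (2) ${\rm PSL}_n(\mathbb{Z}_2)$ is isomorphic to a quotient of ${\rm Out}\, F_n$, and every nonabelian finite quotient $G$ of ${\rm Out}\, F_n$ satisfies $|G| \ge |{\rm PSL}_n(\mathbb{Z}_2)|$, with equality only if $G \cong {\rm PSL}_n(\mathbb{Z}_2)$.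
   Context: $F_n$ is the free group of rank $n$, and ${\rm Out}\, F_n = {\rm Aut}\, F_n / {\rm Inn}\, F_n$ is its outer automorphism group. The action on the abelianization $F_n^{\rm ab} \cong \mathbb{Z}^n$ gives a canonical surjection ${\rm Out}\, F_n \to {\rm GL}_n(\mathbb{Z})$; ${\rm SOut}\, F_n$ denotes the preimage of ${\rm SL}_n(\mathbb{Z})$ under this surjection (a subgroup of index two in ${\rm Out}\, F_n$). $\mathbb{Z}_2 = \mathbb{Z}/2\mathbb{Z}$ is the field with two elements. A quotient of a group is a factor group by a normal subgroup (considered up to isomorphism); ''minimal'' means of smallest possible order. *)

(* Defs.v *)
From HB Require Import structures.
From mathcomp Require Import all_boot all_order all_algebra all_fingroup.
From mathcomp Require Import generic_quotient center.
From mathcomp Require Import boolp.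

Set Implicit Arguments.
Unset Strict Implicit.
Unset Printing Implicit Defensive.

Import GRing.Theory.
Local Open Scope group_scope.

Record normal_subgroup (G : groupType) := NormalSubgroup {
  nsub_pred :> {pred G};
  nsub_closed : group_closed nsub_pred;
  nsub_conj : forall x y, x \in nsub_pred -> x ^ y \in nsub_pred
}.

(* The factor group G / N, for an arbitrary (possibly infinite) group G. *)
Section FactorGroup.
Variables (G : groupType) (N : normal_subgroup G).

Let N1 : 1 \in nsub_pred N. Proof. by case: (nsub_closed N). Qed.
Let NM x y : x \in nsub_pred N -> y \in nsub_pred N -> x * y \in nsub_pred N.
Proof. by apply: group_closedM; apply: nsub_closed. Qed.
Let NV x : x \in nsub_pred N -> x^-1 \in nsub_pred N.
Proof. by apply: group_closedV; apply: nsub_closed. Qed.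

Definition coset_rel : rel G := [rel x y | x^-1 * y \in nsub_pred N].

Lemma coset_rel_equiv : equiv_class_of coset_rel.
Proof.
rewrite /coset_rel; split=> [x|x y|y x z] /=; first by rewrite mulVg.
- by apply/idP/idP => /NV; rewrite invgM invgK.
- by move=> xy yz; have := NM xy yz; rewrite -mulgA mulKVg.
Qed.

Canonical coset_rel_equivRel := EquivRelPack coset_rel_equiv.

Definition factor_group := {eq_quot coset_rel}%qT.
HB.instance Definition _ := EqQuotient.on factor_group.
HB.instance Definition _ := Choice.on factor_group.

Local Notation pi := (\pi_factor_group)%qT.

Definition factor_one : factor_group := pi 1.
Definition factor_mul (a b : factor_group) : factor_group :=
  pi (repr a * repr b).
Definition factor_inv (a : factor_group) : factor_group := pi (repr a)^-1.

Lemma factor_eqP x y : reflect (pi x = pi y) (x^-1 * y \in nsub_pred N).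
Proof. exact: (eqquotP factor_group). Qed.

Lemma factor_reprP x : x^-1 * repr (pi x) \in nsub_pred N.
Proof. by apply/factor_eqP; rewrite reprK. Qed.

Lemma factor_mul_pi x y : factor_mul (pi x) (pi y) = pi (x * y).
Proof.
apply/esym/factor_eqP.
set x' := repr (pi x); set y' := repr (pi y).
have -> : (x * y)^-1 * (x' * y') = (x^-1 * x') ^ y * (y^-1 * y').
  by rewrite /conjg invgM !mulgA mulgK.
by apply: NM; [apply: nsub_conj|]; apply: factor_reprP.
Qed.

Lemma factor_inv_pi x : factor_inv (pi x) = pi x^-1.
Proof.
apply/esym/factor_eqP; rewrite invgK; set x' := repr _.
have -> : x * x'^-1 = ((x^-1 * x')^-1) ^ x^-1.
  by rewrite /conjg !invgM !invgK mulgK.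
by apply: nsub_conj; apply: NV; apply: factor_reprP.
Qed.

Lemma factor_mulA : associative factor_mul.
Proof.
move=> a b c; rewrite -[a]reprK -[b]reprK -[c]reprK.
move: (repr a) (repr b) (repr c) => x y z.
by rewrite (factor_mul_pi y z) (factor_mul_pi x y) !factor_mul_pi mulgA.
Qed.
Lemma factor_mul1 : left_id factor_one factor_mul.
Proof. by move=> a; rewrite -[a]reprK factor_mul_pi mul1g. Qed.
Lemma factor_mulr1 : right_id factor_one factor_mul.
Proof. by move=> a; rewrite -[a]reprK factor_mul_pi mulg1. Qed.
Lemma factor_mulV : left_inverse factor_one factor_inv factor_mul.
Proof. by move=> a; rewrite -[a]reprK factor_inv_pi factor_mul_pi mulVg. Qed.
Lemma factor_mulrV : right_inverse factor_one factor_inv factor_mul.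
Proof. by move=> a; rewrite -[a]reprK factor_inv_pi factor_mul_pi mulgV. Qed.

HB.instance Definition _ := isGroup.Build factor_group
  factor_mulA factor_mul1 factor_mulr1 factor_mulV factor_mulrV.

End FactorGroup.

(* The finite group H is isomorphic to the factor group of G by some normal
   subgroup. *)
Definition is_quotient (G : groupType) (gT : finGroupType) (H : {group gT}) :=
  exists (N : normal_subgroup G) (f : {multiplicative factor_group N -> gT}),
    injective f /\ (forall y, y \in H <-> exists a, f a = y).

Section AutomorphismGroup.
Variable G : groupType.

Record autgroup := Autgroup {
  aut_fun :> G -> G;
  aut_morph : {morph aut_fun : x y / x * y};
  aut_bij : bijective aut_fun
}.

HB.instance Definition _ := gen_eqMixin autgroup.
HB.instance Definition _ := gen_choiceMixin autgroup.

Implicit Types f g : autgroup.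

Lemma autP f g : f =1 g -> f = g.
Proof.
case: f g => [f fM fB] [g gM gB] /= /funext fg.
by case: _ / fg gM gB => gM gB; congr Autgroup; apply: Prop_irrelevance.
Qed.

Lemma aut_inv_exists f : exists g : autgroup, cancel f g /\ cancel g f.
Proof.
case: (aut_bij f) => h fK hK.
have hM : {morph h : x y / x * y}.
  by move=> x y; apply: (can_inj fK); rewrite aut_morph !hK.
by exists (Autgroup hM (Bijective hK fK)).
Qed.

Definition aut_one : autgroup :=
  @Autgroup idfun (fun _ _ => erefl) (Bijective (frefl _) (frefl _)).
Definition aut_mul f g : autgroup :=
  @Autgroup (f \o g)
    (fun x y => etrans (congr1 f (aut_morph g x y)) (aut_morph f _ _))
    (bij_comp (aut_bij f) (aut_bij g)).
Definition aut_inv f : autgroup := projT1 (cid (aut_inv_exists f)).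

Lemma aut_invK f : cancel f (aut_inv f) /\ cancel (aut_inv f) f.
Proof. exact: projT2 (cid (aut_inv_exists f)). Qed.

Lemma aut_mulA : associative aut_mul.
Proof. by move=> f g h; apply: autP. Qed.
Lemma aut_mul1 : left_id aut_one aut_mul.
Proof. by move=> f; apply: autP. Qed.
Lemma aut_mulr1 : right_id aut_one aut_mul.
Proof. by move=> f; apply: autP. Qed.
Lemma aut_mulV : left_inverse aut_one aut_inv aut_mul.
Proof. by move=> f; apply: autP; case: (aut_invK f). Qed.
Lemma aut_mulrV : right_inverse aut_one aut_inv aut_mul.
Proof. by move=> f; apply: autP; case: (aut_invK f). Qed.

HB.instance Definition _ := isGroup.Build autgroup
  aut_mulA aut_mul1 aut_mulr1 aut_mulV aut_mulrV.

Lemma autM f g x : (f * g) x = f (g x). Proof. by []. Qed.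
Lemma aut1 x : (1 : autgroup) x = x. Proof. by []. Qed.

Lemma aut_fun1 f : f 1 = 1.
Proof.
by apply: (mulgI (f 1)); rewrite -aut_morph !mulg1.
Qed.

Lemma aut_funV f x : f x^-1 = (f x)^-1.
Proof. by apply: (mulgI (f x)); rewrite -aut_morph !mulgV aut_fun1. Qed.

Definition inner : {pred autgroup} :=
  [pred f | `[< exists g : G, forall x, aut_fun f x = g * x * g^-1 >]].

Lemma innerP f :
  reflect (exists g : G, forall x, f x = g * x * g^-1) (f \in inner).
Proof. exact: asboolP. Qed.

Lemma inner_closed : group_closed inner.
Proof.
split; first by apply/innerP; exists 1 => x; rewrite mul1g invg1 mulg1.
move=> f h /innerP[a fE] /innerP[b hE]; apply/innerP; exists (a * b^-1) => x.
have hV y : h^-1 y = b^-1 * y * b.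
  apply: (bij_inj (aut_bij h)); rewrite -autM mulgV hE.
  by rewrite aut1 !mulgA mulgV mul1g mulgK.
by rewrite autM fE hV invgM invgK !mulgA.
Qed.

Lemma inner_conj f h : f \in inner -> f ^ h \in inner.
Proof.
move=> /innerP[a fE]; apply/innerP; exists (h^-1 a) => x.
rewrite /conjg !autM fE !aut_morph aut_funV.
by rewrite -(autM h^-1 h) mulVg aut1.
Qed.

Definition inngroup := NormalSubgroup inner_closed inner_conj.

Definition outgroup := factor_group inngroup.
HB.instance Definition _ := Group.on outgroup.
HB.instance Definition _ := EqQuotient.on outgroup.

End AutomorphismGroup.

(* The free group on x_0, ..., x_{n-1}, as the set of reduced words: the letter
   (i, false) stands for x_i and (i, true) for its inverse. *)
Section FreeGroup.
Variable n : nat.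

Definition letter : Type := 'I_n * bool.
HB.instance Definition _ := Choice.on letter.
Definition letter_inv (l : letter) : letter := (l.1, ~~ l.2).
Definition reduced (w : seq letter) :=
  sorted (fun l m => m != letter_inv l) w.

Record free_group := FreeGroup { word :> seq letter; _ : reduced word }.

HB.instance Definition _ := [isSub for word].
HB.instance Definition _ := [Choice of free_group by <:].

Definition push (l : letter) (w : seq letter) : seq letter :=
  if w is m :: w' then if m == letter_inv l then w' else l :: w else [:: l].

Definition reduced_cat (u v : seq letter) := foldr push v u.

Definition word_inv (w : seq letter) := rev (map letter_inv w).

Lemma letter_invK : involutive letter_inv.
Proof. by case=> i b; rewrite /letter_inv /= negbK. Qed.

Lemma reduced_push l w : reduced w -> reduced (push l w).
Proof.
case: w => [|m w] //= rw; case: eqP => [_|/eqP ne]; first exact: path_sorted rw.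
by rewrite /= ne.
Qed.

Lemma reduced_reduced_cat u v : reduced v -> reduced (reduced_cat u v).
Proof. by move=> rv; elim: u => //= l u; apply: reduced_push. Qed.

Lemma push_inv l w : reduced w -> push l (push (letter_inv l) w) = w.
Proof.
case: w => [|m w] /=; first by rewrite eqxx.
rewrite letter_invK; case: eqP => [->|_ _] /=; last by rewrite eqxx.
by case: w => [|k w] //= /andP[/negPf-> _].
Qed.

Lemma reduced_cat0 w : reduced w -> reduced_cat w [::] = w.
Proof.
elim: w => //= l w IH rw; rewrite IH; last exact: path_sorted rw.
by case: w rw {IH} => //= m w /andP[/negPf-> _].
Qed.

Lemma reduced_cat_push l u w : reduced w ->
  reduced_cat (push l u) w = push l (reduced_cat u w).
Proof.
move=> rw; case: u => [|m u] //=; case: eqP => [->|] //.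
by rewrite push_inv // reduced_reduced_cat.
Qed.

Lemma reduced_catA u v w : reduced w ->
  reduced_cat u (reduced_cat v w) = reduced_cat (reduced_cat u v) w.
Proof. by move=> rw; elim: u => //= l u ->; rewrite reduced_cat_push. Qed.

Lemma reduced_catV w : reduced_cat (word_inv w) w = [::].
Proof.
elim: w => //= l w IH.
by rewrite /reduced_cat /word_inv /= rev_cons foldr_rcons /= letter_invK eqxx.
Qed.

Lemma reduced_word_inv w : reduced w -> reduced (word_inv w).
Proof.
rewrite /reduced /word_inv rev_sorted sorted_map; apply: sub_sorted => l m /=.
by rewrite letter_invK; apply: contraNN => /eqP->.
Qed.

Lemma word_invK : involutive word_inv.
Proof.
by move=> w; rewrite /word_inv map_rev revK mapK //; apply: letter_invK.
Qed.

Definition free_one : free_group := @FreeGroup [::] isT.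
Definition free_mul (u v : free_group) : free_group :=
  FreeGroup (reduced_reduced_cat u (valP v)).
Definition free_inv (u : free_group) : free_group :=
  FreeGroup (reduced_word_inv (valP u)).

Lemma free_mulA : associative free_mul.
Proof. by move=> u v w; apply/val_inj/reduced_catA/valP. Qed.
Lemma free_mul1 : left_id free_one free_mul.
Proof. by move=> u; apply/val_inj. Qed.
Lemma free_mulr1 : right_id free_one free_mul.
Proof. by move=> u; apply/val_inj/reduced_cat0/valP. Qed.
Lemma free_mulV : left_inverse free_one free_inv free_mul.
Proof. by move=> u; apply/val_inj/reduced_catV. Qed.
Lemma free_mulrV : right_inverse free_one free_inv free_mul.
Proof.
by move=> u; apply/val_inj; rewrite /= -{1}[word u]word_invK reduced_catV.
Qed.

HB.instance Definition _ := isGroup.Build free_group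
  free_mulA free_mul1 free_mulr1 free_mulV free_mulrV.

Definition free_letter (l : letter) : free_group := @FreeGroup [:: l] isT.
Definition free_gen (i : 'I_n) : free_group := free_letter (i, false).

Lemma free_letterV l : free_letter (letter_inv l) = (free_letter l)^-1.
Proof. exact: val_inj. Qed.

Lemma free_ind (P : free_group -> Prop) :
  P 1 -> (forall l w, P w -> P (free_letter l * w)) -> forall w, P w.
Proof.
move=> P1 PM [w rw]; elim: w rw => [|l w IH] rw.
  by rewrite (_ : FreeGroup rw = 1) //; apply: val_inj.
have rw' : reduced w by exact: path_sorted rw.
rewrite (_ : FreeGroup rw = free_letter l * FreeGroup rw'); first exact/PM/IH.
by apply: val_inj => /=; case: w rw {IH rw'} => //= m w /andP[/negPf-> _].
Qed.

End FreeGroup.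

(* The abelianization of the free group, identified with Z^n: a word is sent to
   the column vector of its exponent sums. *)
Section Abelianization.
Variable n : nat.
Local Notation F := (free_group n).
Local Open Scope ring_scope.

Definition exp_sum (w : seq (letter n)) : 'cV[int]_n :=
  \sum_(l <- w) (-1) ^+ l.2 *: delta_mx l.1 0.

Lemma exp_sum_cons l w :
  exp_sum (l :: w) = (-1) ^+ l.2 *: delta_mx l.1 0 + exp_sum w.
Proof. by rewrite /exp_sum big_cons. Qed.

Lemma exp_sum_push l w : exp_sum (push l w) = exp_sum (l :: w).
Proof.
case: w => [|m w] //=; case: eqP => [->|] //.
rewrite !exp_sum_cons /= addrA -scalerDl.
by case: l.2; rewrite /= ?addrN ?addNr scale0r add0r.
Qed.

Lemma exp_sumM (u v : F) : exp_sum (u * v)%g = exp_sum u + exp_sum v.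
Proof.
rewrite /=; elim: (word u) => [|l w IH] /=.
  by rewrite /exp_sum big_nil add0r.
by rewrite exp_sum_push !exp_sum_cons IH addrA.
Qed.

Lemma exp_sum1 : exp_sum (1%g : F) = 0.
Proof. by rewrite /exp_sum big_nil. Qed.

Lemma exp_sumV (u : F) : exp_sum (u^-1)%g = - exp_sum u.
Proof.
by apply/eqP; rewrite eq_sym eqr_oppLR -addr_eq0 addrC -exp_sumM mulVg exp_sum1.
Qed.

Lemma exp_sum_gen i : exp_sum (free_gen i) = delta_mx i 0.
Proof. by rewrite /exp_sum big_seq1 expr0 scale1r. Qed.

Definition aut_mx (f : autgroup F) : 'M[int]_n :=
  \matrix_(i, j) exp_sum (f (free_gen j)) i 0.

(* aut_mx f is the matrix of the map induced by f on the abelianization. *)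
Lemma exp_sum_aut (f : autgroup F) (w : F) :
  exp_sum (f w) = aut_mx f *m exp_sum w.
Proof.
have gen i : exp_sum (f (free_gen i)) = aut_mx f *m exp_sum (free_gen i).
  by rewrite exp_sum_gen -colE; apply/colP => k; rewrite !mxE.
elim/free_ind: w => [|[i b] w IH]; first by rewrite aut_fun1 exp_sum1 mulmx0.
rewrite aut_morph !exp_sumM mulmxDr IH; congr (_ + _).
case: b; last exact: gen.
rewrite (_ : (i, true) = letter_inv (i, false)) // free_letterV aut_funV.
by rewrite !exp_sumV mulmxN gen.
Qed.

Lemma aut_mxM (f g : autgroup F) : aut_mx (f * g)%g = aut_mx f *m aut_mx g.
Proof.
apply/matrixP => i j; rewrite mxE autM exp_sum_aut !mxE.
by apply: eq_bigr => k _; rewrite !mxE.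
Qed.

Lemma aut_mx_inner (f : autgroup F) : f \in inner (G := F) -> aut_mx f = 1%:M.
Proof.
move=> /innerP[g fE]; apply/matrixP => i j; rewrite mxE fE !exp_sumM exp_sumV.
by rewrite addrAC subrr add0r exp_sum_gen !mxE andbT.
Qed.

Lemma aut_mx1 : aut_mx 1%g = 1%:M.
Proof. by apply: aut_mx_inner; case: (inner_closed F). Qed.

(* The action of an outer automorphism on the abelianization; it is computed on
   an arbitrary representative, see out_mxE. *)
Definition out_mx (x : outgroup F) : 'M[int]_n := aut_mx (repr x).

Lemma out_mxE (f : autgroup F) : out_mx (\pi_(outgroup F) f)%qT = aut_mx f.
Proof.
have /aut_mx_inner := factor_reprP (inngroup F) f.
rewrite aut_mxM => /(congr1 (mulmx (aut_mx f))).
by rewrite mulmxA -aut_mxM mulgV aut_mx1 mul1mx mulmx1.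
Qed.

Lemma out_mxM (x y : outgroup F) : out_mx (x * y)%g = out_mx x *m out_mx y.
Proof.
rewrite -[x]reprK -[y]reprK.
have -> : (\pi_(outgroup F) (repr x) * \pi_(outgroup F) (repr y))%g%qT =
          (\pi_(outgroup F) (repr x * repr y)%g)%qT by exact: factor_mul_pi.
by rewrite !out_mxE aut_mxM.
Qed.

Lemma out_mx1 : out_mx 1%g = 1%:M.
Proof. by rewrite out_mxE aut_mx1. Qed.

Definition SOut_pred : {pred outgroup F} := [pred x | \det (out_mx x) == 1].

Lemma SOut_closed : group_closed SOut_pred.
Proof.
split; first by rewrite inE out_mx1 det1.
move=> x y; rewrite !inE => /eqP dx /eqP dy.
have : \det (out_mx (x * y^-1)%g) * \det (out_mx y) = 1.
  by rewrite -det_mulmx -out_mxM mulgVK.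
by rewrite dy mulr1 => ->.
Qed.

Record SOut_free :=
  SOutFree { sout_val :> outgroup F; _ : sout_val \in SOut_pred }.
HB.instance Definition _ := [isSub for sout_val].
HB.instance Definition _ := [Choice of SOut_free by <:].
HB.instance Definition _ :=
  SubChoice_isSubGroup.Build (outgroup F) SOut_pred SOut_free SOut_closed.

End Abelianization.

(* {'GL_n[K]} consists of matrices of size n.-1.+1, so 0 < n is understood. *)
Section ProjectiveSpecialLinear.
Variables (n : nat) (K : finFieldType).

Definition SLgroup : {set {'GL_n[K]}} := [set u | (\det (GLval u) == 1)%R].

Lemma SLgroup_group_set : group_set SLgroup.
Proof.
apply/group_setP; split; first by rewrite inE GL_1E det1.
move=> u v; rewrite !inE GL_ME det_mulmx => /eqP-> /eqP->.
by rewrite GRing.mulr1.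
Qed.
Canonical SLgroup_group := Group SLgroup_group_set.

Definition PSLgroup : {group coset_of 'Z(SLgroup)} :=
  (SLgroup / 'Z(SLgroup))%G.

End ProjectiveSpecialLinear.

(* Main.v *)
From HB Require Import structures.
Require Import Defs.
From mathcomp Require Import all_boot all_order all_algebra all_fingroup.
From mathcomp Require Import all_solvable integral_char.
From mathcomp Require Import generic_quotient center boolp zify.

(** SAut F_n is generated by the transvections rho_ij : x_i |-> x_i x_j and
    lam_ij : x_i |-> x_j^-1 x_i (Nielsen), all conjugate up to inversion, so everything
    depends on the image r_ij of rho_ij in a nontrivial finite quotient G.

    If r_ij^2 = 1, the elements r_ij l_ij generate an abelian normal subgroup D, and G / D
    satisfies Steinberg's relations for GL_n(F_2). These relations define a group of order
    at most |GL_n(F_2)|, and GL_n(F_2) is simple, so G / D is isomorphic to GL_n(F_2).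

    If r_ij has order k > 2, then |G| > |GL_n(F_2)|, without any classification. The row
    subgroup M = <r_0j : j > 0> is normalised by the r_ij with i, j > 0, which act on it
    through Nielsen moves, and it commutes with its conjugate <l_0j>. If M is abelian, then
    M = (Z/k)^(n-1), and |G| is at least the product of the number of conjugates of the
    basis (r_0j) and |M|. If M is not abelian, G is large because it contains commuting
    copies of M (four of them, for the rank two subgroup of M, when n = 4) on which the
    Nielsen moves still act; when M is perfect, Burnside's p^a q^b theorem bounds |M : Z(M)|. *)

Set Implicit Arguments.
Unset Strict Implicit.
Unset Printing Implicit Defensive.

Import GRing.Theory.
Local Open Scope group_scope.

(** * Homomorphisms and automorphisms of free groups *)

(** No presentation of SAut F_n is used, only generation by transvections and a few relations.
    Quotients of SOut F_n and Out F_n are pulled back to maps on automorphisms of F_n. Over F_2 the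
    groups PSL, SL and GL coincide, so the orders to beat are |GL_3(F_2)| = 168 and |GL_4(F_2)| =
    20160. The obstacle is that the counts barely suffice. For k = 3 the abelian row gives 7 . 3 . 9
    = 189 when n = 3 and 10 . 81 . 27 = 21870 when n = 4; the nonabelian cases end at 6 . 4 . 8 =
    192, 80 . 8 . 32 = 20480 and 6 . 8^4 = 24576. This is why one extra conjugate outside an evident
    coset, the inverse coset, or a central index of 8 instead of 4 has to be recorded. For
    nonabelian M the estimate is |G| >= d |M : Z(M)| |C_G(M)|: here d counts conjugates of the basis
    of M / M' (d = 1 if M is perfect), and C_G(M) contains the commuting copies of M. For n = 4 the
    cases are split by whether the squares of the generators of a row commute with that row: if not,
    rank two already gives central index 8 and leaves a spare index for more copies; if so, the rank
    three group has nilpotency class two. *)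

Section FreeHom.
Variables (n : nat) (H : groupType).
Implicit Types h : 'I_n -> H.

Definition letter_ev h (l : letter n) : H := if l.2 then (h l.1)^-1 else h l.1.
Definition word_ev h (w : seq (letter n)) : H :=
  foldr (fun l x => letter_ev h l * x) 1 w.
Definition free_ev h (u : free_group n) : H := word_ev h (word u).

Lemma word_ev_push h l w : word_ev h (push l w) = letter_ev h l * word_ev h w.
Proof.
case: w => [|m w] //=; case: eqP => [->|] //.
by rewrite /letter_ev /=; case: l.2; rewrite ?mulKg ?mulVKg.
Qed.

Lemma free_evM h : {morph free_ev h : u v / u * v}.
Proof.
move=> u v; rewrite /free_ev /=; elim: (word u) => [|l w IH] /=.
  by rewrite mul1g.
by rewrite word_ev_push IH mulgA.
Qed.

Lemma free_ev_gen h i : free_ev h (free_gen i) = h i.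
Proof. by rewrite /free_ev /= mulg1. Qed.

Lemma free_hom1 (f : free_group n -> H) : {morph f : u v / u * v} -> f 1 = 1.
Proof. by move=> fM; apply: (mulgI (f 1)); rewrite -fM !mulg1. Qed.

Lemma eq_free_hom (f g : free_group n -> H) :
  {morph f : u v / u * v} -> {morph g : u v / u * v} ->
  (forall i, f (free_gen i) = g (free_gen i)) -> f =1 g.
Proof.
move=> fM gM fg; elim/free_ind => [|[i b] w IH]; first by rewrite !free_hom1.
rewrite fM gM IH; congr (_ * _); case: b; last exact: fg.
rewrite (_ : (i, true) = letter_inv (i, false)) // free_letterV.
apply: (mulgI (f (free_gen i))); rewrite -fM fg -gM.
by rewrite !mulgV !free_hom1.
Qed.

End FreeHom.

(** * Transvections, signed swaps and double sign changes *)

Section FreeAut.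
Variable n : nat.
Local Notation F := (free_group n).
Local Notation x_ := (@free_gen n).
Implicit Types (f g : autgroup F) (h : 'I_n -> F).

Lemma aut_eq_gen f g : (forall i, f (x_ i) = g (x_ i)) -> f = g.
Proof.
by move=> fg; apply/autP/eq_free_hom => //; apply: aut_morph.
Qed.

(* The identity when [h] is not a basis. *)
Definition free_aut h : autgroup F :=
  if pselect (bijective (free_ev h)) is left b
  then Autgroup (@free_evM n F h) b else 1.

(** [h'] is the inverse substitution. Endomorphisms of a free group that are mutually inverse on the
    generators are mutually inverse, so [free_aut h] does not fall back on its default value. *)
Lemma free_autE h h' :
  (forall i, free_ev h (h' i) = x_ i) -> (forall i, free_ev h' (h i) = x_ i) ->
  forall i, free_aut h (x_ i) = h i.
Proof.
move=> hh' h'h i; rewrite /free_aut.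
case: pselect => [b|[]] /=; first exact: free_ev_gen.
have can h1 h2 : (forall i, free_ev h1 (h2 i) = x_ i) ->
    cancel (free_ev h2) (free_ev h1).
  move=> h12; apply: (@eq_free_hom _ _ (free_ev h1 \o free_ev h2) id) => //.
    by move=> u v /=; rewrite !free_evM.
  by move=> j /=; rewrite free_ev_gen.
by exists (free_ev h'); apply: can.
Qed.

Lemma free_evV h u : free_ev h u^-1 = (free_ev h u)^-1.
Proof.
by apply: (mulgI (free_ev h u)); rewrite -free_evM !mulgV free_hom1 //;
  apply: free_evM.
Qed.

Definition rho (i j : 'I_n) := free_aut (fun k => if k == i then x_ i * x_ j else x_ k).
(** Multiplying by the inverse of [x_j] gives [lam] the same chain relation as [rho], and inverting
    [x_i] together with a third generator exchanges the two exactly. *)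
Definition lam (i j : 'I_n) :=
  free_aut (fun k => if k == i then (x_ j)^-1 * x_ i else x_ k).
(** The sign gives determinant 1, as does inverting two generators at once in [flip2]; unsigned
    transpositions and single inversions lie outside SAut F_n. *)
Definition swp (i j : 'I_n) := free_aut (fun k =>
  if k == i then x_ j else if k == j then (x_ i)^-1 else x_ k).
Definition flip2 (i j : 'I_n) := free_aut (fun k =>
  if (k == i) || (k == j) then (x_ k)^-1 else x_ k).

Lemma rhoE i j k : i != j -> rho i j (x_ k) = if k == i then x_ i * x_ j else x_ k.
Proof.
move=> ij; apply: (@free_autE _
  (fun k => if k == i then x_ i * (x_ j)^-1 else x_ k)) => {}k;
  case: (eqVneq k i) => [->|ki]; rewrite ?(free_evM, free_evV, free_ev_gen) ?eqxx;
  by rewrite 1?[j == i]eq_sym ?(negPf ij) ?(negPf ki) ?mulgK ?mulgVK.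
Qed.

Lemma lamE i j k : i != j ->
  lam i j (x_ k) = if k == i then (x_ j)^-1 * x_ i else x_ k.
Proof.
move=> ij; apply: (@free_autE _
  (fun k => if k == i then x_ j * x_ i else x_ k)) => {}k;
  case: (eqVneq k i) => [->|ki]; rewrite ?(free_evM, free_evV, free_ev_gen) ?eqxx;
  by rewrite 1?[j == i]eq_sym ?(negPf ij) ?(negPf ki) ?mulKg ?mulVKg.
Qed.

Lemma swpE i j k : i != j ->
  swp i j (x_ k) = if k == i then x_ j else if k == j then (x_ i)^-1 else x_ k.
Proof.
move=> ij; have ji : j != i by rewrite eq_sym.
apply: (@free_autE _ (fun k =>
  if k == i then (x_ j)^-1 else if k == j then x_ i else x_ k)) => {}k;
  (case: (eqVneq k i) => [->|ki]; last case: (eqVneq k j) => [->|kj]);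
  rewrite ?(free_evM, free_evV, free_ev_gen) ?eqxx ?(negPf ij) ?(negPf ji) //;
  by rewrite ?(negPf ki) ?(negPf kj) ?eqxx ?invgK.
Qed.

Lemma flip2E i j k :
  flip2 i j (x_ k) = if (k == i) || (k == j) then (x_ k)^-1 else x_ k.
Proof.
apply: (@free_autE _ (fun k =>
  if (k == i) || (k == j) then (x_ k)^-1 else x_ k)) => {}k;
  case: ifP => E; by rewrite ?free_evV free_ev_gen E ?invgK.
Qed.

End FreeAut.

Ltac neq_simpl := repeat match goal with
  | H : is_true (?i != ?j) |- context [?i == ?j] => rewrite (negPf H)
  | H : is_true (?i != ?j) |- context [?j == ?i] => rewrite (eq_sym j i) (negPf H)
  end.

Ltac aut_simpl := repeat (progress (
  rewrite ?autM ?aut_morph ?aut_funV ?(rhoE, lamE, swpE) ?flip2E ?eqxx //; neq_simpl;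
  rewrite ?orbT ?orbF /=)).

(** Both sides are compared on a generator [x_m], after deciding for each index in the context
    whether it equals [m]; what remains is an identity in a group. *)
Ltac aut_rel := let m := fresh "m" in
  apply: aut_eq_gen => m; rewrite ?/commute;
  repeat match goal with
  | i : 'I_ _ |- context [free_gen m] => lazymatch i with
    | m => fail
    | _ => lazymatch goal with
      | H : is_true (m != i) |- _ => fail
      | _ => case: (eqVneq m i) => [?|?]; [subst m|]
      end
    end
  end;
  aut_simpl; by rewrite ?(invgM, mulgA, gnorm).

(** * Relations between transvections *)

Section AutRelations.
Variable n : nat.
Implicit Types i j k l : 'I_n.

Lemma rho_rho_chain i j k : i != j -> i != k -> j != k ->
  rho j k * rho i j = rho i j * rho i k * rho j k.
Proof. by move=> ij ik jk; aut_rel. Qed.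

Lemma rho_lam_chain i j k : i != j -> i != k -> j != k ->
  rho j k * lam i j = lam i j * lam i k * rho j k.
Proof. by move=> ij ik jk; aut_rel. Qed.

Lemma lam_rho_chain i j k : i != j -> i != k -> j != k ->
  rho i k * (lam j k * rho i j) = rho i j * lam j k.
Proof. by move=> ij ik jk; aut_rel. Qed.

Lemma lam_lam_chain i j k : i != j -> i != k -> j != k ->
  lam i k * (lam j k * lam i j) = lam i j * lam j k.
Proof. by move=> ij ik jk; aut_rel. Qed.

Lemma commute_lam_rho i j k : i != j -> i != k -> commute (lam i j) (rho i k).
Proof. by move=> ij ik; aut_rel. Qed.

Lemma commute_rho i j k l : i != j -> i != k -> j != k -> i != l -> j != l ->
  commute (rho i k) (rho j l).
Proof. by move=> ij ik jk il jl; aut_rel. Qed.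

Lemma commute_lam i j k l : i != j -> i != k -> j != k -> i != l -> j != l ->
  commute (lam i k) (lam j l).
Proof. by move=> ij ik jk il jl; aut_rel. Qed.

Lemma commute_lam_rho2 i j k l : i != j -> i != k -> j != k -> i != l -> j != l ->
  commute (lam i k) (rho j l).
Proof. by move=> ij ik jk il jl; aut_rel. Qed.

(** This and [swp_lam_rho] express [swp] by transvections in two ways. When transvections become
    involutions, comparing the two yields [K_swap]; when moreover left and right transvections
    agree, [swp] becomes a Weyl element. *)
Lemma swp_rho_lam i j : i != j -> swp i j * lam i j * rho j i = rho i j.
Proof. by move=> ij; aut_rel. Qed.

Lemma swp_lam_rho i j : i != j -> lam i j * swp i j = lam j i * rho i j.
Proof. by move=> ij; aut_rel. Qed.

Lemma swp_sqr i j : i != j -> swp i j * swp i j = flip2 i j.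
Proof. by move=> ij; aut_rel. Qed.

Lemma swp_rhoR i j k : i != j -> i != k -> j != k ->
  swp i j * rho k i = rho k j * swp i j.
Proof. by move=> ij ik jk; aut_rel. Qed.

Lemma swp_rhoL i j k : i != j -> i != k -> j != k ->
  swp i j * rho i k = rho j k * swp i j.
Proof. by move=> ij ik jk; aut_rel. Qed.

Lemma swp_lamL i j k : i != j -> i != k -> j != k ->
  swp i j * lam i k = lam j k * swp i j.
Proof. by move=> ij ik jk; aut_rel. Qed.

Lemma flip2_rho i j k : i != j -> i != k -> j != k ->
  flip2 i k * rho i j = lam i j * flip2 i k.
Proof. by move=> ij ik jk; aut_rel. Qed.

Lemma flip2_rho_pair i j : i != j -> lam i j * (flip2 i j * rho i j) = flip2 i j.
Proof. by move=> ij; aut_rel. Qed.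

End AutRelations.

(** * Nielsen reduction *)

Section CommonPrefix.
Variable T : eqType.
Implicit Types s t : seq T.

Fixpoint lcp s t := match s, t with
  | x :: s', y :: t' => if x == y then (lcp s' t').+1 else 0
  | _, _ => 0
  end.

Lemma lcpC s t : lcp s t = lcp t s.
Proof. by elim: s t => [|x s IH] [|y t] //=; rewrite eq_sym IH. Qed.

Lemma lcp_leqr s t : lcp s t <= size t.
Proof. by elim: s t => [|x s IH] [|y t] //=; case: eqP => // _; apply: IH. Qed.

Lemma lcp_leql s t : lcp s t <= size s.
Proof. by rewrite lcpC lcp_leqr. Qed.

Lemma take_lcp s t : take (lcp s t) s = take (lcp s t) t.
Proof. by elim: s t => [|x s IH] [|y t] //=; case: eqP => [->|//] /=; rewrite IH. Qed.

Lemma lcp_take_cat s t k r : lcp s t < k -> k <= size t ->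
  lcp s (take k t ++ r) = lcp s t.
Proof.
elim: s t k => [|x s IH] [|y t] [|k] //=.
by case: eqP => // _ ? ?; rewrite IH.
Qed.

End CommonPrefix.

(** * Cancellation in products of reduced words *)

Section Cancellation.
Variable n : nat.
Local Notation F := (free_group n).
Implicit Types (u v w : F) (s : seq (letter n)).

Definition cancel_len u v := lcp (word u^-1) (word v).

Lemma size_word_inv s : size (word_inv s) = size s.
Proof. by rewrite size_rev size_map. Qed.

Lemma word_inv_rcons s l : word_inv (rcons s l) = letter_inv l :: word_inv s.
Proof. by rewrite /word_inv map_rcons rev_rcons. Qed.

(** Induction on the last letter of [s], the one that meets [t]: either it cancels the head of [t],
    or it survives and shields everything before it, because [s] is reduced. *)
Lemma reduced_catE s t : reduced s ->
  let c := lcp (word_inv s) t in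
  reduced_cat s t = take (size s - c) s ++ drop c t.
Proof.
elim/last_ind: s t => [|s l IH] t rs /=; first by rewrite drop0.
have rs' : reduced s.
  by move: rs; case: (s) => // x s'; rewrite /reduced /= rcons_path => /andP[].
rewrite word_inv_rcons /reduced_cat foldr_rcons -/(reduced_cat s _) IH //.
have nocancel r : lcp (word_inv s) (l :: r) = 0.
  case/lastP: s rs {IH rs'} => [|s m] //; rewrite word_inv_rcons /= => rs.
  case: eqP => // lE; move: rs; rewrite -lE.
  by case: s => [|x s]; rewrite /reduced /= ?eqxx // !rcons_path last_rcons eqxx andbF.
case: t => [|m t] /=.
  by rewrite nocancel !subn0 take_size size_rcons take_oversize ?size_rcons // cats0 cats1.
rewrite [letter_inv l == m]eq_sym; case: eqP => _ /=.
  by rewrite size_rcons subSS -cats1 takel_cat // leq_subr.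
by rewrite nocancel !subn0 take_size take_oversize // drop0 cat_rcons.
Qed.

Lemma word_mul u v :
  word (u * v) = take (size (word u) - cancel_len u v) (word u)
                 ++ drop (cancel_len u v) (word v).
Proof. exact/reduced_catE/valP. Qed.

Lemma cancel_leql u v : cancel_len u v <= size (word u).
Proof. by rewrite -[size _]size_word_inv lcp_leql. Qed.

Lemma cancel_leqr u v : cancel_len u v <= size (word v).
Proof. exact: lcp_leqr. Qed.

Lemma size_inv u : size (word u^-1) = size (word u).
Proof. exact: size_word_inv. Qed.

Lemma size_mul u v :
  size (word (u * v)) = (size (word u) + size (word v) - (cancel_len u v).*2)%N.
Proof.
rewrite word_mul size_cat size_takel ?leq_subr // size_drop.
by have := cancel_leql u v; have := cancel_leqr u v; lia.
Qed.

Lemma cancel_lenV u v : cancel_len v^-1 u^-1 = cancel_len u v.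
Proof. by rewrite /cancel_len invgK lcpC. Qed.

Lemma word_eq0 u : (size (word u) == 0) = (u == 1).
Proof. by rewrite size_eq0; apply/idP/idP => /eqP E; apply/eqP; [apply: val_inj|rewrite E]. Qed.

(* Otherwise the middle of [u] would read [l, l^-1], or be a letter equal to its inverse. *)
Lemma cancel_self u : u != 1 -> (cancel_len u u).*2 < size (word u).
Proof.
rewrite -word_eq0; case: u => u ru /=; rewrite /cancel_len /= => u0.
rewrite ltnNge; apply/negP => le; set c := lcp _ _ in le.
have [d _] : {d : letter n | d \in u} by case: (u) u0 => // d v _; exists d; apply: mem_head.
have cs : c <= size u by rewrite /c lcp_leqr.
have E k : k < c -> nth d u k = letter_inv (nth d u (size u - k.+1)).
  move=> kc; have ku : k < size u by exact: leq_trans kc cs.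
  rewrite -(nth_take d kc) -take_lcp nth_take // /word_inv nth_rev ?size_map //.
  by rewrite (nth_map d) //; lia.
have {ru} N k : k.+1 < size u -> nth d u k.+1 != letter_inv (nth d u k).
  by move: ru; rewrite /reduced => /(sortedP d) /[apply].
have [h hE] : exists h, size u = h.*2 \/ size u = h.*2.+1.
  by exists (size u)./2; move: (odd_double_half (size u)); case: odd; lia.
case: hE => hE.
  have := E h.-1; have := N h.-1.
  have -> : h.-1.+1 = h by lia.
  have -> : (size u - h = h)%N by lia.
  move=> /(_ ltac:(lia)) /eqP ne /(_ ltac:(lia)) E'.
  by apply: ne; rewrite E' letter_invK.
have := E h; have -> : (size u - h.+1 = h)%N by lia.
by move=> /(_ ltac:(lia)); case: nth => i [] [].
Qed.

Definition letter_code (l : letter n) : nat := l.1.*2 + l.2.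
(** The word read as a numeral in base 2n: on words of equal length this is the lexicographic order,
    made available for induction on natural numbers. *)
Fixpoint code s : nat :=
  if s is l :: s' then (letter_code l * n.*2 ^ size s' + code s')%N else 0.

Lemma code_cat s t : code (s ++ t) = (code s * n.*2 ^ size t + code t)%N.
Proof.
by elim: s => //= l s ->; rewrite size_cat expnD mulnDl mulnA addnA.
Qed.

Lemma letter_code_lt l : letter_code l < n.*2.
Proof. by rewrite /letter_code; have := ltn_ord l.1; case: l.2; lia. Qed.

Lemma code_lt s : code s < n.*2 ^ size s.
Proof.
elim: s => //= l s IH; apply: (@leq_trans ((letter_code l).+1 * n.*2 ^ size s)).
  by rewrite mulSn addnC ltn_add2r.
by rewrite expnS leq_mul2r letter_code_lt orbT.
Qed.

Lemma code_inj s t : size s = size t -> code s = code t -> s = t.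
Proof.
elim: s t => [|l s IH] [|m t] //= [st]; rewrite st => E.
have lt := code_lt s; have lt' := code_lt t; rewrite st in lt.
have B0 : 0 < n.*2 ^ size t by exact: leq_ltn_trans lt.
have lm : letter_code l = letter_code m.
  have := congr1 (divn^~ (n.*2 ^ size t)%N) E.
  by rewrite /= !divnMDl // !divn_small // !addn0.
have -> : l = m.
  move: l m lm {E} => [i a] [j b]; rewrite /letter_code /= => lm.
  have [ij ->] : i = j :> nat /\ a = b by move: lm; case: a; case: b => /=; lia.
  by rewrite (ord_inj ij).
by rewrite (IH t) //; move: E; rewrite lm => /addnI.
Qed.

Lemma code_cat_lt s s' t t' : size t = size t' -> code s < code s' ->
  code (s ++ t) < code (s' ++ t').
Proof.
move=> st ss; rewrite !code_cat st.
apply: (@leq_trans ((code s).+1 * n.*2 ^ size t')).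
  by rewrite mulSn addnC ltn_add2r -st code_lt.
by apply: leq_trans (leq_addr _ _); rewrite leq_mul2r ss orbT.
Qed.

Definition half_word s := take (uphalf (size s)) s.
(** Nielsen's tie-breaker for moves that keep the length. It adds the codes of the initial halves of
    [u] and of its inverse, the middle letter included, so that a basis element and its inverse
    count alike. *)
Definition half_code u := (code (half_word (word u)) + code (half_word (word u^-1)))%N.

Lemma half_codeV u : half_code u^-1 = half_code u.
Proof. by rewrite /half_code invgK addnC. Qed.

(* If [v = p q^-1] cancels exactly its half [p] against [u], then [u v] is obtained
   from [u] by replacing the final [p^-1] by [q^-1]. *)
Lemma half_code_mul u v : (cancel_len u v).*2 = size (word v) ->
  (cancel_len u v).*2 <= size (word u) ->
  code (take (cancel_len u v) (word v^-1)) < code (take (cancel_len u v) (word v)) ->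
  size (word (u * v)) = size (word u) /\ half_code (u * v) < half_code u.
Proof.
move=> cv cu; set c := cancel_len u v in cv cu *; move=> lt.
have sz : size (word (u * v)) = size (word u) by rewrite size_mul -/c; lia.
split=> //; rewrite /half_code -addnS; apply: leq_add.
  have hc : uphalf (size (word u)) <= size (word u) - c.
    by rewrite leq_uphalf_double; lia.
  apply: eq_leq; rewrite /half_word sz word_mul -/c takel_cat ?take_takel //.
  by rewrite size_takel ?leq_subr.
rewrite /half_word !size_inv sz invgM word_mul cancel_lenV -/c size_inv.
have uE : word u^-1 = take c (word v) ++ drop c (word u^-1).
  by rewrite -[take c (word v)]take_lcp cat_take_drop.
rewrite [X in _ < code (take _ X)]uE.
have -> : (size (word v) - c = c)%N by lia.
have c1 : size (take c (word v^-1)) = c by rewrite size_takel // size_inv; lia.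
have c2 : size (take c (word v)) = c by rewrite size_takel //; lia.
have ch : (uphalf (size (word u)) < c) = false.
  by apply/negbTE; rewrite -leqNgt -[c]uphalf_double uphalf_leq.
rewrite !take_cat c1 c2 ch.
by apply: code_cat_lt.
Qed.

End Cancellation.

(** * Descent to a Nielsen reduced basis *)

Section NielsenReduction.
Variable n : nat.
Local Notation F := (free_group n).
Local Notation x_ := (@free_gen n).
Implicit Types (f g : autgroup F) (y z w : letter n).

Inductive transvection_gen : autgroup F -> Prop :=
| Tgen1 : transvection_gen 1
| Tgen_rho i j : i != j -> transvection_gen (rho i j)
| Tgen_lam i j : i != j -> transvection_gen (lam i j)
| TgenM f g : transvection_gen f -> transvection_gen g -> transvection_gen (f * g)
| TgenV f : transvection_gen f -> transvection_gen f^-1.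

Lemma rhoVE i j k : i != j ->
  (rho i j)^-1 (x_ k) = if k == i then x_ i * (x_ j)^-1 else x_ k.
Proof.
move=> ij; apply: (bij_inj (aut_bij (rho i j))); rewrite -autM mulgV aut1.
case: eqP => [->|/eqP ki].
  by rewrite aut_morph aut_funV !rhoE // eqxx eq_sym (negPf ij) mulgK.
by rewrite rhoE // (negPf ki).
Qed.

Lemma lamVE i j k : i != j ->
  (lam i j)^-1 (x_ k) = if k == i then x_ j * x_ i else x_ k.
Proof.
move=> ij; apply: (bij_inj (aut_bij (lam i j))); rewrite -autM mulgV aut1.
case: eqP => [->|/eqP ki].
  by rewrite aut_morph !lamE // eqxx eq_sym (negPf ij) mulVKg.
by rewrite lamE // (negPf ki).
Qed.

Lemma free_letterE y : free_letter y = if y.2 then (x_ y.1)^-1 else x_ y.1.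
Proof. by case: y => i [] //=; rewrite -free_letterV. Qed.

(** Multiplying the inverse of [x_i] on the right amounts to multiplying [x_i] on the left, whence
    [lam] for inverse letters and [rho] for positive ones. *)
Lemma transvection_move y z : y.1 != z.1 ->
  exists t, [/\ transvection_gen t,
    t (free_letter y) = free_letter y * free_letter z &
    forall k, k != y.1 -> t (x_ k) = x_ k].
Proof.
case: y z => i a [j b] /= ij; rewrite !free_letterE /=.
exists (if a then if b then (lam i j)^-1 else lam i j
        else if b then (rho i j)^-1 else rho i j).
split.
- case: a; case: b;
    [exact/TgenV/Tgen_lam | exact: Tgen_lam | exact/TgenV/Tgen_rho | exact: Tgen_rho].
- case: a; case: b;
    rewrite 1?aut_funV; by [rewrite lamVE // eqxx invgM | rewrite lamE // eqxx invgM invgK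
      | rewrite rhoVE // eqxx | rewrite rhoE // eqxx].
- move=> k /negPf ki; case: a; case: b;
    by [rewrite lamVE // ki | rewrite lamE // ki | rewrite rhoVE // ki | rewrite rhoE // ki].
Qed.

Local Notation size_gen f i := (size (word (aut_fun f (x_ i)))).

Definition total_size f := (\sum_i size_gen f i)%N.
Definition total_code f := (\sum_i half_code (f (x_ i)))%N.

Lemma aut_letter_inv f y : f (free_letter (letter_inv y)) = (f (free_letter y))^-1.
Proof. by rewrite free_letterV aut_funV. Qed.

(** No single move y -> y z decreases the pair (length, [half_code]) lexicographically. Quantifying
    over letters instead of generators covers both signs and both sides of multiplication. *)
Definition reduced_basis f := forall y z, y.1 != z.1 ->
  let u := f (free_letter y) in let v := f (free_letter z) in
  size (word u) <= size (word (u * v)) /\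
  (size (word (u * v)) = size (word u) -> half_code u <= half_code (u * v)).

(** Lexicographic descent on ([total_size], [total_code]): the code may grow when the length drops,
    hence the nested induction. *)
Lemma reduced_basis_exists f :
  exists t, transvection_gen t /\ reduced_basis (f * t).
Proof.
move: {2}(total_size f).+1 (ltnSn (total_size f)) => a.
elim: a f => // a IHa f lta.
move: {2}(total_code f).+1 (ltnSn (total_code f)) => b.
elim: b f lta => // b IHb f lta ltb.
case: (pselect (reduced_basis f)) => [rf|].
  by exists 1; rewrite mulg1; split=> //; apply: Tgen1.
move=> /existsNP[y] /existsNP[z] /not_implyP[yz] /not_andP H.
have [t [tg ty tk]] := transvection_move yz.
have fty : (f * t) (free_letter y) = f (free_letter y) * f (free_letter z).
  by rewrite autM ty aut_morph.
(* Only the generator under [y] moves, so the total of any inversion-invariant [phi] changes by the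
   change of a single term. Used for the length and for [half_code]. *)
have sumE (phi : F -> nat) : (forall u, phi u^-1 = phi u) ->
    addn (\sum_i phi ((f * t)%g (x_ i))) (phi (f (free_letter y))) =
    addn (\sum_i phi (f (x_ i))) (phi (f (free_letter y) * f (free_letter z))%g).
  move=> phiV; have phiE (g : autgroup F) : phi (g (free_letter y)) = phi (g (x_ y.1)).
    by rewrite free_letterE; case: y.2; rewrite ?aut_funV ?phiV.
  rewrite -fty !phiE !(bigD1 y.1 (P := predT)) //=.
  rewrite [X in (_ + X + _)%N](eq_bigr (fun k => phi (f (x_ k)))) => [|k ky]; last first.
    by rewrite tk.
  by rewrite addnC addnAC addnA.
have eqs := sumE (fun u => size (word u)) (@size_inv n).
have eqc := sumE (@half_code n) (@half_codeV n).
rewrite -/(total_size f) -/(total_size (f * t)) in eqs.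
rewrite -/(total_code f) -/(total_code (f * t)) in eqc.
have [H1|[H1 H2]] : size (word (f (free_letter y) * f (free_letter z))) <
    size (word (f (free_letter y))) \/
    size (word (f (free_letter y) * f (free_letter z))) =
    size (word (f (free_letter y))) /\
    half_code (f (free_letter y) * f (free_letter z)) < half_code (f (free_letter y)).
  by case: H => [/negP|/not_implyP[? /negP]]; rewrite -ltnNge; [left|right].
  have [|t' [t'g rt']] := IHa (f * t); first by lia.
  by exists (t * t'); rewrite mulgA; split=> //; apply: TgenM.
have [||t' [t'g rt']] := IHb (f * t); [by lia|by lia|].
by exists (t * t'); rewrite mulgA; split=> //; apply: TgenM.
Qed.

Lemma free_letter_neq1 y : free_letter y != 1.
Proof. by rewrite -word_eq0. Qed.

Lemma aut_eq1 f u : (f u == 1) = (u == 1).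
Proof. by rewrite -{1}(aut_fun1 f) (bij_eq (aut_bij f)). Qed.

Section Reduced.
Variables (f : autgroup F) (rf : reduced_basis f).
Local Notation V y := (f (free_letter y)).

(** A product that loses more than half of one factor would shorten the other factor, against
    minimality for the pair [y], [z] or for their inverses in reverse order. For z = y the reason is
    [cancel_self]. *)
Lemma reduced_cancel y z : z != letter_inv y ->
  (cancel_len (V y) (V z)).*2 <= size (word (V y)) /\
  (cancel_len (V y) (V z)).*2 <= size (word (V z)).
Proof.
move=> ne; have [E|yz] := eqVneq y.1 z.1.
  have -> : z = y.
    move: y z ne E => [i a] [j b] /= ne ij; rewrite -{}ij in ne *.
    by move: ne; rewrite /letter_inv xpair_eqE eqxx; case: a; case: b.
  have lt := @cancel_self _ (V y) _.
  by split; apply/ltnW/lt; rewrite aut_eq1 free_letter_neq1.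
have [le _] := rf yz; rewrite eq_sym in yz.
have [le' _] := @rf (letter_inv z) (letter_inv y) yz.
move: le le'; rewrite !aut_letter_inv -invgM !size_inv !size_mul.
by have := cancel_leql (V y) (V z); have := cancel_leqr (V y) (V z); lia.
Qed.

Lemma reduced_cancel2_lt y z w : z != letter_inv y -> w != letter_inv z ->
  (cancel_len (V y) (V z)).*2 = size (word (V z)) ->
  (cancel_len (V z) (V w)).*2 = size (word (V z)) ->
  code (take (cancel_len (V y) (V z)) (word (V z)^-1)) <
  code (take (cancel_len (V y) (V z)) (word (V z))) -> False.
Proof.
move=> yz zw cy cw lt; have [cyy _] := reduced_cancel yz.
have [sz hc] := half_code_mul cy cyy lt.
have ne : y.1 != z.1.
  apply/eqP => E; have zE : z = y.
    move: y z yz E {cy cw lt cyy sz hc zw} => [i a] [j b] /= ne ij; rewrite -{}ij in ne *.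
    by move: ne; rewrite /letter_inv xpair_eqE eqxx; case: a; case: b.
  have := @cancel_self _ (V y); rewrite aut_eq1 free_letter_neq1 => /(_ isT).
  by rewrite -{2}zE cy zE ltnn.
by have [_ /(_ sz)] := rf ne; rewrite leqNgt hc.
Qed.

(** If [V z] were consumed by its neighbours, both cancellations would be exact halves, V z = p
    q^-1. If q precedes p, the move y -> y z lowers the code; if p precedes q, the move w^-1 -> w^-1
    z^-1 does; and p = q would make [V z] trivial. *)
Lemma reduced_cancel2 y z w : z != letter_inv y -> w != letter_inv z ->
  cancel_len (V y) (V z) + cancel_len (V z) (V w) < size (word (V z)).
Proof.
move=> yz zw; have [_ c1] := reduced_cancel yz; have [c2 _] := reduced_cancel zw.
rewrite ltnNge; apply/negP => le.
have cy : (cancel_len (V y) (V z)).*2 = size (word (V z)) by lia.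
have cw : (cancel_len (V z) (V w)).*2 = size (word (V z)) by lia.
have cE : cancel_len (V z) (V w) = cancel_len (V y) (V z) by lia.
case: (ltngtP (code (take (cancel_len (V y) (V z)) (word (V z)^-1)))
              (code (take (cancel_len (V y) (V z)) (word (V z))))) => lt.
- exact: reduced_cancel2_lt yz zw cy cw lt.
- have zw' : letter_inv z != letter_inv (letter_inv w).
    by rewrite letter_invK eq_sym.
  have yz' : letter_inv y != letter_inv (letter_inv z) by rewrite letter_invK eq_sym.
  apply: (reduced_cancel2_lt zw' yz'); rewrite !aut_letter_inv cancel_lenV ?size_inv //.
  by rewrite invgK cE.
- have V1 : V z != 1 by rewrite aut_eq1 free_letter_neq1.
  have := cancel_self V1; apply/negP; rewrite -leqNgt -cy leq_double.
  set c := cancel_len (V y) (V z) in cy lt *.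
  have : take c (word (V z)^-1) = take c (word (V z)).
    by apply: code_inj => //; rewrite !size_takel ?size_inv //; lia.
  have cs : c <= size (word (V z)) by rewrite cancel_leqr.
  rewrite /cancel_len; have := size_inv (V z); move: (word (V z)^-1) (word (V z)) cs.
  clear; clearbody c; elim: c => //= c IH [|x s] [|x' t] //= ct [st] [-> E].
  by rewrite eqxx ltnS; apply: IH.
Qed.

(** Every letter leaves at least one letter in the product, as no [V z] is swallowed between its
    neighbours. The surviving prefix is part of the statement because it determines the cancellation
    against a letter put in front. *)
Lemma word_reduced_basis y s (r : reduced (y :: s)) : exists rest,
  word (f (FreeGroup r)) = take (size (word (V y)) -
     (if s is z :: _ then cancel_len (V y) (V z) else 0)) (word (V y)) ++ rest
  /\ size s <= size rest.
Proof.
elim: s y r => [|z s IH] y r.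
  exists [::]; rewrite subn0 take_size cats0; split=> //.
  by congr (word (f _)); apply: val_inj.
have r' : reduced (z :: s) by exact: path_sorted r.
have yz : z != letter_inv y by move: r => /andP[].
have -> : FreeGroup r = free_letter y * FreeGroup r'.
  by apply: val_inj => /=; rewrite (negPf yz).
have [rest [WE szr]] := IH _ r'; rewrite aut_morph word_mul.
set d := (if s is _ :: _ then _ else _) in WE.
have cd : cancel_len (V y) (V z) + d < size (word (V z)).
  rewrite /d; clear WE; case: (s) r' => [|w s'] r'; last first.
    by apply: reduced_cancel2 => //; move: r' => /andP[].
  have [_] := reduced_cancel yz; rewrite addn0.
  have : 0 < size (word (V z)) by rewrite lt0n word_eq0 aut_eq1 free_letter_neq1.
  by lia.
have cE : cancel_len (V y) (f (FreeGroup r')) = cancel_len (V y) (V z).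
  by rewrite /cancel_len WE lcp_take_cat ?leq_subr // ltn_subRL addnC.
rewrite cE; eexists; split; first by [].
by rewrite size_drop WE size_cat size_takel ?leq_subr //=; clearbody d; lia.
Qed.

Lemma size_reduced_basis u : size (word u) <= size (word (f u)).
Proof.
case: u => -[|y s] r //=; have [rest [-> sr]] := word_reduced_basis r.
rewrite size_cat size_takel ?leq_subr // -add1n leq_add // subn_gt0.
have : 0 < size (word (V y)) by rewrite lt0n word_eq0 aut_eq1 free_letter_neq1.
case: s r {rest sr} => //= z s /andP[yz _].
by have [? _] := reduced_cancel yz; lia.
Qed.

(** A reduced basis never shortens a word, so the preimage of a generator has length at most one and
    is not empty. Thus [f] is a signed permutation of the generators. *)
Lemma reduced_basis_letter k : exists y, V y = x_ k.
Proof.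
have [g _ gK] := aut_bij f; have := size_reduced_basis (g (x_ k)); rewrite gK /=.
case E: (g (x_ k)) => [[|y [|]] r] //= _; last first.
  by exists y; rewrite -[RHS]gK E; congr (f _); apply: val_inj.
have := gK (x_ k); rewrite E (_ : FreeGroup r = 1) ?aut_fun1; last exact: val_inj.
by move=> /(congr1 (@word n)).
Qed.

End Reduced.

End NielsenReduction.

Lemma third_index n (i j : 'I_n) : 2 < n -> exists k, (i != k) && (j != k).
Proof.
move=> n3; have [k] : exists k, k \notin [set i; j].
  apply/existsP; apply: contraLR n3 => /existsPn all_in.
  rewrite -leqNgt -[n in n <= _]card_ord -cardsT.
  apply: (@leq_trans #|[set i; j]|); last by rewrite cards2; case: eqP.
  by apply/subset_leq_card/subsetP => k _; have := all_in k; rewrite negbK.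
by rewrite !inE negb_or [k == i]eq_sym [k == j]eq_sym; exists k.
Qed.

(** * Generation of SAut F_n by transvections *)

Section SpecialAut.
Variable n : nat.
Local Notation F := (free_group n).
Local Notation x_ := (@free_gen n).
Implicit Types (f g t : autgroup F) (y z w : letter n) (i j k : 'I_n).

Definition special_aut f := (\det (aut_mx f) == 1)%R.

Lemma special1 : special_aut 1.
Proof. by rewrite /special_aut aut_mx1 det1. Qed.

Lemma specialM f g : special_aut f -> special_aut g -> special_aut (f * g).
Proof. by rewrite /special_aut aut_mxM det_mulmx => /eqP-> /eqP->; rewrite mulr1. Qed.

Lemma aut_detV f : (\det (aut_mx f) * \det (aut_mx f^-1%g) = 1)%R.
Proof. by rewrite -det_mulmx -aut_mxM mulgV aut_mx1 det1. Qed.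

Lemma aut_det_neq0 f : (\det (aut_mx f) != 0)%R.
Proof. by apply: contra_eqN (aut_detV f) => /eqP->; rewrite mul0r. Qed.

Lemma specialV f : special_aut f -> special_aut f^-1.
Proof. by rewrite /special_aut => /eqP E; have := aut_detV f; rewrite E mul1r => ->. Qed.

(** [h] is a commutator of [f] and [g] up to conjugation, and determinants commute. The chain
    relations then give transvections determinant 1 without computing a matrix. *)
Lemma special_comm f g h : f * g = g * h * f -> special_aut h.
Proof.
move=> /(congr1 (fun a => \det (aut_mx a))%R); rewrite !aut_mxM !det_mulmx => E.
apply/eqP/(mulfI (aut_det_neq0 g))/(mulIf (aut_det_neq0 f)).
by rewrite -E mulr1 mulrC.
Qed.

Lemma special_rho i j : 2 < n -> i != j -> special_aut (rho i j).
Proof.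
move=> n3 ij; have [k /andP[ik jk]] := third_index i j n3.
by apply: special_comm (rho_rho_chain ik ij _); rewrite eq_sym.
Qed.

Lemma special_lam i j : 2 < n -> i != j -> special_aut (lam i j).
Proof.
move=> n3 ij; have [k /andP[ik jk]] := third_index i j n3.
by apply: special_comm (rho_lam_chain ik ij _); rewrite eq_sym.
Qed.

Lemma special_transvection_gen f : 2 < n -> transvection_gen f -> special_aut f.
Proof.
move=> n3; elim=> [|i j|i j|a b _ sa _|a _]; first exact: special1.
- exact: special_rho.
- exact: special_lam.
- exact: specialM.
- exact: specialV.
Qed.

Lemma transvection_gen_swp i j : i != j -> transvection_gen (swp i j).
Proof.
move=> ij; have ji : j != i by rewrite eq_sym.
have -> : swp i j = rho i j * (rho j i)^-1 * (lam i j)^-1.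
  by rewrite -swp_rho_lam // !mulgK.
by apply: TgenM (TgenV (Tgen_lam ij)); apply: TgenM (Tgen_rho ij) (TgenV (Tgen_rho ji)).
Qed.

Lemma transvection_gen_flip2 i j : i != j -> transvection_gen (flip2 i j).
Proof. by move=> ij; rewrite -swp_sqr //; apply: TgenM; apply: transvection_gen_swp. Qed.

Definition signed_basis f := forall k, exists y, f (free_letter y) = x_ k.

Lemma signed_basisM f t : signed_basis f ->
  (forall y, exists z, t (free_letter z) = free_letter y) -> signed_basis (f * t).
Proof.
by move=> sf st k; have [y <-] := sf k; have [z <-] := st y; exists z; rewrite autM.
Qed.

Lemma free_letter_inj : injective (@free_letter n).
Proof. by move=> y z /(congr1 (@word n)) [->]. Qed.

Lemma letter_surj t : (forall i, exists z, t (free_letter z) = x_ i) ->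
  forall y, exists z, t (free_letter z) = free_letter y.
Proof.
move=> st y; have [z zE] := st y.1; rewrite free_letterE.
exists (if y.2 then letter_inv z else z).
by case: y.2; rewrite ?aut_letter_inv zE.
Qed.

Lemma swp_letter_surj i j : i != j ->
  forall y, exists z, swp i j (free_letter z) = free_letter y.
Proof.
move=> ij; apply: letter_surj => k; have [->|ki] := eqVneq k i.
  exists (j, true); rewrite free_letterE /= aut_funV swpE // eq_sym (negPf ij) eqxx.
  by rewrite invgK.
have [->|kj] := eqVneq k j; first by exists (i, false); rewrite swpE // eqxx.
by exists (k, false); rewrite swpE // (negPf ki) (negPf kj).
Qed.

Lemma flip2_letter_surj i j :
  forall y, exists z, flip2 i j (free_letter z) = free_letter y.
Proof.
apply: letter_surj => k; exists (k, (k == i) || (k == j)).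
by rewrite free_letterE /=; case E: orb; rewrite ?aut_funV flip2E E ?invgK.
Qed.

Lemma fix_letter f i b : f (x_ i) = x_ i -> f (free_letter (i, b)) = free_letter (i, b).
Proof. by rewrite free_letterE; case: b => //= E; rewrite aut_funV E. Qed.

(** The generators are put in place one by one by signed swaps. The bound [m < n] leaves the last
    one out: a wrong sign is repaired together with the sign of a later generator, which must
    exist. *)
Lemma signed_basis_sort f m : signed_basis f -> m < n ->
  exists t, [/\ transvection_gen t, signed_basis (f * t) &
    forall i : 'I_n, i < m -> (f * t) (x_ i) = x_ i].
Proof.
move=> sf; elim: m => [_|m IH mn].
  by exists 1; rewrite mulg1; split=> //; apply: Tgen1.
have [t [tt st ft]] := IH (ltnW mn); pose k : 'I_n := Ordinal (ltnW mn).
suff [u [tu su]] : exists u, [/\ transvection_gen u,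
    forall y, exists z, u (free_letter z) = free_letter y,
    forall i : 'I_n, i < k -> u (x_ i) = x_ i &
    (f * t) (u (x_ k)) = x_ k].
  move=> fu uk; exists (t * u); rewrite mulgA; split; first exact: TgenM.
    exact: signed_basisM.
  move=> i; rewrite ltnS leq_eqVlt => /orP[/eqP im|im].
    by rewrite autM (_ : i = k) //; apply: val_inj.
  by rewrite autM fu // ft.
have [[j b] jE] := st k.
have kj : k <= j.
  rewrite leqNgt; apply/negP => jk; move: jE; rewrite fix_letter ?ft //.
  by move=> /free_letter_inj [E _]; move: jk; rewrite E ltnn.
have neq_lt (i : 'I_n) : i < k -> (i == k = false) * (i == j = false).
  move=> ik; split; apply/eqP => E; move: ik; rewrite E ?ltnn //.
  by rewrite ltnNge kj.
have [jk|nkj] := eqVneq k j; last first.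
  have njk : j != k by rewrite eq_sym.
  exists (if b then swp j k else swp k j).
  case: b jE => jE; split; do ?exact: transvection_gen_swp; do ?exact: swp_letter_surj.
  - by move=> i ik; rewrite swpE // !neq_lt.
  - by rewrite swpE // (negPf nkj) eqxx -free_letterV.
  - by move=> i ik; rewrite swpE // !neq_lt.
  - by rewrite swpE // eqxx.
rewrite -{}jk in jE *; case: b jE => jE; last first.
  exists 1; split=> //; first exact: Tgen1.
  by move=> y; exists y.
(* The image of [x_k] is right up to sign; the sign is passed on to the next generator, which is
   treated later. *)
pose k' : 'I_n := Ordinal mn.
have kk' : k != k' by rewrite -val_eqE /= neq_ltn ltnSn.
exists (flip2 k k'); split.
- exact: transvection_gen_flip2.
- exact: flip2_letter_surj.
- move=> i ik; rewrite flip2E neq_lt //= -val_eqE /= ltn_eqF //.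
  exact: ltn_trans ik (ltnSn m).
- by rewrite flip2E eqxx -free_letterV.
Qed.

(** After reduction and sorting only the sign of the last generator is undecided, and a wrong sign
    would make the determinant -1. *)
Lemma transvection_gen_special f : 2 < n -> special_aut f -> transvection_gen f.
Proof.
move=> n3 sf; have [t [tt rt]] := reduced_basis_exists f.
have n1 : n.-1 < n by lia.
have [u [tu su fu]] := signed_basis_sort (reduced_basis_letter rt) n1.
have tu1 : transvection_gen (t * u) by exact: TgenM.
rewrite -mulgA in su fu; move: {t u tt rt tu} (t * u) tu1 su fu => t tt st ft.
suff -> : f = t^-1 by exact: TgenV.
apply: (mulIg t); rewrite mulVg; set g := f * t in st ft *.
have sg : special_aut g by apply: specialM => //; apply: special_transvection_gen.
pose k : 'I_n := Ordinal n1.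
have kE (i : 'I_n) : i != k -> g (x_ i) = x_ i.
  by rewrite -val_eqE /= => ne; apply: ft; have := ltn_ord i; lia.
have [[j b] jE] := st k.
have {j} jE : g (free_letter (k, b)) = x_ k.
  have [jk|jk] := eqVneq j k; first by rewrite jk in jE.
  move: jE; rewrite fix_letter ?kE //.
  by move=> /free_letter_inj [E]; rewrite E eqxx in jk.
apply: aut_eq_gen => i; rewrite aut1; have [->|ik] := eqVneq i k; last exact: kE.
case: b jE => // jE.
have gk : g (x_ k) = (x_ k)^-1.
  by apply: invg_inj; rewrite invgK -[RHS]jE free_letterE aut_funV.
move: sg; rewrite /special_aut.
have -> : aut_mx g = diag_mx (\row_i (if i == k then -1 else 1))%R.
  apply/matrixP => a c; rewrite !mxE; have [->|ck] := eqVneq c k.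
    by rewrite gk exp_sumV exp_sum_gen !mxE andbT; case: eqP => //= ->; rewrite eqxx.
  rewrite kE // exp_sum_gen !mxE andbT; case: (eqVneq a c) => // ->.
  by rewrite (negPf ck).
rewrite det_diag (bigD1 k) //= mxE eqxx big1 ?mulr1 // => a ak.
by rewrite mxE (negPf ak).
Qed.

End SpecialAut.

(** * Lower bounds from transvections of order at least 3 *)

(* The relations between the right transvections [v j : x_0 |-> x_0 x_j] and
   [E i j : x_i |-> x_i x_j]. *)
Definition nielsen_family (gT : finGroupType) (T : finType) (v : T -> gT)
    (E : T -> T -> gT) :=
  (forall i j, i != j -> E i j * v i = v i * v j * E i j) /\
  (forall i j k, i != j -> k != i -> commute (E i j) (v k)).

Lemma card_class_cent1 (gT : finGroupType) (G : {group gT}) x :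
  #|G| = (#|x ^: G| * #|'C_G[x]|)%N.
Proof. by rewrite -index_cent1 mulnC Lagrange // subsetIl. Qed.

(** * Conjugacy classes in a Nielsen family *)

Section NielsenFamily.
Variables (gT : finGroupType) (T : finType) (v : T -> gT) (E : T -> T -> gT).
Hypothesis fam : nielsen_family v E.

Lemma family_conj i j : i != j -> v i ^ (E i j)^-1 = v i * v j.
Proof. by move=> ij; rewrite /conjg invgK mulgA (proj1 fam) // mulgK. Qed.

Lemma family_conjC i j k : i != j -> k != i -> v k ^ (E i j)^-1 = v k.
Proof.
by move=> ij ki; rewrite /conjg invgK mulgA ((proj2 fam) i j k ij ki) mulgK.
Qed.

Lemma family_conjI i j : i != j -> v i ^ E i j = v i * (v j)^-1.
Proof.
move=> ij; have ji : j != i by rewrite eq_sym.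
apply: (conjg_inj (E i j)^-1); rewrite conjgK conjMg conjVg.
by rewrite family_conj // family_conjC // // mulgK.
Qed.

Lemma family_conjCI i j k : i != j -> k != i -> v k ^ E i j = v k.
Proof. by move=> ij ki; rewrite -{1}(family_conjC ij ki) conjgKV. Qed.

(** The conjugates are v_i, v_i v_j, v_i v_j v_i^-1, v_j: the last conjugation removes the inner
    twist, so the family is a single orbit also when it does not commute. *)
Lemma family_swap i j : i != j -> v i ^ ((E i j)^-1 * E j i * v i) = v j.
Proof.
move=> ij; have ji : j != i by rewrite eq_sym.
rewrite !conjgM family_conj // [(v i * v j) ^ _]conjMg family_conjCI // family_conjI //.
by rewrite mulgA conjgE !mulgA mulgVK mulVg mul1g.
Qed.

Lemma family_order i j : #[v i] = #[v j].
Proof. by have [->//|ij] := eqVneq i j; rewrite -(family_swap ij) orderJ. Qed.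

Lemma family_expg1 i j x : v i ^+ x = 1 -> v j ^+ x = 1.
Proof. by move/eqP; rewrite -order_dvdn (family_order i j) order_dvdn => /eqP. Qed.

Lemma family_conjX i j x : i != j -> commute (v i) (v j) ->
  v i ^ ((E i j)^-1 ^+ x) = v i * v j ^+ x.
Proof.
move=> ij c; have ji : j != i by rewrite eq_sym.
elim: x => [|x IH]; first by rewrite conjg1 mulg1.
rewrite expgSr conjgM IH conjMg conjXg family_conj // family_conjC //.
by rewrite expgS mulgA.
Qed.

Lemma family_conjCX i j k x : i != j -> k != i -> v k ^ ((E i j)^-1 ^+ x) = v k.
Proof.
by move=> ij ki; elim: x => [|x IH]; rewrite ?conjg1 // expgSr conjgM IH family_conjC.
Qed.

Hypothesis abel : forall i j, commute (v i) (v j).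

(** The move v_i -> v_i v_j multiplies the relation by v_j^x, hence v_j^x = 1; all members have the
    same order, so v_i^x = 1 too. This is what makes an abelian row a direct product of cyclic
    groups. *)
Lemma family_indep2 i j x y : i != j -> v i ^+ x * v j ^+ y = 1 ->
  v i ^+ x = 1 /\ v j ^+ y = 1.
Proof.
move=> ij E1; have ji : j != i by rewrite eq_sym.
suff vi : v i ^+ x = 1 by rewrite vi mul1g in E1.
have := congr1 (conjg^~ (E i j)^-1) E1; rewrite /= conj1g conjMg !conjXg.
rewrite family_conj // family_conjC // expgMn //.
rewrite -mulgA -expgnDr addnC expgnDr mulgA E1 mul1g.
exact: family_expg1.
Qed.

Lemma family_indep3 i j k x y z : i != j -> i != k -> j != k ->
  v i ^+ x * v j ^+ y * v k ^+ z = 1 ->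
  [/\ v i ^+ x = 1, v j ^+ y = 1 & v k ^+ z = 1].
Proof.
move=> ij ik jk E1; have ji : j != i by rewrite eq_sym.
have ki : k != i by rewrite eq_sym.
suff vi : v i ^+ x = 1 by rewrite vi mul1g in E1; have [] := family_indep2 jk E1.
have := congr1 (conjg^~ (E i j)^-1) E1; rewrite /= conj1g !conjMg !conjXg.
rewrite family_conj // !family_conjC // expgMn //.
rewrite (commuteX2 x x (abel i j)) -!mulgA; rewrite -mulgA in E1; rewrite E1 mulg1.
exact: family_expg1.
Qed.

Lemma family_TI2 i j : i != j -> <[v i]> :&: <[v j]> = 1.
Proof.
move=> ij; apply/eqP; rewrite eqEsubset sub1set !inE !group1 !andbT.
apply/subsetP => x /setIP[/cycleP[a xa]]; rewrite -groupV inE.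
move=> /cycleP[b xb]; have [|vi _] := @family_indep2 i j a b ij.
  by rewrite -xa -xb mulgV.
by rewrite xa vi.
Qed.

Lemma family_TI3 i j k : i != j -> i != k -> j != k ->
  <[v i]> * <[v j]> :&: <[v k]> = 1.
Proof.
move=> ij ik jk; apply/eqP; rewrite eqEsubset sub1set !inE group1 andbT.
rewrite (_ : 1 \in _) ?andbT; last by rewrite -(mulg1 1) mem_mulg.
apply/subsetP => x /setIP[].
move=> /mulsgP[y z /cycleP[a ya] /cycleP[b zb] xE]; rewrite -groupV inE.
move=> /cycleP[c xc]; have [|vi vj _] := @family_indep3 i j k a b c ij ik jk.
  by rewrite -ya -zb -xE -xc mulgV.
by rewrite xE ya zb vi vj mulg1.
Qed.

Lemma card_cycle2 i j : i != j -> #|<[v i]> * <[v j]>| = (#[v i] ^ 2)%N.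
Proof.
move=> ij; rewrite TI_cardMg ?family_TI2 // -!orderE (family_order j i).
by rewrite mulnn.
Qed.

Lemma cycle_mulC i j : <[v i]> * <[v j]> = <[v j]> * <[v i]>.
Proof. by apply: centC; rewrite cent_cycle cycle_subG; apply/cent1P. Qed.

Lemma card_cycle3 i j k : i != j -> i != k -> j != k ->
  #|<[v i]> * <[v j]> * <[v k]>| = (#[v i] ^ 3)%N.
Proof.
move=> ij ik jk; have := family_TI3 ij ik jk.
have gs : group_set (<[v i]> * <[v j]>) by apply/comm_group_setP/cycle_mulC.
pose H := Group gs; move=> TI; have := @TI_cardMg _ H <[v k]>%G TI; rewrite /= => ->.
by rewrite card_cycle2 // -orderE (family_order k i) [RHS]expnSr.
Qed.

Lemma leq_class_line (Y : {group gT}) i j : i != j -> E i j \in Y ->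
  #[v i] <= #|v i ^: Y|.
Proof.
move=> ij EY; rewrite (family_order i j) orderE -(card_lcoset _ (v i)).
apply/subset_leq_card/subsetP => x /lcosetP[_ /cycleP[a ->] ->].
by rewrite -family_conjX // memJ_class // groupX // groupV.
Qed.

Lemma class_plane_sub (Y : {group gT}) i j k : i != j -> i != k -> j != k ->
  E i j \in Y -> E i k \in Y -> v i *: (<[v j]> * <[v k]>) \subset v i ^: Y.
Proof.
move=> ij ik jk EY EY'.
apply/subsetP => x /lcosetP[_ /mulsgP[_ _ /cycleP[a ->] /cycleP[b ->] ->] ->].
have ji : j != i by rewrite eq_sym.
have -> : v i * (v j ^+ a * v k ^+ b) = v i ^ ((E i k)^-1 ^+ b * (E i j)^-1 ^+ a).
  rewrite conjgM family_conjX // conjMg family_conjX // conjXg family_conjCX // 1?eq_sym //.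
  by rewrite mulgA.
by rewrite memJ_class // groupM // groupX // groupV.
Qed.

Lemma leq_class_plane (Y : {group gT}) i j k : i != j -> i != k -> j != k ->
  E i j \in Y -> E i k \in Y -> #[v i] ^ 2 <= #|v i ^: Y|.
Proof.
move=> ij ik jk EY EY'; rewrite (family_order i j) -(card_cycle2 jk) -(card_lcoset _ (v i)).
exact/subset_leq_card/class_plane_sub.
Qed.

Lemma family_notin i j : i != j -> 1 < #[v i] -> v j \notin v i *: <[v j]>.
Proof.
move=> ij v1; apply/negP => /lcosetP[_ /cycleP[a ->] vjE].
have vi : v i \in <[v i]> :&: <[v j]>.
  rewrite inE cycle_id /= (_ : v i = v j * (v j ^+ a)^-1); last by rewrite [X in X * _]vjE mulgK.
  by rewrite groupM ?groupV ?mem_cycle ?cycle_id.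
by move: vi v1; rewrite family_TI2 // => /set1P ->; rewrite order1.
Qed.

Section InGroup.
Variable X : {group gT}.
Hypothesis vX : forall i, v i \in X.
Hypothesis EX : forall i j, i != j -> E i j \in X.

Lemma family_class i j : v j \in v i ^: X.
Proof.
have [->|ij] := eqVneq j i; first exact: class_refl.
have ji : i != j by rewrite eq_sym.
rewrite -(family_swap ji) memJ_class // !groupM ?groupV //; exact: EX.
Qed.

(** The class contains the coset v_i <v_j> and, outside it, the conjugate [v j]. This extra element
    makes the factor at least 3 rather than 2. *)
Lemma leq_class_line1 i j : i != j -> 1 < #[v i] -> #[v i] < #|v i ^: X|.
Proof.
move=> ij v1; have := family_notin ij v1.
rewrite -[X in X < _](family_order j i) [#[v j]]orderE -(card_lcoset _ (v i)).
move=> notin; rewrite -add1n -[1%N]/(nat_of_bool true) -notin -cardsU1.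
apply/subset_leq_card; rewrite subUset sub1set family_class /=.
apply/subsetP => x /lcosetP[_ /cycleP[a ->] ->].
by rewrite -family_conjX // memJ_class // groupX // groupV EX.
Qed.

Lemma leq_class_plane1 i j k : i != j -> i != k -> j != k -> 1 < #[v i] ->
  #[v i] ^ 2 < #|v i ^: X|.
Proof.
move=> ij ik jk v1; rewrite (family_order i j) -(card_cycle2 jk) -(card_lcoset _ (v i)).
have notin : v j \notin v i *: (<[v j]> * <[v k]>).
  apply/negP => /lcosetP[_ /mulsgP[_ _ /cycleP[a ->] /cycleP[b ->] ->] vjE].
  have kj : k != j by rewrite eq_sym. 
  have : v i \in <[v j]> * <[v k]> :&: <[v i]>.
    rewrite inE cycle_id andbT; apply/mulsgP.
    exists (v j * (v j ^+ a)^-1) ((v k ^+ b)^-1).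
    - by rewrite groupM ?groupV ?mem_cycle ?cycle_id.
    - by rewrite groupV mem_cycle.
    - rewrite -mulgA -invgM (commuteX2 b a (abel k j)); apply: (mulIg (v j ^+ a * v k ^+ b)).
      by rewrite mulgVK -vjE.
  rewrite family_TI3 // 1?eq_sym // => /set1P v0.
  by move: v1; rewrite v0 order1.
rewrite -add1n -[1%N]/(nat_of_bool true) -notin -cardsU1.
apply/subset_leq_card; rewrite subUset sub1set family_class /=.
by apply: class_plane_sub => //; apply: EX.
Qed.

Lemma family_inv_class i j : i != j -> (v i)^-1 \in v i ^: X.
Proof.
move=> ij; have ji : j != i by rewrite eq_sym.
have /class_eqP <- := family_class i j.
have -> : (v i)^-1 = v j ^ (E j i * (E i j)^-1).
  rewrite conjgM family_conjI // [(v j * _) ^ _]conjMg conjVg family_conj // family_conjC //.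
  by rewrite invgM mulVKg.
by rewrite memJ_class // groupM ?groupV ?EX.
Qed.

(** Three disjoint pieces of the class: the coset v_i <v_j>, its inverse, and [v j]. They account
    for 2k + 1 elements. *)
Lemma leq_class_line2 i j : i != j -> 2 < #[v i] -> (#[v i]).*2 < #|v i ^: X|.
Proof.
move=> ij v2; have ji : j != i by rewrite eq_sym.
have v1 : 1 < #[v i] by apply: ltnW.
have sub : v i *: <[v j]> \subset v i ^: X.
  apply/subsetP => x /lcosetP[_ /cycleP[a ->] ->].
  by rewrite -family_conjX // memJ_class // groupX // groupV EX.
have cL : #|v i *: <[v j]>| = #[v i] by rewrite card_lcoset -orderE; apply: family_order.
(* A common element would give v_i^2 v_j^(a+b) = 1, hence v_i^2 = 1 by independence, against order
   above 2. *)
have dis : [disjoint v i *: <[v j]> & (v i *: <[v j]>)^-1].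
  apply/pred0P => x /=; apply/negbTE/negP => /andP[].
  move=> /lcosetP[_ /cycleP[a ->] ->]; rewrite inE => /lcosetP[_ /cycleP[b ->]] xE.
  have : v i ^+ 2 * v j ^+ (a + b) = 1.
    have -> : v i ^+ 2 * v j ^+ (a + b) = (v i * v j ^+ a) * (v i * v j ^+ b).
      have C : commute (v i) (v j ^+ a) by apply/commuteX/abel.
      by rewrite expgnDr expg2 -!mulgA [v i * (v j ^+ a * _)]mulgA C -!mulgA.
    by rewrite -xE mulgV.
  move=> /(family_indep2 ij)[/eqP]; rewrite -order_dvdn => /dvdn_leq.
  by move=> /(_ isT); rewrite leqNgt v2.
have subV : (v i *: <[v j]>)^-1 \subset v i ^: X.
  have /class_eqP <- := family_inv_class ij; rewrite classVg.
  by rewrite invSg.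
have notin : v j \notin (v i *: <[v j]>) :|: (v i *: <[v j]>)^-1.
  rewrite inE (negPf (family_notin ij v1)) inE /=; apply/negP => /lcosetP[_ /cycleP[a ->]] vjE.
  have : v i ^+ 1 * v j ^+ a.+1 = 1 by rewrite expg1 expgSr mulgA -vjE mulVg.
  by move=> /(family_indep2 ij)[vi1 _]; move: v1; rewrite -[v i]expg1 vi1 order1.
rewrite -addnn -{1}cL -cL -{2}card_invg.
move: dis; rewrite -leq_card_setU => /eqP <-.
rewrite -add1n -[1%N]/(nat_of_bool true) -notin -cardsU1.
by apply/subset_leq_card; rewrite !subUset sub1set family_class sub subV.
Qed.

(** Orbit counting for the pair: [v i] has more than k conjugates, and then [E j i], which fixes
    [v i], still moves [v j] through k values. *)
Lemma card_pair i j : i != j -> 1 < #[v i] ->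
  (#[v i]).+1 * #[v i] * #|'C_('C_X[v i])[v j]| <= #|X|.
Proof.
move=> ij v1; have ji : j != i by rewrite eq_sym.
rewrite (card_class_cent1 X (v i)) -mulnA leq_mul ?(leq_class_line1 ij) //.
rewrite (card_class_cent1 'C_X[v i] (v j)) leq_mul // (family_order i j).
apply: (leq_class_line ji); rewrite inE EX //; apply/cent1P.
by apply: (proj2 fam).
Qed.

Lemma card_pair2 i j : i != j -> 2 < #[v i] ->
  (#[v i]).*2.+1 * #[v i] * #|'C_('C_X[v i])[v j]| <= #|X|.
Proof.
move=> ij v1; have ji : j != i by rewrite eq_sym.
rewrite (card_class_cent1 X (v i)) -mulnA leq_mul ?(leq_class_line2 ij) //.
rewrite (card_class_cent1 'C_X[v i] (v j)) leq_mul // (family_order i j).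
apply: (leq_class_line ji); rewrite inE EX //; apply/cent1P.
by apply: (proj2 fam).
Qed.

(** Each basis vector in turn ranges over a plane of k^2 values under moves that fix the vectors
    already placed; the first class has one further element. *)
Lemma card_triple i j k : i != j -> i != k -> j != k -> 1 < #[v i] ->
  (#[v i] ^ 2).+1 * #[v i] ^ 4 * #|'C_('C_('C_X[v i])[v j])[v k]| <= #|X|.
Proof.
move=> ij ik jk v1.
have ji : j != i by rewrite eq_sym.
have ki : k != i by rewrite eq_sym.
have kj : k != j by rewrite eq_sym.
have C a b c : a != b -> c != a -> E a b \in 'C[v c].
  by move=> ab ca; apply/cent1P; apply: (proj2 fam).
rewrite (card_class_cent1 X (v i)) -mulnA leq_mul ?(leq_class_plane1 ij ik jk) //.
rewrite (card_class_cent1 'C_X[v i] (v j)) (expnD _ 2 2) -mulnA leq_mul //.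
  rewrite (family_order i j); apply: (leq_class_plane ji jk ik);
  by rewrite inE EX // C.
rewrite (card_class_cent1 'C_('C_X[v i])[v j] (v k)) leq_mul // (family_order i k).
by apply: (leq_class_plane ki kj ij); rewrite 2!inE EX // !C.
Qed.

End InGroup.

End NielsenFamily.

(** * Central indices and products with centralisers *)

Lemma three_primes_ge30 k : 2 < size (primes k) -> 30 <= k.
Proof.
have small : all (fun k => size (primes k) <= 2) (iota 0 30) by vm_compute.
rewrite leqNgt => k3; rewrite leqNgt; apply: contra k3 => k30.
by apply: (allP small); rewrite mem_iota.
Qed.

(** The order has three distinct prime divisors, and 30 = 2 . 3 . 5 is the least such number. *)
Lemma nonsolvable_ge30 (gT : finGroupType) (A : {group gT}) : ~~ solvable A -> 30 <= #|A|.
Proof.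
move=> nsA; apply: three_primes_ge30; rewrite ltnNge.
by apply: contra nsA => /Burnside_p_a_q_b.
Qed.

Section CentralIndex.
Variable gT : finGroupType.
Implicit Types A B G : {group gT}.

(** If A / Z(A) were solvable, so would be A, and a perfect solvable group is trivial. *)
Lemma perfect_index_center A : A \subset A^`(1) -> A :!=: 1 -> 30 <= #|A : 'Z(A)|.
Proof.
move=> pA A1; rewrite -card_quotient ?normal_norm ?center_normal //.
apply: nonsolvable_ge30; apply: contra A1 => solAZ.
have solA : solvable A.
  by rewrite (series_sol (center_normal A)) abelian_sol ?center_abelian.
apply: contraLR pA => A1; have /andP[] := sol_der1_proper solA (subxx A) A1.
by [].
Qed.

(** The intersection of commuting [A] and [B] is central in [A], so at least |A : Z(A)| survives in
    the product. This is how commuting copies are counted although they may overlap. *)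
Lemma commuting_card_mulG A B : B \subset 'C(A) ->
  (#|A : 'Z(A)| * #|B|)%N <= #|A * B|.
Proof.
move=> cAB; rewrite -(leq_pmul2r (cardG_gt0 'Z(A))) mulnAC.
have -> : (#|A : 'Z(A)| * #|'Z(A)| = #|A|)%N by rewrite mulnC Lagrange ?center_sub.
rewrite mul_cardG leq_mul2l subset_leq_card ?orbT //.
by rewrite subsetI subsetIl /= (subset_trans (subsetIr _ _)).
Qed.

Lemma card_mul_centraliser A G : A \subset G ->
  #|A * 'C_G(A)| = (#|A : 'Z(A)| * #|'C_G(A)|)%N.
Proof.
move=> sAG; apply/eqP; rewrite -(eqn_pmul2r (cardG_gt0 'Z(A))) [X in _ == X]mulnAC.
have -> : (#|A : 'Z(A)| * #|'Z(A)| = #|A|)%N by rewrite mulnC Lagrange ?center_sub.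
by rewrite mul_cardG /center setIA (setIidPl sAG).
Qed.

Lemma mul_centraliser_leq A G : A \subset G -> #|A * 'C_G(A)| <= #|G|.
Proof. by move=> sAG; rewrite subset_leq_card // mul_subG // subsetIl. Qed.

End CentralIndex.

(** * The group generated by a Nielsen family, and its quotients *)

Section FamilyGroup.
Variables (gT : finGroupType) (T : finType) (v : T -> gT) (E : T -> T -> gT).
Hypothesis fam : nielsen_family v E.
Variable G : {group gT}.
Hypothesis vG : forall i, v i \in G.
Hypothesis EG : forall i j, i != j -> E i j \in G.

Definition family_group := <<v @: T>>.
Local Notation M := family_group.
Canonical family_group_group := Eval hnf in [group of M].

Lemma mem_family i : v i \in M.
Proof. by rewrite mem_gen // imset_f. Qed.

Lemma family_group_sub (H : {group gT}) : (forall i, v i \in H) -> M \subset H.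
Proof. by move=> vH; rewrite gen_subG; apply/subsetP => _ /imsetP[i _ ->]. Qed.

Lemma family_subG : M \subset G. Proof. exact: family_group_sub. Qed.

Lemma family_norm i j : i != j -> E i j \in 'N(M).
Proof.
move=> ij; rewrite -groupV inE -genJ gen_subG.
apply/subsetP => _ /imsetP[_ /imsetP[k _ ->] ->].
have [->|ki] := eqVneq k i; first by rewrite family_conj // groupM ?mem_family.
by rewrite family_conjC // mem_family.
Qed.

Lemma family_abelian : reflect (forall i j, commute (v i) (v j)) (abelian M).
Proof.
apply: (iffP idP) => [aM i j|cv]; first by apply: (centsP aM); apply: mem_family.
rewrite /abelian cent_gen; apply: family_group_sub => i.
by apply/centP => _ /imsetP[j _ ->]; apply: cv.
Qed.

Section Quotient.
Variable L : {group gT}.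
Hypothesis nML : M \subset 'N(L).
Hypothesis nEL : forall i j, i != j -> E i j \in 'N(L).

Definition fam_quo i := coset L (v i).
Definition famE_quo i j := coset L (E i j).

Let vN i : v i \in 'N(L). Proof. exact: (subsetP nML _ (mem_family i)). Qed.

Lemma family_quotient : nielsen_family fam_quo famE_quo.
Proof.
split=> [i j ij|i j k ij ki]; rewrite /commute /fam_quo /famE_quo.
  by rewrite -!morphM ?groupM ?nEL ?vN // (proj1 fam).
by rewrite -!morphM ?groupM ?nEL ?vN // (proj2 fam _ _ _ ij ki).
Qed.

Lemma family_quo_abel : M^`(1) \subset L -> forall i j, commute (fam_quo i) (fam_quo j).
Proof.
move=> M'L i j; have := sub_der1_abelian M'L; move/centsP; apply.
  by rewrite mem_quotient ?mem_family.
by rewrite mem_quotient ?mem_family.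
Qed.

Lemma family_quo_mem i : fam_quo i \in 'N_G(L) / L.
Proof. by rewrite mem_quotient // inE vG vN. Qed.

Lemma family_quoE_mem i j : i != j -> famE_quo i j \in 'N_G(L) / L.
Proof. by move=> ij; rewrite mem_quotient // inE EG ?nEL. Qed.

(** All images have the same order, so a single trivial one would put the whole of [M] inside
    [L]. *)
Lemma family_quo_order i : ~~ (M \subset L) -> 1 < #[fam_quo i].
Proof.
apply: contraNT; rewrite -leqNgt => o1.
have all1 j : fam_quo j = 1.
  apply/eqP; rewrite -order_eq1 eqn_leq order_gt0 andbT.
  by rewrite (family_order family_quotient j i).
by apply: family_group_sub => j; apply: coset_idr; [apply: vN | apply: all1].
Qed.

Lemma family_quo_order2 i : v i ^+ 2 \notin L -> 2 < #[fam_quo i].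
Proof.
move=> vi; rewrite ltnNge; apply: contra vi => o2.
have : fam_quo i ^+ 2 = 1.
  apply/eqP; rewrite -order_dvdn; move: o2 (order_gt0 (fam_quo i)).
  by case: #[_] => [|[|[|]]].
by rewrite -morphX // => /coset_idr; apply; rewrite groupX.
Qed.

Lemma index_family2 i j : M^`(1) \subset L -> i != j -> #[fam_quo i] ^ 2 <= #|M : L|.
Proof.
move=> M'L ij; rewrite -(card_cycle2 family_quotient (family_quo_abel M'L) ij).
rewrite -card_quotient //; apply/subset_leq_card/mul_subG;
  by rewrite cycle_subG mem_quotient ?mem_family.
Qed.

Lemma index_family3 i j k : M^`(1) \subset L -> i != j -> i != k -> j != k ->
  #[fam_quo i] ^ 3 <= #|M : L|.
Proof.
move=> M'L ij ik jk; rewrite -(card_cycle3 family_quotient (family_quo_abel M'L) ij ik jk).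
rewrite -card_quotient //; apply/subset_leq_card/mul_subG; first apply: mul_subG;
  by rewrite cycle_subG mem_quotient ?mem_family.
Qed.

End Quotient.

Lemma family_norm_char (L : {group gT}) : L \char M ->
  M \subset 'N(L) /\ forall i j, i != j -> E i j \in 'N(L).
Proof.
move=> cL; split; first by rewrite normal_norm ?char_normal.
by move=> i j ij; apply: (subsetP (char_norms cL)); apply: family_norm.
Qed.

(* [M * C_G(M)] acts trivially on [M / M'], so it lies in the stabiliser of the
   basis [v] modulo [M']. *)
Lemma centraliser_quotient_leq d (H : {group coset_of M^`(1)}) :
  (forall x, x \in (M * 'C_G(M)) / M^`(1) -> x \in H) ->
  (d * #|H|)%N <= #|'N_G(M^`(1)) / M^`(1)| -> (d * #|M * 'C_G(M)|%g)%N <= #|G|.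
Proof.
move=> sub; set L := M^`(1)%G.
have [nML _] := family_norm_char (der_char 1 M).
have LM : L \subset M by apply: der_sub.
have LN : L \subset 'N_G(L) by rewrite subsetI (subset_trans LM family_subG) normG.
have nC : 'C_G(M) \subset 'N(L).
  by rewrite (subset_trans (subsetIr _ _)) // (subset_trans (centS LM)) ?cent_sub.
have eqM : M * 'C_G(M) = M <*> 'C_G(M) by rewrite cent_joinEr ?subsetIr.
have nMC : M <*> 'C_G(M) \subset 'N(L) by rewrite join_subG nML nC.
have LMC : L \subset M <*> 'C_G(M) by rewrite (subset_trans LM) ?joing_subl.
rewrite card_quotient ?subsetIr // => le.
rewrite (@leq_trans #|'N_G(L)|) ?subset_leq_card ?subsetIl //.
rewrite -(Lagrange LN) eqM -(Lagrange LMC) mulnCA leq_mul2l (leq_trans _ le) ?orbT //.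
rewrite leq_mul2l -card_quotient // subset_leq_card ?orbT //.
by apply/subsetP => x xC; apply: sub; rewrite eqM.
Qed.

Lemma mem_centraliser_quotient x i :
  x \in (M * 'C_G(M)) / M^`(1) -> x \in 'C[coset M^`(1) (v i)].
Proof.
have [nML _] := family_norm_char (der_char 1 M).
have LM : M^`(1) \subset M by apply: der_sub.
case/morphimP => y _ /mulsgP[m c mM /setIP[_ cC] ->] ->.
have cN : c \in 'N(M^`(1)).
  by apply: (subsetP _ _ cC); rewrite (subset_trans (centS LM)) ?cent_sub.
have mN := subsetP nML _ mM; have vN := subsetP nML _ (mem_family i).
apply/cent1P; rewrite morphM // /commute -mulgA.
have cv : commute (coset M^`(1) c) (coset M^`(1) (v i)).
  rewrite /commute -!morphM //; congr coset.
  by apply: (centP cC); apply: mem_family.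
have cm : commute (coset M^`(1) m) (coset M^`(1) (v i)).
  by apply: (centsP (sub_der1_abelian (subxx _))); rewrite mem_quotient ?mem_family.
by rewrite cv mulgA cm -mulgA.
Qed.

(** The factor is (k + 1) k with k = 2, the least possible order of the generators modulo M'. *)
Lemma nonperfect_family2 (i j : T) : i != j -> ~~ (M \subset M^`(1)) ->
  (6 * #|M * 'C_G(M)|%g)%N <= #|G|.
Proof.
move=> ij npM; have [nML nEL] := family_norm_char (der_char 1 M).
have Qf := family_quotient (L := M^`(1)) nML nEL.
have ab := family_quo_abel (L := M^`(1)) (subxx _).
have k1 := family_quo_order (L := M^`(1)) nML nEL i npM.
have := card_pair Qf ab (family_quo_mem (L := M^`(1)) nML)
  (family_quoE_mem (L := M^`(1)) nEL) ij k1.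
rewrite -/(fam_quo _ _) => le.
apply: (@centraliser_quotient_leq _ ('C_('C_('N_G(M^`(1)) / M^`(1))[fam_quo M^`(1) i])[fam_quo M^`(1) j])%G).
  move=> x xM; rewrite 2!inE !(mem_centraliser_quotient _ xM) !andbT.
  have LM : M^`(1) \subset M by apply: der_sub.
  move: x xM; apply/subsetP/quotientS; rewrite subsetI mul_subG ?family_subG ?subsetIl //=.
  rewrite mul_subG // (subset_trans (subsetIr _ _)) // (subset_trans (centS LM)) //.
  exact: cent_sub.
apply: leq_trans le; rewrite leq_mul2r; apply/orP; right.
by apply: (@leq_trans (3 * 2)%N) => //; apply: leq_mul.
Qed.

(** The factor 80 is (k^2 + 1) k^4 at k = 2, the count of triples modulo M'. *)
Lemma nonperfect_family3 (i j k : T) : i != j -> i != k -> j != k ->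
  ~~ (M \subset M^`(1)) -> (80 * #|M * 'C_G(M)|%g)%N <= #|G|.
Proof.
move=> ij ik jk npM; have [nML nEL] := family_norm_char (der_char 1 M).
have Qf := family_quotient (L := M^`(1)) nML nEL.
have ab := family_quo_abel (L := M^`(1)) (subxx _).
have k1 := family_quo_order (L := M^`(1)) nML nEL i npM.
have := card_triple Qf ab (family_quo_mem (L := M^`(1)) nML)
  (family_quoE_mem (L := M^`(1)) nEL) ij ik jk k1.
rewrite -!/(fam_quo _ _) => le.
apply: (@centraliser_quotient_leq _ ('C_('C_('C_('N_G(M^`(1)) / M^`(1))[fam_quo M^`(1) i])[fam_quo M^`(1) j])[fam_quo M^`(1) k])%G).
  move=> x xM; rewrite 3!inE !(mem_centraliser_quotient _ xM) !andbT.
  have LM : M^`(1) \subset M by apply: der_sub.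
  move: x xM; apply/subsetP/quotientS; rewrite subsetI mul_subG ?family_subG ?subsetIl //=.
  rewrite mul_subG // (subset_trans (subsetIr _ _)) // (subset_trans (centS LM)) //.
  exact: cent_sub.
apply: leq_trans le; rewrite leq_mul2r; apply/orP; right.
by apply: (@leq_trans ((2 ^ 2).+1 * 2 ^ 4)%N) => //; rewrite leq_mul // ?ltnS ?leq_exp2r.
Qed.

End FamilyGroup.

(** * Lower bounds for the order of the ambient group *)

Section FamilyBounds.
Variables (gT : finGroupType) (T : finType) (v : T -> gT) (E : T -> T -> gT).
Hypothesis fam : nielsen_family v E.
Variable G : {group gT}.
Hypothesis vG : forall i, v i \in G.
Hypothesis EG : forall i j, i != j -> E i j \in G.
Local Notation M := (family_group v).
Implicit Types i j k : T.

Lemma commute_conj (x y z : gT) : commute x y -> commute (x ^ z) (y ^ z).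
Proof. by move=> xy; rewrite /commute -!conjMg xy. Qed.

(** The move v_i -> v_i v_j fixes [v k], so [v k] commutes with v_i v_j as well as with v_i. Hence
    one commuting pair makes the whole family abelian. *)
Lemma commute_family i j k : i != j -> i != k -> j != k ->
  commute (v i) (v k) -> commute (v j) (v k).
Proof.
move=> ij ik jk cik; have ki : k != i by rewrite eq_sym.
have := commute_conj (E i j)^-1 cik; rewrite family_conj // family_conjC // => c.
by rewrite -[v j](mulKg (v i)); apply/commute_sym/commuteM; [apply: commuteV|]; apply/commute_sym.
Qed.

Lemma abelian_family i j : i != j -> commute (v i) (v j) -> abelian M.
Proof.
move=> ij cij; apply/family_abelian => a b.
have all_j c : commute (v c) (v j).
  have [->|ci] := eqVneq c i; first by [].
  have [->|cj] := eqVneq c j; first by [].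
  by apply: commute_family cij; rewrite // eq_sym.
have [->//|ab] := eqVneq a b.
have [->|aj] := eqVneq a j; first by apply/commute_sym.
have [->|bj] := eqVneq b j; first by [].
by apply: (@commute_family j) => //; try rewrite eq_sym //; apply/commute_sym.
Qed.

Lemma abelian_family_bound2 i j : abelian M -> i != j -> 2 < #[v i] ->
  ((#[v i]).*2.+1 * #[v i] * #[v i] ^ 2)%N <= #|G|.
Proof.
move=> /[dup] abM /family_abelian ab ij o2.
apply: leq_trans (card_pair2 fam ab vG EG ij o2); rewrite leq_mul2l; apply/orP; right.
rewrite -(card_cycle2 fam ab ij); apply/subset_leq_card/mul_subG;
  by rewrite cycle_subG !in_setI vG; do !(apply/andP; split) => //; apply/cent1P.
Qed.

Lemma abelian_family_bound3 i j k : abelian M -> i != j -> i != k -> j != k ->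
  1 < #[v i] -> ((#[v i] ^ 2).+1 * #[v i] ^ 4 * #[v i] ^ 3)%N <= #|G|.
Proof.
move=> /[dup] abM /family_abelian ab ij ik jk o1.
apply: leq_trans (card_triple fam ab vG EG ij ik jk o1); rewrite leq_mul2l; apply/orP; right.
rewrite -(card_cycle3 fam ab ij ik jk); apply/subset_leq_card/mul_subG; first apply: mul_subG;
  by rewrite cycle_subG !in_setI vG; do !(apply/andP; split) => //; apply/cent1P.
Qed.

Lemma family_derived_gt1 : ~~ abelian M -> (1 < #|M^`(1)|).
Proof. by move=> nab; rewrite cardG_gt1; apply: contra nab => /eqP M1; apply/derG1P. Qed.

(** 192 = 6 . 4 . 8: six conjugates of the basis modulo M', central index at least 4 as M / Z(M) is
    not cyclic, and a commuting copy of order at least |M : M'| |M'| = 4 . 2. A perfect [M] gives 30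
    . 30 instead. *)
Lemma nonabelian_family_bound2 (A : {group gT}) i j : ~~ abelian M -> i != j ->
  A \subset 'C_G(M) -> #|A| = #|M| -> 192 <= #|G|.
Proof.
move=> nab ij cAM cardA; have sMG := family_subG vG.
have q4 : 4 <= #|M : 'Z(M)|.
  rewrite leqNgt; apply: contra nab => q3.
  rewrite -card_quotient ?normal_norm ?center_normal // in q3.
  apply/cyclic_center_factor_abelian; move: q3 (cardG_gt0 (M / 'Z(M))).
  case c: #|_| => [|[|[|[|]]]] // _ _; last 2 first.
  - by apply: prime_cyclic; rewrite c.
  - by apply: prime_cyclic; rewrite c.
  by move/eqP: c; rewrite -trivg_card1 => /eqP ->; apply: cyclic1.
have cM : #|M| <= #|'C_G(M)| by rewrite -cardA subset_leq_card.
have [pM|npM] := boolP (M \subset M^`(1)).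
  have M1 : M :!=: 1 by apply: contraNneq nab => ->; apply: abelian1.
  have q30 := perfect_index_center pM M1.
  have M30 : 30 <= #|M| by rewrite (leq_trans q30) // dvdn_leq // dvdn_indexg.
  have := mul_centraliser_leq sMG; rewrite card_mul_centraliser // => /(leq_trans _); apply.
  by apply: (@leq_trans (30 * 30)%N) => //; rewrite leq_mul // (leq_trans M30).
have := nonperfect_family2 fam vG EG ij npM; rewrite card_mul_centraliser // => /(leq_trans _).
apply; apply: (@leq_trans (6 * (4 * 8))%N) => //; rewrite leq_mul2l leq_mul //=.
have [nML nEL] := family_norm_char fam (der_char 1 M).
have k1 := family_quo_order fam (L := M^`(1)) nML nEL i npM.
have := index_family2 fam (L := M^`(1)) nML nEL (subxx _) ij.
move=> i4; apply: leq_trans cM; rewrite -(Lagrange (der_sub 1 M)).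
apply: (@leq_trans (2 * 2 ^ 2)%N) => //; apply: leq_mul; first exact: family_derived_gt1.
by apply: leq_trans i4; rewrite leq_exp2r.
Qed.

(** Let L = M' Z(M). If L = M, then M / Z(M) is perfect and has order at least 30. Otherwise let k
    be the order of [v i] modulo L: if k > 2, then |M : L| >= 9; if k = 2, then |M : L| >= 4, and
    the square of [v i] lies in L but not in Z(M), which doubles the index. *)
Lemma family_center_index8 i j : i != j -> ~~ (M \subset M^`(1)) ->
  v i ^+ 2 \notin 'Z(M) -> 8 <= #|M : 'Z(M)|.
Proof.
move=> ij npM sq; have nab : ~~ abelian M.
  apply: contra sq => abM; rewrite (center_idP abM) groupX //; exact: mem_family.
have [nM'M nEM'] := family_norm_char fam (der_char 1 M).
have [nMZ nEZ] := family_norm_char fam (center_char M).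
pose L := (M^`(1) <*> 'Z(M))%G.
have nML : M \subset 'N(L) by rewrite normsY.
have nEL a b : a != b -> E a b \in 'N(L).
  move=> ab; rewrite -sub1set normsY // sub1set; [exact: nEM'|exact: nEZ].
have M'L : M^`(1) \subset L by rewrite joing_subl.
have ZL : 'Z(M) \subset L by rewrite joing_subr.
have LM : L \subset M by rewrite join_subG der_sub center_sub.
have [sML|nsML] := boolP (M \subset L).
  suff q30 : 30 <= #|M : 'Z(M)| by apply: leq_trans q30.
  rewrite -card_quotient //; apply: nonsolvable_ge30; apply/negP => solQ.
  have Q1 : M / 'Z(M) != 1.
    apply: contra nab; rewrite -subG1 quotient_sub1 // => sMZ.
    exact: abelianS sMZ (center_abelian M).
  have /andP[_ /negP[]] := sol_der1_proper solQ (subxx _) Q1.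
  rewrite -quotient_der //; apply: subset_trans (quotientS _ sML) _.
  by rewrite quotientYidr // (subset_trans (der_sub 1 M)).
have k1 := family_quo_order fam nML nEL i nsML.
have iL := index_family2 fam nML nEL M'L ij.
have [k3|k2] := ltnP 2 #[fam_quo v L i].
  apply: leq_trans (dvdn_leq (indexg_gt0 _ _) (indexgS _ ZL)); apply: leq_trans iL.
  by apply: (@leq_trans (3 ^ 2)%N) => //; rewrite leq_exp2r.
have vL : v i ^+ 2 \in L.
  by apply: contraLR k2 => vL; rewrite -ltnNge; apply: family_quo_order2 vL.
rewrite -(Lagrange_index LM ZL) (@leq_trans (2 ^ 2 * 2)%N) // leq_mul //.
  by apply: leq_trans iL; rewrite leq_exp2r.
by rewrite indexg_gt1; apply: contra sq => /subsetP; apply.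
Qed.

(** With q = |M : Z(M)|, the three copies give |C_G(M)| >= q^3, so M C_G(M) has at least q^4
    elements: 6 . 8^4 = 24576 if [M] is not perfect, and 30^4 if it is. *)
Lemma four_copies_bound (A B C : {group gT}) i j : i != j ->
  v i ^+ 2 \notin 'Z(M) -> A \subset 'C_G(M) -> B \subset 'C_G(M) -> C \subset 'C_G(M) ->
  A \subset 'C(B) -> A \subset 'C(C) -> B \subset 'C(C) ->
  (exists g, A :=: M :^ g) -> (exists g, B :=: M :^ g) -> (exists g, C :=: M :^ g) ->
  20160 < #|G|.
Proof.
move=> ij sq AM BM CM AB AC BC [a aE] [b bE] [c cE].
have sMG := family_subG vG.
set q := #|M : 'Z(M)|.
have qJ g : #|M :^ g : 'Z(M :^ g)| = q by rewrite /center centJ -conjIg indexJg.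
have qC : q * (q * q) <= #|'C_G(M)|.
  have cBC : C \subset 'C(B) by rewrite centsC.
  have cABC : B <*> C \subset 'C(A) by rewrite join_subG -!(centsC A) AB.
  apply: (@leq_trans #|A * (B <*> C)|); last first.
    by rewrite subset_leq_card // mul_subG // join_subG BM.
  apply: leq_trans (commuting_card_mulG cABC); rewrite aE qJ leq_mul2l.
  rewrite /= cent_joinEr //; apply/orP; right.
  apply: leq_trans (commuting_card_mulG cBC); rewrite bE qJ leq_mul2l.
  by rewrite cE cardJg dvdn_leq ?orbT ?dvdn_indexg.
have [pM|npM] := boolP (M \subset M^`(1)).
  have M1 : M :!=: 1.
    apply: contraNneq sq => M1; have := mem_family v i.
    by rewrite M1 => /set1P ->; rewrite expg1n group1.
  have q30 : 30 <= q := perfect_index_center pM M1.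
  have := mul_centraliser_leq sMG; rewrite card_mul_centraliser // => /(leq_trans _); apply.
  rewrite -/q; apply: (@leq_trans (30 * (30 * (30 * 30)))%N); first by vm_compute.
  by rewrite leq_mul // (leq_trans _ qC) // !leq_mul.
have q8 : 8 <= q := family_center_index8 ij npM sq.
have := nonperfect_family2 fam vG EG ij npM; rewrite card_mul_centraliser // => /(leq_trans _).
apply; rewrite -/q; apply: (@leq_trans (6 * (8 * (8 * (8 * 8))))%N); first by vm_compute.
by rewrite leq_mul2l leq_mul // (leq_trans _ qC) // !leq_mul.
Qed.

(** Central squares force class two: M / Z(M) is generated by involutions whose pairwise products
    are again involutions. Then |M : Z(M)| >= 8 and |M| = |M : M'| |M'| >= 8 . 4, and 80 . 8 . 32 =
    20480. *)
Lemma nilpotent_family_bound (A : {group gT}) i j k : i != j -> i != k -> j != k ->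
  ~~ abelian M -> (forall a b, commute (v a ^+ 2) (v b)) ->
  A \subset 'C_G(M) -> #|A| = #|M| -> 20160 < #|G|.
Proof.
move=> ij ik jk nab sq cAM cardA.
have [ji ki kj] : [/\ j != i, k != i & k != j] by rewrite ![k == _]eq_sym eq_sym.
have sMG := family_subG vG.
have [nML nEL] := family_norm_char fam (der_char 1 M).
have [nMZ nEZ] := family_norm_char fam (center_char M).
have sqZ a : v a ^+ 2 \in 'Z(M).
  rewrite inE groupX ?mem_family // cent_gen; apply/centP => _ /imsetP[b _ ->].
  exact: sq.
(* Involutions whose product is an involution commute; here the product v_a v_b is a conjugate of
   v_a. *)
have coset_comm (x y : gT) (L : {group gT}) : x \in 'N(L) -> y \in 'N(L) ->
    x ^+ 2 \in L -> y ^+ 2 \in L -> (x * y) ^+ 2 \in L -> commute (coset L x) (coset L y).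
  move=> xN yN x2 y2 xy2.
  have c1 z : z \in 'N(L) -> z ^+ 2 \in L -> coset L z * coset L z = 1.
    by move=> zN z2; rewrite -morphM //= -expg2 coset_id.
  have := c1 _ (groupM xN yN) xy2; rewrite morphM // => e.
  have [ex ey] := (c1 x xN x2, c1 y yN y2).
  rewrite /commute -[RHS]mul1g -e -!mulgA [coset L y * (coset L y * _)]mulgA ey mul1g.
  by rewrite ex mulg1.
have M'Z : M^`(1) \subset 'Z(M).
  rewrite -quotient_cents2 // -[_ / _]/(M / 'Z(M)).
  have sN : v @: T \subset 'N('Z(M)).
    by apply/subsetP => _ /imsetP[a _ ->]; apply: (subsetP nMZ); apply: mem_family.
  have imE : (v @: T) / 'Z(M) = fam_quo v 'Z(M)%G @: T.
    by rewrite /quotient morphimEsub // -imset_comp; apply: eq_imset.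
  have -> : M / 'Z(M) = family_group (fam_quo v 'Z(M)%G).
    by rewrite /family_group -imE -quotient_gen.
  apply/family_abelian => a b; have [->//|ab] := eqVneq a b.
  have vN c : v c \in 'N('Z(M)) by apply: (subsetP nMZ); apply: mem_family.
  apply: coset_comm => //.
  have <- : v a ^ (E a b)^-1 = v a * v b by apply: family_conj.
  by rewrite -conjXg memJ_norm // groupV nEZ.
have npM : ~~ (M \subset M^`(1)).
  apply: contra nab => sMM'; apply: abelianS (center_abelian M).
  exact: subset_trans sMM' M'Z.
have nMsZ : ~~ (M \subset 'Z(M)).
  by apply: contra nab => sMZ; apply: abelianS sMZ (center_abelian M).
have kZ := family_quo_order fam nMZ nEZ i nMsZ.
have iZ := index_family3 fam nMZ nEZ M'Z ij ik jk.
have k1 := family_quo_order fam (L := M^`(1)) nML nEL i npM.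
have i1 := index_family3 fam (L := M^`(1)) nML nEL (subxx _) ij ik jk.
have ge8 m : 1 < m -> 8 <= m ^ 3 by move=> m1; apply: (@leq_trans (2 ^ 3)%N) => //; rewrite leq_exp2r.
have Z8 := leq_trans (ge8 _ kZ) iZ; have M8 := leq_trans (ge8 _ k1) i1.
have nc a b : a != b -> ~ commute (v a) (v b).
  by move=> ab cab; move/negP: nab; apply; apply: abelian_family cab.
have comm_mulE (x y : gT) : (x ^ y = x) <-> commute x y.
  by split=> [/conjg_fixP/commgP//|/commgP/conjg_fixP].
(* [E j k] fixes [v i] and carries v_j v_k to v_j, so the assumption would make [v i] commute with
   [v j]. The next claim uses the inverse move in the same way. *)
have jk' : commute (v i) (v j * v k) -> False.
  move=> c; have := commute_conj (E j k) c.
  rewrite family_conjCI // [(v j * _) ^ _]conjMg family_conjI // family_conjCI //.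
  by rewrite mulgVK; apply: nc.
have jkV : v i ^ v j = v i ^ v k -> False.
  move=> e; have : commute (v i) (v j * (v k)^-1).
    by apply/comm_mulE; rewrite conjgM e -conjgM mulgV conjg1.
  move=> /(commute_conj (E j k)^-1); rewrite family_conjC // [(v j * _) ^ _]conjMg conjVg.
  by rewrite family_conj // family_conjC // mulgK; apply: nc.
have bc : v i ^ (v j * v k) = v i ^ v j -> False.
  move=> e; apply: (nc i k ik); apply/comm_mulE.
  have e' : v i ^ (v j * v k * (v j)^-1) = v i by rewrite conjgM e -conjgM mulgV conjg1.
  have cz : [~ v k, (v j)^-1] \in 'Z(M).
    by apply: (subsetP M'Z); rewrite mem_commg ?groupV ?mem_family.
  have E1 : v j * v k * (v j)^-1 = v k * [~ v k, (v j)^-1].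
    by rewrite commgEl mulVKg conjgE invgK mulgA.
  move: e'; rewrite E1 conjgM => e'; rewrite -[RHS]e'.
  apply/esym/conjg_fixP/commgP; case/setIP: cz => _ /centP; move: [~ _, _] => z cz.
  by apply/commute_sym/cz; rewrite groupJ ?mem_family.
(* The conjugates of [v i] by 1, v_j, v_k and v_j v_k are distinct and all lie in the coset v_i
   M'. *)
have D4 : 4 <= #|M^`(1)|.
  rewrite -(card_lcoset _ (v i)).
  have u : uniq [:: v i; v i ^ v j; v i ^ v k; v i ^ (v j * v k)].
    rewrite /= !inE !negb_or !andbT.
    have cs a : a != i -> v i != v i ^ v a.
      by rewrite eq_sym => ia; apply/eqP => /esym/comm_mulE; apply: nc.
    do !(apply/andP; split); try by [apply: cs; rewrite eq_sym]; apply/eqP.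
    - by move=> /esym/comm_mulE.
    - exact: jkV.
    - by move=> /esym.
    - rewrite conjgM => /conjg_inj /esym/comm_mulE; exact: nc.
  rewrite -[4]/(size [:: v i; v i ^ v j; v i ^ v k; v i ^ (v j * v k)]) -(card_uniqP u).
  apply/subset_leq_card/subsetP => x; rewrite !inE.
  have mem y : y \in M -> v i ^ y \in v i *: M^`(1).
    by move=> yM; rewrite mem_lcoset -commgEl mem_commg ?mem_family.
  case/or4P => /eqP ->; rewrite ?mem ?mem_family ?groupM ?mem_family //.
  by rewrite -[X in X \in _](conjg1 (v i)) mem.
have := nonperfect_family3 fam vG EG ij ik jk npM; rewrite card_mul_centraliser //.
move=> /(leq_trans _); apply; apply: (@leq_trans (80 * (8 * 32))%N); first by vm_compute.
rewrite leq_mul2l leq_mul //; apply: (@leq_trans #|M|); last first.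
  by rewrite -cardA subset_leq_card.
by rewrite -(Lagrange (der_sub 1 M)) (@leq_trans (4 * 8)%N) // leq_mul.
Qed.

End FamilyBounds.

(** * Finite quotients of SAut F_n *)

Lemma family_group_conj (gT : finGroupType) (T : finType) (v w : T -> gT) g :
  (forall t, w t = v t ^ g) -> family_group w = family_group v :^ g.
Proof.
move=> wv; rewrite /family_group -genJ; congr <<_>>.
by rewrite /conjugate -imset_comp; apply: eq_imset => t; rewrite wv.
Qed.

Lemma family_group_cents (gT : finGroupType) (T U : finType) (v : T -> gT) (w : U -> gT) :
  (forall t u, commute (v t) (w u)) -> family_group v \subset 'C(family_group w).
Proof.
move=> vw; apply: family_group_sub => t; rewrite /= /family_group cent_gen.
by apply/centP => _ /imsetP[u _ ->]; apply: vw.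
Qed.

Lemma order_gt2 (gT : finGroupType) (x : gT) : x ^+ 2 != 1 -> 2 < #[x].
Proof.
apply: contraNT; rewrite -leqNgt -order_dvdn; have := order_gt0 x.
by case: #[x] => [|[|[|]]].
Qed.

(* [Phi] stands for a surjection from SAut F_n to [G]; its values on automorphisms of
   determinant -1 are irrelevant. *)
Definition special_quotient n (gT : finGroupType) (G : {group gT})
    (Phi : autgroup (free_group n) -> gT) :=
  (forall a b, special_aut a -> special_aut b -> Phi (a * b) = Phi a * Phi b) /\
  (forall y, y \in G <-> exists2 a, special_aut a & Phi a = y).

Section SpecialQuotient.
Variables (n : nat) (gT : finGroupType) (G : {group gT}).
Variable Phi : autgroup (free_group n) -> gT.
Hypotheses (n3 : 2 < n) (PhiG : special_quotient G Phi).
Implicit Types i j k l o : 'I_n.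

Let PhiM a b : special_aut a -> special_aut b -> Phi (a * b) = Phi a * Phi b.
Proof. exact: (proj1 PhiG). Qed.

Lemma Phi_in a : special_aut a -> Phi a \in G.
Proof. by move=> sa; apply/(proj2 PhiG); exists a. Qed.

Lemma Phi1 : Phi 1 = 1.
Proof. by apply: (mulgI (Phi 1)); rewrite -PhiM ?mulg1 //; apply: special1. Qed.

Lemma PhiV a : special_aut a -> Phi a^-1 = (Phi a)^-1.
Proof.
move=> sa; apply: (mulgI (Phi a)); rewrite -PhiM ?mulgV ?Phi1 //.
exact: specialV.
Qed.

Local Notation R i j := (Phi (rho i j)).
Local Notation L i j := (Phi (lam i j)).

Let sR i j : i != j -> special_aut (rho i j). Proof. exact: special_rho. Qed.
Let sL i j : i != j -> special_aut (lam i j). Proof. exact: special_lam. Qed.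

Lemma special_swp i j : i != j -> special_aut (swp i j).
Proof. by move=> ij; apply: special_transvection_gen; first by []; apply: transvection_gen_swp. Qed.

Lemma special_flip2 i j : i != j -> special_aut (flip2 i j).
Proof. by move=> ij; apply: special_transvection_gen; first by []; apply: transvection_gen_flip2. Qed.

(** Generation of SAut F_n by transvections enters the study of its quotients here. *)
Lemma special_quotient_sub (H : {group gT}) :
  (forall i j, i != j -> R i j \in H /\ L i j \in H) -> G \subset H.
Proof.
move=> RL; apply/subsetP => _ /(proj2 PhiG)[a /(transvection_gen_special n3) ga <-].
suff [] : special_aut a /\ Phi a \in H by [].
elim: ga => [|i j ij|i j ij|b c _ [sb Hb] _ [sc Hc]|b _ [sb Hb]].
- by rewrite Phi1 special1 group1.
- by rewrite sR //; have [] := RL i j ij.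
- by rewrite sL //; have [] := RL i j ij.
- by rewrite PhiM // groupM // specialM.
- by rewrite PhiV // groupV specialV.
Qed.

Lemma commute_Phi a b : special_aut a -> special_aut b -> commute a b ->
  commute (Phi a) (Phi b).
Proof. by move=> sa sb ab; rewrite /commute -!PhiM // ab. Qed.

Lemma Phi_conj a b c : special_aut a -> special_aut b -> special_aut c ->
  a * b = c * a -> Phi c = Phi b ^ (Phi a)^-1.
Proof.
by move=> sa sb sc e; rewrite conjgE invgK mulgA -PhiM // e PhiM // mulgK.
Qed.

(** [s] selects the columns of row [o]. The index type stays free because both rank two ([bool]) and
    rank three (['I_3]) families are needed. *)
Lemma Phi_family (T : finType) o (s : T -> 'I_n) : injective s -> (forall t, o != s t) ->
  nielsen_family (fun t => R o (s t)) (fun t u => R (s t) (s u)).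
Proof.
move=> sI os; split=> [t u tu|t u w tu wt].
  have stu : s t != s u by rewrite (inj_eq sI).
  by rewrite -!PhiM ?rho_rho_chain ?specialM ?sR.
have ? : s t != s u by rewrite (inj_eq sI).
have ? : s t != s w by rewrite eq_sym (inj_eq sI).
apply: commute_Phi; rewrite ?sR //; apply: commute_rho => //.
by rewrite eq_sym.
Qed.

Lemma R_in i j : i != j -> R i j \in G. Proof. by move=> ij; apply/Phi_in/sR. Qed.

Lemma Phi_swpR i j k : i != j -> i != k -> j != k -> R k j = R k i ^ (Phi (swp i j))^-1.
Proof.
move=> ij ik jk; have [ki kj] : k != i /\ k != j by rewrite ![k == _]eq_sym.
by apply: Phi_conj; rewrite ?swp_rhoR ?sR ?special_swp.
Qed.

Lemma Phi_swpL i j k : i != j -> i != k -> j != k -> R j k = R i k ^ (Phi (swp i j))^-1.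
Proof. by move=> ij ik jk; apply: Phi_conj; rewrite ?swp_rhoL ?sR ?special_swp. Qed.

Lemma Phi_swp_lamL i j k : i != j -> i != k -> j != k ->
  L j k = L i k ^ (Phi (swp i j))^-1.
Proof. by move=> ij ik jk; apply: Phi_conj; rewrite ?swp_lamL ?sL ?special_swp. Qed.

Lemma Phi_flip2 i j k : i != j -> i != k -> j != k ->
  L i j = R i j ^ (Phi (flip2 i k))^-1.
Proof.
by move=> ij ik jk; apply: Phi_conj; rewrite ?flip2_rho ?sR ?sL ?special_flip2.
Qed.

Lemma Phi_flip2_pair i j : i != j -> (L i j)^-1 = R i j ^ (Phi (flip2 i j))^-1.
Proof.
move=> ij; rewrite -PhiV ?sL //; apply: Phi_conj; rewrite ?specialV ?sR ?sL ?special_flip2 //.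
by rewrite -{2}(flip2_rho_pair ij) mulKg.
Qed.

(** One index changes at a time; a pair is reversed through a third index m, by (i,j), (m,j), (m,i),
    (j,i). *)
Lemma ordered_pair_ind (P : 'I_n -> 'I_n -> Prop) i j k l :
  (forall i j k, i != j -> i != k -> j != k -> P k i -> P k j) ->
  (forall i j k, i != j -> i != k -> j != k -> P i k -> P j k) ->
  i != j -> k != l -> P i j -> P k l.
Proof.
move=> PR PL ij kl pij.
have Lp (p q r : 'I_n) : q != p -> r != p -> P q p -> P r p.
  by move=> qp rp; have [->//|qr] := eqVneq q r; apply: PL.
have Rp (p q r : 'I_n) : p != q -> p != r -> P p q -> P p r.
  by move=> pq pr; have [->//|qr] := eqVneq q r; apply: PR; rewrite // eq_sym.
have [li|li] := eqVneq l i; last first.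
  by apply: (Lp _ i) => //; rewrite 1?eq_sym //; apply: (Rp _ j) => //; rewrite eq_sym.
subst l; have [kj|kj] := eqVneq k j; last first.
  apply: (Rp k j); rewrite // ; apply: (Lp _ i) => //.
subst k; have [m /andP[im jm]] := third_index i j n3.
apply: (Lp _ m) => //; rewrite 1?eq_sym //; apply: (Rp _ j); rewrite // 1?eq_sym //.
by apply: (Lp _ i); rewrite // eq_sym.
Qed.

Lemma R_sqr_all i j k l : i != j -> k != l -> R i j ^+ 2 = 1 -> R k l ^+ 2 = 1.
Proof.
move=> ij kl; apply: (@ordered_pair_ind (fun p q => R p q ^+ 2 = 1)) => // {ij kl i j k l} i j k ij ik jk.
  by rewrite (Phi_swpR ij ik jk) -conjXg => ->; rewrite conj1g.
by rewrite (Phi_swpL ij ik jk) -conjXg => ->; rewrite conj1g.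
Qed.

(** The copy consists of left transvections in the same row. A full row leaves no index outside it
    to invert along with [o], so a column [s t0] is inverted instead; this replaces one generator of
    the copy by its inverse. *)
Lemma lam_copy (T : finType) o (s : T -> 'I_n) (t0 : T) : injective s -> (forall t, o != s t) ->
  let M := family_group (fun t => R o (s t)) in
  exists2 A : {group gT}, A \subset 'C_G(M) & #|A| = #|M|.
Proof.
move=> sI os M; pose g := (Phi (flip2 o (s t0)))^-1.
have MG : M \subset G by apply: family_group_sub => t; apply/Phi_in/sR.
exists (M :^ g)%G; last by rewrite cardJg.
rewrite subsetI conj_subG ?groupV ?Phi_in ?special_flip2 //=.
rewrite -(@family_group_conj _ _ _ (fun t => R o (s t) ^ g)) //.
apply: family_group_cents => t u.
have c : commute (L o (s t)) (R o (s u)).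
  by apply: commute_Phi; rewrite ?sR ?sL //; apply: commute_lam_rho.
have [tt|tt] := eqVneq t t0.
  by rewrite tt -Phi_flip2_pair // -tt; apply/commute_sym/commuteV/commute_sym.
by rewrite /g -Phi_flip2 // (inj_eq sI).
Qed.

(** 168 = |GL_3(F_2)|. A nonabelian row gives 192; an abelian one gives (2k + 1) k . k^2, which is
    189 at k = 3. *)
Lemma special_quotient_bound3 i j : n = 3 -> i != j -> R i j ^+ 2 != 1 -> 168 < #|G|.
Proof.
move=> nE ij /order_gt2 o2; have [k /andP[ik jk]] := third_index i j n3.
pose s b := if b then j else k.
have sI : injective s by case; case => //= E; rewrite E eqxx in jk.
have os b : i != s b by case: b.
have [A AM cA] := lam_copy true sI os.
have fam := Phi_family sI os.
have vG b : R i (s b) \in G by apply: R_in.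
have EG (b c : bool) : b != c -> R (s b) (s c) \in G by move=> bc; apply: R_in; rewrite (inj_eq sI).
have [ab|nab] := boolP (abelian (family_group (fun b => R i (s b)))); last first.
  by apply: leq_trans (nonabelian_family_bound2 fam vG EG nab (isT : true != false) AM cA).
apply: leq_trans (abelian_family_bound2 fam vG EG ab (isT : true != false) o2).
rewrite /=; move: #[_] o2 => m m3; apply: (@leq_trans (3.*2.+1 * 3 * 3 ^ 2)%N); first by vm_compute.
by rewrite !leq_mul // ltnS leq_double.
Qed.

(** 20160 = |GL_4(F_2)|. If a square fails to commute with another member of its row, those two
    columns form a rank two family, and the fourth index [m] provides the copies in row [m].
    Otherwise the full row has rank three, and is either of class two or abelian with (k^2 + 1) k^4
    . k^3 >= 21870. *)
Lemma special_quotient_bound4 i j : n = 4 -> i != j -> R i j ^+ 2 != 1 -> 20160 < #|G|.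
Proof.
move=> nE ij r2.
case: (pselect (forall o k l, o != k -> o != l -> commute (R o k ^+ 2) (R o l))) => [sq|]; last first.
  move=> /existsNP[o] /existsNP[k] /existsNP[l] /not_implyP[ok] /not_implyP[ol nc].
  have kl : k != l by apply: contra_notN nc => /eqP ->; apply/commute_sym/commuteX.
  have [m /and3P[om km lm]] : exists m, [&& o != m, k != m & l != m].
    have [m] : exists m, m \notin [set o; k; l].
      apply/existsP; apply: contraTT isT => /existsPn all_in.
      have : #|'I_n| <= #|[set o; k; l]|.
        by rewrite -cardsT; apply/subset_leq_card/subsetP => m _; have := all_in m; rewrite negbK.
      have le3 : #|[set o; k; l]| <= 3.
        by rewrite setUC cardsU1 cards2; case: (_ \notin _); case: eqP.
      by rewrite card_ord => /leq_trans/(_ le3); lia.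
    by rewrite !inE !negb_or ![m == _]eq_sym -andbA; exists m.
  pose s b := if b then k else l.
  have sI : injective s by case; case => //= E; rewrite E eqxx in kl.
  have os b : o != s b by case: b.
  have ms b : m != s b by case: b; rewrite eq_sym.
  have sm b : s b != m by rewrite eq_sym.
  have so b : s b != o by rewrite eq_sym.
  have mo : m != o by rewrite eq_sym.
  have fam := Phi_family sI os.
  have vG b : R o (s b) \in G by apply: R_in.
  have EG (b c : bool) : b != c -> R (s b) (s c) \in G by move=> bc; apply: R_in; rewrite (inj_eq sI).
  set v := fun b => R o (s b) in fam vG.
  pose w1 b := L o (s b); pose w2 b := R m (s b); pose w3 b := L m (s b).
  have cG w (T := bool) : (forall b : T, w b \in G) -> (forall b c, commute (w b) (v c)) ->
      family_group w \subset 'C_G(family_group v).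
    by move=> wG cw; rewrite subsetI family_group_sub //=; apply: family_group_cents.
  apply: (@four_copies_bound _ _ _ _ fam G vG EG (family_group_group w1)
    (family_group_group w2) (family_group_group w3) true false) => //.
  - apply: contra_notN nc => /setIP[_ /centP cM]; apply: cM.
    exact: (mem_family v false).
  - apply: cG => [b|b c]; first exact/Phi_in/sL.
    by apply: commute_Phi; rewrite ?sR ?sL //; apply: commute_lam_rho.
  - apply: cG => [b|b c]; first exact: R_in.
    by apply: commute_Phi; rewrite ?sR ?sL //; apply: commute_rho.
  - apply: cG => [b|b c]; first exact/Phi_in/sL.
    by apply: commute_Phi; rewrite ?sR ?sL //; apply: commute_lam_rho2.
  - apply: family_group_cents => b c.
    by apply: commute_Phi; rewrite ?sR ?sL //; apply: commute_lam_rho2.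
  - apply: family_group_cents => b c.
    by apply: commute_Phi; rewrite ?sR ?sL //; apply: commute_lam.
  - apply: family_group_cents => b c; apply/commute_sym.
    by apply: commute_Phi; rewrite ?sR ?sL //; apply: commute_lam_rho.
  - exists (Phi (flip2 o m))^-1; apply: family_group_conj => b.
    exact: Phi_flip2.
  - exists (Phi (swp o m))^-1; apply: family_group_conj => b.
    by rewrite /w2 (Phi_swpL om).
  - exists ((Phi (flip2 o m))^-1 * (Phi (swp o m))^-1); apply: family_group_conj => b.
    by rewrite /w3 (Phi_swp_lamL om) // (Phi_flip2 (k := m)) // -conjgM.
have [s sI os] : exists2 s : 'I_3 -> 'I_n, injective s & forall t, i != s t.
  move: i {ij r2 sq}; rewrite nE => o; exists (lift o); first exact: lift_inj.
  by move=> t; apply: neq_lift.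
have fam := Phi_family sI os.
have vG t : R i (s t) \in G by apply: R_in.
have EG (t u : 'I_3) : t != u -> R (s t) (s u) \in G by move=> tu; apply: R_in; rewrite (inj_eq sI).
have [A AM cA] := lam_copy ord0 sI os.
have d1 : (ord0 : 'I_3) != lift ord0 ord0 by [].
have d2 : (ord0 : 'I_3) != ord_max by [].
have d3 : (lift ord0 ord0 : 'I_3) != ord_max by [].
have [ab|nab] := boolP (abelian (family_group (fun t => R i (s t)))); last first.
  by apply: (nilpotent_family_bound fam vG EG d1 d2 d3 nab _ AM cA) => t u; apply: sq.
have o2 : 2 < #[R i (s ord0)].
  by apply: order_gt2; apply: contra_neq r2; apply: R_sqr_all.
apply: leq_trans (abelian_family_bound3 fam vG EG ab d1 d2 d3 (ltnW o2)).
rewrite /=; move: #[_] o2 => m m3; apply: (@leq_trans ((3 ^ 2).+1 * 3 ^ 4 * 3 ^ 3)%N).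
  by vm_compute.
by rewrite !leq_mul // ?ltnS leq_exp2r.
Qed.

End SpecialQuotient.

(** * An upper bound for Steinberg's presentation of GL_n(F_2) *)

Lemma card_gen_commuting_involutions (gT : finGroupType) (s : seq gT) :
  {in s, forall x, x * x = 1} -> {in s &, forall x y, commute x y} ->
  #|<<[set x in s]>>| <= 2 ^ size s.
Proof.
elim: s => [|x s IH] s2 sc.
  by rewrite (_ : [set x in [::]] = set0) ?gen0 ?cards1 //; apply/setP => y; rewrite !inE.
have -> : [set y in x :: s] = x |: [set y in s] by apply/setP => y; rewrite !inE.
have -> : <<x |: [set y in s]>> = <[x]> <*> <<[set y in s]>>.
  by rewrite joing_idl joing_idr.
have cxs : <<[set y in s]>> \subset 'C(<[x]>).
  rewrite gen_subG /= cent_cycle; apply/subsetP => y; rewrite inE => ys; apply/cent1P.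
  by apply: sc; rewrite inE ?eqxx ?ys ?orbT.
rewrite cent_joinEr //=; apply: (@leq_trans (#|<[x]>| * #|<<[set y in s]>>|)%N).
  by rewrite (@mul_cardG _ <[x]>%G <<[set y in s]>>%G) leq_pmulr ?cardG_gt0.
rewrite expnS leq_mul // ?IH //; last first.
- by move=> y z ys zs; apply: sc; rewrite inE ?ys ?zs orbT.
- by move=> y ys; apply: s2; rewrite inE ys orbT.
rewrite -orderE dvdn_leq // order_dvdn expgS expg1; apply/eqP/s2.
by rewrite mem_head.
Qed.

Lemma count_leq_enum_ord n q : count (fun i : 'I_n => q <= i) (enum 'I_n) = (n - q)%N.
Proof.
rewrite -(count_map val (leq q)) val_enum_ord; elim: n => // n IH.
by rewrite -[n.+1]addn1 iotaD count_cat IH /= addn0; case: leqP; lia.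
Qed.

(** Nonzero vectors times the stabiliser of one of them, which is GL_(n-1)(F_2) extended by 2^(n-1)
    translations. The upper bound below follows this recursion. *)
Fixpoint gl2_order (n : nat) : nat :=
  if n is n'.+1 then ((2 ^ n).-1 * (2 ^ n' * gl2_order n'))%N else 1%N.

Section Steinberg.
Variables (gT : finGroupType) (n : nat) (e : 'I_n -> 'I_n -> gT).
Implicit Types (i j k l : 'I_n) (x y z : gT) (Q : 'I_n -> 'I_n -> bool).

(** For elementary matrices over F_2 this is the permutation matrix of the transposition of [i] and
    [j]. *)
Definition weyl i j := e i j * e j i * e i j.

Hypothesis e_sqr : forall i j, i != j -> e i j * e i j = 1.
Hypothesis e_chain : forall i j k, i != j -> i != k -> j != k ->
  e j k * e i j = e i j * e i k * e j k.
Hypothesis e_comm : forall i j k l, i != j -> k != l -> j != k -> i != l ->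
  commute (e i j) (e k l).
Hypothesis weylC : forall i j, i != j -> weyl i j = weyl j i.
Hypothesis weyl_R : forall i j k, i != j -> i != k -> j != k ->
  weyl i j * e k i = e k j * weyl i j.
Hypothesis weyl_L : forall i j k, i != j -> i != k -> j != k ->
  weyl i j * e i k = e j k * weyl i j.

Definition elementary_group Q :=
  <<[set e ij.1 ij.2 | ij : 'I_n * 'I_n & Q ij.1 ij.2 && (ij.1 != ij.2)]>>.
Canonical elementary_group_group Q := Eval hnf in [group of elementary_group Q].

Lemma mem_elementary Q i j : Q i j -> i != j -> e i j \in elementary_group Q.
Proof.
by move=> Qij ij; apply/mem_gen/imsetP; exists (i, j); rewrite //= inE /= Qij ij.
Qed.

Lemma elementary_sub Q (H : {group gT}) :
  (forall i j, Q i j -> i != j -> e i j \in H) -> elementary_group Q \subset H.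
Proof.
move=> QH; rewrite gen_subG; apply/subsetP => y /imsetP[[i j]].
by rewrite inE /= => /andP[Qij ij] ->; apply: QH.
Qed.

Lemma elementary_subset Q Q' : (forall i j, Q i j -> Q' i j) ->
  elementary_group Q \subset elementary_group Q'.
Proof. by move=> QQ; apply: elementary_sub => i j Qij; apply/mem_elementary/QQ. Qed.

Lemma elementary_conj Q (H : {group gT}) x :
  (forall i j, Q i j -> i != j -> e i j ^ x \in H) -> elementary_group Q :^ x \subset H.
Proof.
move=> QH; rewrite -genJ gen_subG; apply/subsetP => y /imsetP[z /imsetP[[i j]]].
by rewrite inE /= => /andP[Qij ij] -> ->; apply: QH.
Qed.

Lemma elementary_cent Q Q' :
  (forall i j k l, Q i j -> i != j -> Q' k l -> k != l -> commute (e i j) (e k l)) ->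
  elementary_group Q \subset 'C(elementary_group Q').
Proof.
move=> cQ; apply: elementary_sub => i j Qij ij; rewrite /= /elementary_group cent_gen; apply/centP.
by move=> y /imsetP[[k l]]; rewrite inE /= => /andP[Qkl kl] ->; apply: cQ.
Qed.

Lemma eV i j : i != j -> (e i j)^-1 = e i j.
Proof. by move=> ij; apply: (mulgI (e i j)); rewrite mulgV e_sqr. Qed.

Lemma e_conj i j k : i != j -> i != k -> j != k -> e i j ^ e j k = e i j * e i k.
Proof.
by move=> ij ik jk; rewrite conjgE -{1}(eV jk) invgK mulgA e_chain // -!mulgA e_sqr // mulg1.
Qed.

Lemma e_conj2 i j k : i != j -> i != k -> j != k -> e j k ^ e i j = e i k * e j k.
Proof.
by move=> ij ik jk; rewrite conjgE e_chain // !mulgA mulVg mul1g.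
Qed.

Lemma e_conj_comm i j k l : i != j -> k != l -> j != k -> i != l -> e i j ^ e k l = e i j.
Proof. by move=> ij kl jk il; apply/conjg_fixP/commgP/e_comm. Qed.

Lemma weyl_sqr i j : i != j -> weyl i j * weyl i j = 1.
Proof.
move=> ij; have ji : j != i by rewrite eq_sym.
rewrite /weyl !mulgA -(mulgA (e i j * e j i)) e_sqr // mulg1.
by rewrite -(mulgA (e i j)) e_sqr // mulg1 e_sqr.
Qed.

Lemma weylV i j : i != j -> (weyl i j)^-1 = weyl i j.
Proof. by move=> ij; apply: (mulgI (weyl i j)); rewrite mulgV weyl_sqr. Qed.

Lemma weyl_conjR i j k : i != j -> i != k -> j != k -> e k i ^ weyl i j = e k j.
Proof.
by move=> ij ik jk; rewrite conjgE -{1}weylV // invgK mulgA weyl_R // -mulgA weyl_sqr ?mulg1.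
Qed.

Lemma weyl_conjL i j k : i != j -> i != k -> j != k -> e i k ^ weyl i j = e j k.
Proof.
by move=> ij ik jk; rewrite conjgE -{1}weylV // invgK mulgA weyl_L // -mulgA weyl_sqr ?mulg1.
Qed.

Lemma weyl_conjS i j : i != j -> e i j ^ weyl i j = e j i.
Proof.
move=> ij; have ji : j != i by rewrite eq_sym.
have E : e i j * weyl i j = weyl i j * e j i.
  by rewrite {2}weylC // /weyl !mulgA e_sqr // mul1g -!mulgA e_sqr // mulg1.
by rewrite conjgE E mulKg.
Qed.

Definition block (p : 'I_n) i j := (p <= i) && (p <= j).
(** With [e i j] read as 1 + E_ij, this shape leaves column [p] as in the identity: inside the block
    it stands for the stabiliser of the basis vector with index [p]. *)
Definition block_stab (p : 'I_n) i j := (p <= i) && (p <= j) && (j != p).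

(** * One step of the recursion: from the block at q = p + 1 to the block at p *)

Section Step.
Variables p q : 'I_n.
Hypothesis pq : val q = p.+1.

(** A prime drops the position at [q], the one that forms a rank one pair with the Weyl element [w];
    the remaining positions are carried by [w] into the smaller block [H]. *)
Definition low_col i j := (q <= i) && (j == p).
Definition low_col' i j := (q < i) && (j == p).
Definition low_col2 i j := (q < i) && (j == q).
Definition top_row i j := (i == p) && (q <= j).
Definition top_row' i j := (i == p) && (q < j).
Local Notation G := (elementary_group (block p)).
Local Notation H := (elementary_group (block q)).
Local Notation P := (elementary_group (block_stab p)).
Local Notation P' := (elementary_group (block_stab q)).
Local Notation A := (elementary_group low_col).
Local Notation A' := (elementary_group low_col').
Local Notation N := (elementary_group top_row).
Local Notation N' := (elementary_group top_row').
Local Notation B := (elementary_group low_col2).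
Local Notation w := (weyl p q).

Let lepq : p <= q. Proof. by rewrite -[nat_of_ord q]/(val q) pq leqnSn. Qed.
Let npq : p != q. Proof. by rewrite -val_eqE /= pq; lia. Qed.
Let nqp : q != p. Proof. by rewrite eq_sym. Qed.

Let q_neq_p i : q <= i -> (i != p) * (p != i).
Proof. by move=> qi; split; move: qi; rewrite -!val_eqE /= pq; lia. Qed.
Let q_le i : p <= i -> i != p -> q <= i.
Proof. by move=> pi ip; rewrite -[nat_of_ord q]/(val q) pq ltn_neqAle pi andbT eq_sym. Qed.
Let gtq_neq i : q < i -> (i != p) * (p != i) * (i != q) * (q != i).
Proof. by move=> qi; do !split; move: qi; rewrite -!val_eqE /= pq; lia. Qed.

Lemma HP : H \subset P.
Proof. by apply: elementary_subset => i j; rewrite /block /block_stab -val_eqE /= pq; lia. Qed.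

Lemma P'H : P' \subset H.
Proof. by apply: elementary_subset => i j /andP[]. Qed.

Lemma NP : N \subset P.
Proof. by apply: elementary_subset => i j; rewrite /top_row /block_stab -!val_eqE /= pq; lia. Qed.

Lemma BH : B \subset H.
Proof. by apply: elementary_subset => i j; rewrite /low_col2 /block -!val_eqE /=; lia. Qed.

Lemma wA : A :^ w \subset P.
Proof.
apply: elementary_conj => i j /andP[qi /eqP ->] ip.
have [->|iq] := eqVneq i q.
  rewrite weylC // weyl_conjS //; apply: mem_elementary => //.
  by rewrite /block_stab nqp leqnn pq leqnSn.
rewrite weyl_conjR // 1?eq_sym //; apply: mem_elementary; rewrite ?iq //.
by rewrite /block_stab nqp lepq (leq_trans lepq qi).
Qed.

Lemma wA' : A' :^ w \subset H.
Proof.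
apply: elementary_conj => i j /andP[qi /eqP ->] ip.
have [[[? ?] ?] ?] := gtq_neq qi.
by rewrite weyl_conjR //; apply: mem_elementary => //; rewrite /block leqnn ltnW.
Qed.

Lemma wN' : N' :^ w \subset H.
Proof.
apply: elementary_conj => i j /andP[/eqP -> qj] ip.
have [[[? ?] ?] ?] := gtq_neq qj.
by rewrite weyl_conjL //; apply: mem_elementary => //; rewrite /block leqnn ltnW.
Qed.

Lemma wP' : P' :^ w \subset P.
Proof.
apply: elementary_conj => i j /andP[/andP[qi qj] jq] ij.
have [jp pj] := q_neq_p qj; have qj' : q != j by rewrite eq_sym.
have [iq|iq] := eqVneq i q.
  rewrite iq weylC // weyl_conjL // mem_elementary //.
  by rewrite /block_stab jp leqnn (leq_trans lepq qj).
have [ip pi] := q_neq_p qi; have qi' : q != i by rewrite eq_sym.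
have wc : commute (e i j) w by rewrite /weyl; do !apply: commuteM; apply: e_comm.
have -> : e i j ^ w = e i j by apply/conjg_fixP/commgP.
rewrite mem_elementary //.
by rewrite /block_stab jp (leq_trans lepq qi) (leq_trans lepq qj).
Qed.

Lemma HnormA : H \subset 'N(A).
Proof.
apply: elementary_sub => k l /andP[qk ql] kl; rewrite inE; apply: elementary_conj.
have [kp pk] := q_neq_p qk; have [lp pl] := q_neq_p ql.
move=> i j /andP[qi /eqP ->] ip; have [<-|li] := eqVneq l i.
  by rewrite e_conj2 // groupM // mem_elementary // /low_col ?qk ?ql eqxx.
have il : i != l by rewrite eq_sym.
by rewrite e_conj_comm // mem_elementary // /low_col qi eqxx.
Qed.

Lemma HnormN : H \subset 'N(N).
Proof.
apply: elementary_sub => k l /andP[qk ql] kl; rewrite inE; apply: elementary_conj.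
have [kp pk] := q_neq_p qk; have [lp pl] := q_neq_p ql.
move=> i j /andP[/eqP -> qj] pj; have [->|jk] := eqVneq j k.
  by rewrite e_conj // groupM // mem_elementary // /top_row ?qk ?ql eqxx.
by rewrite e_conj_comm // mem_elementary // /top_row qj eqxx.
Qed.

Lemma A'B : A' \subset 'C(B).
Proof.
apply: elementary_cent => i j k l /andP[qi /eqP ->] ip /andP[qk /eqP ->] kq.
have [[[? ?] ?] ?] := gtq_neq qi; have [[[? ?] ?] ?] := gtq_neq qk.
exact: e_comm.
Qed.

Lemma A'conj : A' :^ e p q \subset B * A'.
Proof.
have cBA : A' \subset 'C(B) := A'B.
rewrite -cent_joinEr //; apply: elementary_conj => i j /andP[qi /eqP ->] ip.
have [[[? ?] ?] ?] := gtq_neq qi; rewrite e_conj // groupM //.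
  by rewrite (subsetP (joing_subr _ _)) // mem_elementary // /low_col' qi eqxx.
by rewrite (subsetP (joing_subl _ _)) // mem_elementary // /low_col2 qi eqxx.
Qed.

Lemma elementary_split (Q Q1 : 'I_n -> 'I_n -> bool) a b : a != b ->
  (forall i j, Q i j -> i != j -> Q1 i j \/ i = a /\ j = b) ->
  (forall i j, Q1 i j -> i != j -> commute (e i j) (e a b)) ->
  forall x, x \in elementary_group Q ->
  exists2 y, y \in elementary_group Q1 & x = y \/ x = y * e a b.
Proof.
move=> ab Q1P Q1c x.
have sub : elementary_group Q \subset elementary_group Q1 * <[e a b]>.
  have c1 : <[e a b]> \subset 'C(elementary_group Q1).
    rewrite centsC; apply: elementary_sub => i j Qij ij.
    by rewrite /= cent_cycle; apply/cent1P/Q1c.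
  rewrite -cent_joinEr //; apply: elementary_sub => i j Qij ij.
  have [Q1ij|[-> ->]] := Q1P i j Qij ij.
    by rewrite (subsetP (joing_subl _ _)) // mem_elementary.
  by rewrite (subsetP (joing_subr _ _)) // cycle_id.
move=> /(subsetP sub) /mulsgP[y z yQ /cycleP[k ->] ->]; exists y => //.
elim: k => [|k IH]; first by rewrite mulg1; left.
rewrite expgSr mulgA; case: IH => ->; [by right|left].
by rewrite -mulgA e_sqr // mulg1.
Qed.

(** Cosets of [P] model nonzero vectors: those with p-th coordinate 1 are reached by [A], and those
    with p-th coordinate 0 by [w] followed by [H]. The proof checks that the union is stable under
    right multiplication by generators. *)
Lemma coset_cover : G \subset P * A :|: P * (w *: H).
Proof.
set S := _ :|: _.
have S1 : 1 \in S by rewrite inE -(mulg1 1) mem_mulg.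
pose St := [set x | S :* x \subset S].
have StP : group_set St.
  apply/group_setP; split; first by rewrite inE mulg1.
  move=> x y; rewrite !inE => Sx Sy; apply: subset_trans Sy.
  by rewrite rcosetM; apply: mulSg.
suff GSt : G \subset Group StP.
  apply/subsetP => x /(subsetP GSt); rewrite inE => /subsetP; apply.
  by rewrite -{1}(mul1g x) mem_mulg ?set11.
have inS1 x y : x \in P -> y \in A -> x * y \in S.
  by move=> xP yA; rewrite inE mem_mulg.
have inS2 x h : x \in P -> h \in H -> x * w * h \in S.
  move=> xP hH; rewrite inE; apply/orP; right.
  by rewrite -mulgA mem_mulg // mem_lcoset mulKg.
have StI x : (forall y z, y \in P -> z \in A -> y * z * x \in S) ->
    (forall y h, y \in P -> h \in H -> y * w * h * x \in S) -> x \in Group StP.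
  move=> H1 H2; rewrite inE; apply/subsetP => _ /rcosetP[s sS ->].
  move: sS; rewrite inE => /orP[] /mulsgP[y z yP zA ->]; first exact: H1.
  by case/lcosetP: zA => h hH ->; rewrite mulgA H2.
have HSt : H \subset Group StP.
  apply/subsetP => x xH; apply: StI => [y z yP zA|y h yP hH]; last first.
    by rewrite -mulgA inS2 // groupM.
  rewrite -mulgA (conjgC z) mulgA inS1 //.
    by rewrite groupM // (subsetP HP).
  by rewrite memJ_norm // (subsetP HnormA).
have wJ x (K : {group gT}) X : X :^ w \subset K -> x \in X -> w * x = x ^ w * w /\ x ^ w \in K.
  move=> sub xX; split; last by rewrite (subsetP sub) // memJ_conjg.
  by rewrite conjgCV weylV.
have ASt : A \subset Group StP.
  apply/subsetP => x xA; apply: StI => [y z yP zA|y h yP hH].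
    by rewrite -mulgA inS1 // groupM.
  have hx := conjgCV h x.
  rewrite -mulgA hx mulgA -(mulgA y).
  have xhA : x ^ h^-1 \in A by rewrite memJ_norm ?groupV // (subsetP HnormA).
  have [-> xP] := wJ _ _ _ wA xhA.
  by rewrite mulgA inS2 // groupM.
have esqr : e p q * e p q = 1 by apply: e_sqr.
have ePq : e p q \in P.
  by rewrite (subsetP NP) // mem_elementary // /top_row eqxx leqnn.
have eqpA : e q p \in A by rewrite mem_elementary // /low_col eqxx leqnn.
have eSt : e p q \in Group StP.
  apply: StI => [y z yP zA|y h yP hH].
    have [a aA' az] : exists2 a, a \in A' & z = a \/ z = a * e q p.
      apply: (elementary_split nqp) zA => [i j /andP[qi jp] ij|i j /andP[qi /eqP ->] ip].
        have [iq|iq] := eqVneq i q; first by right; split; rewrite ?iq //; apply/eqP.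
        by left; rewrite /low_col' jp andbT ltn_neqAle qi andbT -val_eqE eq_sym in iq *.
      by have [[[? ?] ?] ?] := gtq_neq qi; apply: e_comm.
    have aA : a \in A.
      by apply: (subsetP (elementary_subset _) a aA') => i j /andP[qi jp]; rewrite /low_col jp ltnW.
    have : a ^ e p q \in B * A' by rewrite (subsetP A'conj) // memJ_conjg.
    case/mulsgP => b c bB cA' bc.
    have bP : b \in P by rewrite (subsetP HP) // (subsetP BH).
    have cA : c \in A.
      by apply: (subsetP (elementary_subset _) c cA') => i j /andP[qi jp]; rewrite /low_col jp ltnW.
    have ae : a * e p q = e p q * b * c by rewrite conjgC bc mulgA.
    case: az => ->; first by rewrite -mulgA ae mulgA inS1 // !groupM.
    (* The rank one exchange: it moves an element from the first part of the cover to the second. *)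
    have ew : e q p * e p q = e p q * w by rewrite /weyl !mulgA esqr mul1g.
    have [_ cw] := wJ _ _ _ wA' cA'.
    have cwE : c * w = w * c ^ w by rewrite conjgC.
    have -> : y * (a * e q p) * e p q = y * e p q * b * w * c ^ w.
      transitivity (y * ((a * e p q) * w)); first by rewrite -(mulgA a) -ew !mulgA.
      rewrite ae -(mulgA (e p q * b)) cwE; move: (c ^ w) (weyl p q) => c1 w1.
      by rewrite !mulgA.
    by rewrite inS2 // !groupM.
  have hx := conjgCV h (e p q).
  have eN : e p q ^ h^-1 \in N.
    rewrite memJ_norm ?groupV ?(subsetP HnormN) //.
    by rewrite mem_elementary // /top_row eqxx leqnn.
  rewrite -mulgA hx mulgA -(mulgA y).
  have [a aN' az] : exists2 a, a \in N' & e p q ^ h^-1 = a \/ e p q ^ h^-1 = a * e p q.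
    apply: (elementary_split npq) eN => [i j /andP[ip qj] ij|i j /andP[/eqP -> qj] pj].
      have [iq|iq] := eqVneq j q; first by right; split; rewrite ?iq //; apply/eqP.
      by left; rewrite /top_row' ip /= ltn_neqAle qj andbT -val_eqE eq_sym in iq *.
    by have [[[? ?] ?] ?] := gtq_neq qj; apply: e_comm.
  have [wa awH] := wJ _ _ _ wN' aN'.
  have awP : a ^ w \in P by rewrite (subsetP HP).
  case: az => ->; first by rewrite wa mulgA inS2 // groupM.
  (* The exchange in the opposite direction, from the second part back to the first. *)
  have we : w * e p q = e p q * e q p by rewrite /weyl -!mulgA esqr mulg1.
  have -> : y * (w * (a * e p q)) * h = y * a ^ w * e p q * e q p * h.
    transitivity (y * (a ^ w * (w * e p q)) * h); last by rewrite we !mulgA.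
    rewrite (mulgA (a ^ w)) -wa; move: (weyl p q) => w1.
    by rewrite !mulgA.
  have : y * a ^ w * e p q * e q p \in S by apply: inS1 => //; apply: groupM => //; apply: groupM.
  move: (y * a ^ w * e p q * e q p) => s sS; have := subsetP HSt _ hH.
  by rewrite inE => /subsetP; apply; rewrite mem_mulg ?set11.
(* These elements of [H] conjugate [e p q] to the other generators of row [p]. *)
have weylH j : q < j -> weyl q j \in H.
  move=> qj; have [[[? ?] ?] ?] := gtq_neq qj.
  have h1 : e q j \in H by apply: mem_elementary; rewrite // /block leqnn ltnW.
  have h2 : e j q \in H by apply: mem_elementary; rewrite // /block leqnn ltnW.
  by rewrite /weyl; apply: groupM => //; apply: groupM.
apply: elementary_sub => i j /andP[pi pj] ij.
have [ip|ip] := eqVneq i p; have [jp|jp] := eqVneq j p.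
- by rewrite ip jp eqxx in ij.
- have [jq|jq] := eqVneq j q; first by rewrite ip jq.
  have qj : q < j by rewrite ltn_neqAle q_le // andbT eq_sym.
  have [[[? ?] ?] ?] := gtq_neq qj.
  rewrite ip -(weyl_conjR (i := q)) // groupJ //.
  by rewrite (subsetP HSt) // weylH.
- rewrite (subsetP ASt) // mem_elementary // /low_col jp eqxx andbT.
  exact: q_le.
- rewrite (subsetP HSt) // mem_elementary // /block.
  by rewrite !q_le.
Qed.

(** P w H has the size of P^w H, and P^w meets [H] in at least P', since [w] conjugates P' into
    P. *)
Lemma card_cover : #|G| <= #|P| * (#|A| + #|H : P'|).
Proof.
apply: leq_trans (subset_leq_card coset_cover) _; apply: leq_trans (leq_card_setU _ _) _.
rewrite mulnDr leq_add //.
  by rewrite (@mul_cardG _ [group of P] [group of A]) leq_pmulr ?cardG_gt0.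
have -> : #|P * (w *: H)| = #|P :^ w * H|.
  rewrite -(card_lcoset (P :^ w * H) w); congr #|pred_of_set _|.
  by rewrite conjsgE !mulgA mulg_set1 mulgV mul1g.
rewrite -(leq_pmul2r (cardG_gt0 [group of P'])) -mulnA [X in _ <= _ * X]mulnC.
rewrite (Lagrange P'H) -(cardJg P w) (@mul_cardG _ [group of P :^ w] [group of H]).
rewrite leq_mul2l subset_leq_card ?orbT // subsetI P'H andbT /=.
by rewrite -[w]invgK weylV // -sub_conjg wP'.
Qed.

Lemma card_elementary_line Q (f : 'I_n -> 'I_n * 'I_n) :
  (forall i j, Q i j -> i != j -> exists2 k : 'I_n, q <= k & (i, j) = f k) ->
  (forall k : 'I_n, q <= k -> (f k).1 != (f k).2) ->
  (forall k l : 'I_n, q <= k -> q <= l -> commute (e (f k).1 (f k).2) (e (f l).1 (f l).2)) ->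
  #|elementary_group Q| <= 2 ^ (n - q).
Proof.
move=> Qf fne fc; pose s := [seq e (f k).1 (f k).2 | k <- enum 'I_n & q <= k].
have -> : (n - q)%N = size s by rewrite size_map size_filter count_leq_enum_ord.
apply: leq_trans (card_gen_commuting_involutions _ _).
- apply/subset_leq_card; apply: elementary_sub => i j Qij ij; rewrite mem_gen // inE.
  have [k qk E] := Qf i j Qij ij; apply/mapP; exists k; last by rewrite -E.
  by rewrite mem_filter qk mem_enum.
- by move=> x /mapP[k]; rewrite mem_filter => /andP[qk _] ->; apply/e_sqr/fne.
- move=> x y /mapP[k]; rewrite mem_filter => /andP[qk _] -> /mapP[l].
  by rewrite mem_filter => /andP[ql _] ->; apply: fc.
Qed.

Lemma card_low_col : #|A| <= 2 ^ (n - q).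
Proof.
apply: (card_elementary_line (f := fun k => (k, p))) => [i j /andP[qi /eqP ->] _|k qk|k l qk ql].
- by exists i.
- by rewrite /= q_neq_p.
- by apply: e_comm; rewrite /= q_neq_p.
Qed.

Lemma card_top_row : #|N| <= 2 ^ (n - q).
Proof.
apply: (card_elementary_line (f := fun k => (p, k))) => [i j /andP[/eqP -> qj] _|k qk|k l qk ql].
- by exists j.
- by rewrite /= q_neq_p.
- by apply: e_comm; rewrite /= q_neq_p.
Qed.

Lemma card_stab : #|P| <= 2 ^ (n - q) * #|H|.
Proof.
apply: (@leq_trans #|N * H|); last first.
  apply: (@leq_trans (#|N| * #|H|)); last by rewrite leq_mul2r card_top_row orbT.
  by rewrite (@mul_cardG _ [group of N] [group of H]) leq_pmulr ?cardG_gt0.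
rewrite -norm_joinEr ?HnormN //; apply/subset_leq_card/elementary_sub => i j.
move=> /andP[/andP[pi pj] jp] ij; have [ip|ip] := eqVneq i p.
  by rewrite (subsetP (joing_subl _ _)) // mem_elementary // /top_row ip eqxx q_le.
by rewrite (subsetP (joing_subr _ _)) // mem_elementary // /block !q_le.
Qed.

Lemma stab_sub_block : P \subset G.
Proof. by apply: elementary_subset => i j /andP[]. Qed.

End Step.

(** The index is bounded along with the order because |H : P'| enters the next cover, where 2^(d+1)
    + (2^(d+1) - 1) = 2^(d+2) - 1. *)
Lemma card_block d (p : 'I_n) : (n - p)%N = d.+1 ->
  #|elementary_group (block p)| <= gl2_order d.+1 /\
  #|elementary_group (block p) : elementary_group (block_stab p)| <= (2 ^ d.+1).-1.
Proof.
elim: d p => [|d IH] p np.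
  have G1 : elementary_group (block p) \subset 1%G.
    apply: elementary_sub => i j /andP[pi pj] /eqP[].
    by apply: val_inj => /=; have := ltn_ord i; have := ltn_ord j; lia.
  have cG : #|elementary_group (block p)| <= 1 by rewrite (leq_trans (subset_leq_card G1)) ?cards1.
  by split=> //; apply: leq_trans cG; rewrite dvdn_leq ?dvdn_indexg.
have pq : p.+1 < n by lia.
pose q := Ordinal pq; have pqE : val q = p.+1 by [].
have nq : (n - q)%N = d.+1 by rewrite /= subnS np.
have [cH cHP] := IH q nq.
have cG := card_cover pqE; have cP := card_stab pqE; have cA := card_low_col pqE.
have sPG := @stab_sub_block p.
rewrite nq in cP cA.
have cG' : #|elementary_group (block p)| <=
    #|elementary_group (block_stab p)| * (2 ^ d.+2).-1.
  apply: leq_trans cG _; rewrite leq_mul2l; apply/orP; right.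
  rewrite (leq_trans (leq_add cA cHP)) // [(2 ^ d.+2)%N]expnS.
  have : 0 < 2 ^ d.+1 by rewrite expn_gt0.
  by move: (2 ^ d.+1)%N => m; lia.
split.
  apply: leq_trans cG' _; rewrite mulnC leq_mul2l; apply/orP; right.
  by apply: leq_trans cP _; rewrite leq_mul2l cH orbT.
rewrite -(leq_pmul2l (cardG_gt0 [group of elementary_group (block_stab p)])).
by rewrite Lagrange.
Qed.

End Steinberg.

(** * The group GL_n(F_2) *)

Lemma F2P (a : 'F_2) : a = 0%R \/ a = 1%R.
Proof. by case: a => [[|[|]]] // i; [left|right]; apply: val_inj. Qed.

Lemma F2_neq0 (a : 'F_2) : (a != 0)%R -> a = 1%R.
Proof. by case: (F2P a) => ->; rewrite ?eqxx. Qed.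

Lemma F2_addrr (a : 'F_2) : (a + a = 0)%R.
Proof. by case: (F2P a) => ->; apply: val_inj. Qed.

Lemma commg_in_der1 (gT : finGroupType) (x y : gT) : [~ x, y] \in [set: gT]^`(1).
Proof. by rewrite mem_commg // in_setT. Qed.

Section GL2.
Variable m : nat.
Local Notation n := m.+1.
Local Notation GL := {'GL_m.+1['F_2]}.
Local Notation M := 'M['F_2]_m.+1.
Implicit Types (i j k : 'I_m.+1) (g h x : {'GL_m.+1['F_2]}).
Local Open Scope ring_scope.

Lemma GLval_inj : injective (@GLval m.+1 'F_2).
Proof. by move=> g h; apply: val_inj. Qed.

Lemma GL_mulmx g h : GLval (g * h)%g = GLval g *m GLval h.
Proof. by []. Qed.

(* Opaque, because unfolding the coercion to matrices makes conversion diverge. *)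
Lemma GL_of_sig : {f : M -> GL | forall A, A \in unitmx -> GLval (f A) = A}.
Proof. by exists (insubd (1%g : GL)) => A uA; apply: insubdK. Qed.

Definition GL_of : M -> GL := sval GL_of_sig.

Lemma GL_ofK A : A \in unitmx -> GLval (GL_of A) = A.
Proof. exact: (svalP GL_of_sig). Qed.

Definition elem_mx i j : M := 1%:M + delta_mx i j.

Lemma elem_mx_sqr i j : i != j -> elem_mx i j *m elem_mx i j = 1%:M.
Proof.
move=> ij; rewrite mulmxDl mul1mx mulmxDr mulmx1 mul_delta_mx_0; last by rewrite eq_sym.
rewrite addr0 -addrA (_ : delta_mx i j + delta_mx i j = 0) ?addr0 //.
by apply/matrixP => a b; rewrite !mxE F2_addrr.
Qed.

Definition elemGL i j := GL_of (elem_mx i j).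

Lemma elemGLE i j : i != j -> GLval (elemGL i j) = elem_mx i j.
Proof. by move=> ij; apply: GL_ofK; have [] := mulmx1_unit (elem_mx_sqr ij). Qed.

Lemma elem_mulE i j (A : M) a b :
  (elem_mx i j *m A) a b = A a b + (if a == i then A j b else 0).
Proof.
rewrite mulmxDl mul1mx mxE; congr (_ + _); rewrite mxE (bigD1 j) //= big1 => [|k kj].
  by rewrite addr0 mxE eqxx andbT; case: eqP; rewrite ?mul1r ?mul0r.
by rewrite mxE (negPf kj) andbF mul0r.
Qed.

Lemma elemGL_mulE i j g a b : i != j ->
  GLval (elemGL i j * g)%g a b = GLval g a b + (if a == i then GLval g j b else 0).
Proof. by move=> ij; rewrite GL_mulmx elemGLE // elem_mulE. Qed.

Lemma elemGL_chain i j k : i != j -> i != k -> j != k ->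
  (elemGL i j * elemGL j k)%g = (elemGL i k * (elemGL j k * elemGL i j))%g.
Proof.
move=> ij ik jk; have ki : k != i by rewrite eq_sym.
have kj : k != j by rewrite eq_sym.
apply: GLval_inj; rewrite [LHS]GL_mulmx [RHS]GL_mulmx [X in _ = _ *m X]GL_mulmx.
rewrite !elemGLE // /elem_mx.
rewrite !(mulmxDl, mulmxDr, mul1mx, mulmx1) !mul_delta_mx_cond eqxx.
rewrite (negPf ki) (negPf kj) !mulr0n !mulr1n ?mul0mx ?mulmx0 !addr0.
by rewrite !addrA [1%:M + delta_mx j k + _]addrAC.
Qed.

Section Generation.
Variable G : {group GL}.
Hypothesis elemG : forall i j, i != j -> elemGL i j \in G.

Definition first_cols (k : nat) (A : M) := forall i j, (j < k)%N -> A i j = (i == j)%:R.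

Lemma first_cols_elem (k : nat) i j g : (k <= j)%N -> i != j ->
  first_cols k (GLval g) -> first_cols k (GLval (elemGL i j * g)%g).
Proof.
move=> kj ij gk a b bk; rewrite elemGL_mulE // !gk // (_ : j == b = false).
  by case: ifP; rewrite addr0.
by apply/eqP => jb; move: bk; rewrite -jb ltnNge kj.
Qed.

(** If column k vanished from row k on, it would be a combination of the earlier unit columns, and
    [z] would be a nonzero kernel vector. *)
Lemma first_cols_pivot (k : nat) g (kn : (k < n)%N) : first_cols k (GLval g) ->
  exists2 i : 'I_m.+1, (k <= i)%N & GLval g i (Ordinal kn) != 0.
Proof.
move=> gk; set c := Ordinal kn.
case: (pselect (exists2 i : 'I_m.+1, (k <= i)%N & GLval g i c != 0)) => // no; exfalso.
have g0 i : (k <= i)%N -> GLval g i c = 0.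
  by move=> ki; apply/eqP; apply/negP => gi; case: no; exists i => //; apply/negP.
pose z : 'cV['F_2]_m.+1 := \col_i (if (i < k)%N then GLval g i c else (i == c)%:R).
have gz : GLval g *m z = 0.
  apply/colP => i; rewrite !mxE (bigID (fun j : 'I_m.+1 => (j < k)%N)) /=.
  rewrite (eq_bigr (fun j : 'I_m.+1 => (i == j)%:R * GLval g j c)) => [|j jk]; last first.
    by rewrite mxE jk gk.
  rewrite (bigD1 c (P := fun j : 'I_m.+1 => ~~ (j < k)%N)) /= ?ltnn // [z c 0]mxE ltnn eqxx.
  rewrite mulr1 [X in _ + (_ + X)]big1 ?addr0 => [|j /andP[jk jc]]; last first.
    by rewrite mxE (negPf jk) (negPf jc) mulr0.
  have [ik|ki] := ltnP i k; last first.
    rewrite g0 // addr0 big1 // => j jk; rewrite (_ : i == j = false) ?mul0r //.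
    by apply/eqP => E; move: jk; rewrite -E ltnNge ki.
  rewrite (bigD1 i) //= eqxx mul1r big1 ?addr0 ?F2_addrr // => j /andP[_ ji].
  by rewrite eq_sym (negPf ji) mul0r.
have : z = 0 by rewrite -[z](mulKmx (GL_unitmx g)) gz mulmx0.
by move=> /colP/(_ c); rewrite !mxE ltnn eqxx => /eqP; rewrite oner_eq0.
Qed.

(** Gaussian elimination on rows. Over F_2, adding the pivot row flips a wrong entry; [bad] counts
    the wrong entries of the current column. A zero pivot is itself a wrong entry, corrected by
    adding a lower row. *)
Lemma GL_generated : G :=: [set: GL].
Proof.
apply/setP => g; rewrite inE.
suff red (k : nat) : (k <= n)%N -> exists2 h, h \in G & first_cols k (GLval (h * g)%g).
  have [h hG hg] := red n (leqnn _).
  rewrite -(groupMl _ hG) (_ : (h * g = 1)%g) ?group1 //.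
  by apply: GLval_inj; apply/matrixP => a b; rewrite hg // GL_1E mxE.
elim: k => [_|k IH kn]; first by exists 1%g.
have [h0 h0G h0g] := IH (ltnW kn); pose c := Ordinal kn.
pose bad (x : GL) := #|[set i | GLval x i c != (i == c)%:R]|.
suff clear b x : (bad x < b)%N -> first_cols k (GLval x) ->
    exists2 h, h \in G & first_cols k.+1 (GLval (h * x)%g).
  have [h hG hg] := clear (bad (h0 * g)%g).+1 (h0 * g)%g (ltnSn _) h0g.
  by exists (h * h0)%g; [apply: groupM | rewrite -mulgA].
elim: b x => // b IHb x xb xk.
case: (set_0Vmem [set i | GLval x i c != (i == c)%:R]) => [x0|[i0 i0bad]].
  exists 1%g => // i j; rewrite mul1g ltnS leq_eqVlt => /orP[/eqP jk|]; last exact: xk.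
  have -> : j = c by apply: val_inj.
  by apply/eqP; move/setP/(_ i): x0; rewrite !inE => /negbT; rewrite negbK.
have step i j : (k <= j)%N -> i != j -> GLval x i c != (i == c)%:R -> GLval x j c = 1 ->
    exists2 h, h \in G & first_cols k.+1 (GLval (h * x)%g).
  move=> kj ij ib jx.
  have [||h hG hg] := IHb (elemGL i j * x)%g; last first.
  - by exists (h * elemGL i j)%g; [apply: groupM (elemG ij) | rewrite -mulgA].
  - exact: first_cols_elem.
  rewrite -ltnS; apply: leq_trans xb; rewrite ltnS; apply/proper_card/properP; split.
    apply/subsetP => a; rewrite !inE elemGL_mulE //; case: (eqVneq a i) => [-> _|_]; first exact: ib.
    by rewrite addr0.
  exists i; rewrite !inE // elemGL_mulE // eqxx jx negbK.
  move: ib; case: (F2P (GLval x i c)) => ->; case: (F2P (i == c)%:R) => ->;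
    by rewrite ?eqxx // => _; apply/eqP/val_inj.
have [xc0|xc0] := eqVneq (GLval x c c) 0.
  have [i ki xi] := first_cols_pivot kn xk.
  have ci : c != i by apply: contraNneq xi => <-; rewrite xc0.
  by apply: (step c i) => //; rewrite ?xc0 ?eqxx //; apply: F2_neq0.
have xc := F2_neq0 xc0; apply: (step i0 c) => //; last by rewrite inE in i0bad.
by apply: contraTneq i0bad => ->; rewrite inE xc eqxx negbK.
Qed.

End Generation.

Lemma row_free_pair (u v : 'rV['F_2]_m.+1) : u != 0 -> v != 0 -> u != v ->
  row_free (col_mx u v).
Proof.
move=> u0 v0 uv; apply: inj_row_free => w; rewrite -[w]hsubmxK mul_row_col.
rewrite [lsubmx w]mx11_scalar [rsubmx w]mx11_scalar !mul_scalar_mx.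
case: (F2P (lsubmx w 0 0)) => ->; case: (F2P (rsubmx w 0 0)) => ->;
  rewrite ?scale0r ?scale1r ?add0r ?addr0 => E.
- by rewrite raddf0 row_mx0.
- by rewrite E eqxx in v0.
- by rewrite E eqxx in u0.
- case/eqP: uv; apply/rowP => a; move/rowP/(_ a): E; rewrite !mxE.
  by case: (F2P (u 0 a)) => ->; case: (F2P (v 0 a)) => -> // /(congr1 val).
Qed.

(** Over F_2 two distinct nonzero vectors are linearly independent, so both pairs extend to
    bases. *)
Lemma GL_two_transitive i j (u v : 'rV['F_2]_m.+1) : i != j -> u != 0 -> v != 0 -> u != v ->
  exists x : GL, row i (GLval x) = u /\ row j (GLval x) = v.
Proof.
move=> ij u0 v0 uv.
pose U : 'M['F_2]_(1 + 1, m.+1) := col_mx (delta_mx 0 i) (delta_mx 0 j).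
pose f : M := \matrix_(a, b) (if a == i then u 0 b else if a == j then v 0 b else 0).
have fi : row i f = u by apply/rowP => b; rewrite !mxE eqxx.
have fj : row j f = v by apply/rowP => b; rewrite !mxE eqxx eq_sym (negPf ij).
have Uf : U *m f = col_mx u v by rewrite mul_col_mx -!rowE fi fj.
have d0 k : delta_mx 0 k != 0 :> 'rV['F_2]_m.+1.
  by apply/eqP => /rowP/(_ k); rewrite !mxE !eqxx => /eqP; rewrite oner_eq0.
have dij : delta_mx 0 i != delta_mx 0 j :> 'rV['F_2]_m.+1.
  apply/eqP => /rowP/(_ i); rewrite !mxE !eqxx (negPf ij) => /eqP.
  by rewrite oner_eq0.
have [|x ux Ux] := @complete_unitmx _ _ _ U f.
  by rewrite Uf (eqP (row_free_pair u0 v0 uv)) (eqP (row_free_pair (d0 i) (d0 j) dij)).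
exists (GL_of x); rewrite GL_ofK //.
by move: Ux; rewrite Uf mul_col_mx -!rowE => /eq_col_mx[].
Qed.

(* Iwasawa's argument: [A] is the group of transvections along [e_0]. *)
Lemma GL_normal_full (K : {group GL}) : (2 < m.+1)%N -> (K <| [set: GL])%g -> (K :!=: 1)%g ->
  K :=: [set: GL].
Proof.
move=> m2 nK K1.
have row0 x i : row i (GLval x) != 0.
  apply/eqP => r0; have := GL_unitmx x; rewrite -row_free_unit -kermx_eq0 => /eqP k0.
  have : (delta_mx 0 i : 'rV['F_2]_m.+1) *m GLval x = 0 by rewrite -rowE.
  move/sub_kermxP; rewrite k0 submx0 => /eqP/rowP/(_ i); rewrite !mxE !eqxx => /eqP.
  by rewrite oner_eq0.
have [g gK [i0 gi0]] : exists2 g, g \in K & exists i, row i (GLval g) != delta_mx 0 i.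
  have [g gK g1] : exists2 g, g \in K & g != 1%g.
    by have /trivgPn[g gK g1] := K1; exists g.
  exists g => //; apply/existsP; apply: contra_neqT g1 => /existsPn no.
  apply: GLval_inj; apply/row_matrixP => i; have := no i; rewrite negbK => /eqP ->.
  by rewrite GL_1E -[1]/(1%:M) row1.
(* Some element of [K] moves a basis row vector; conjugating it by two-transitivity gives elements
   of [K] that take e_0 to any e_j. *)
have trans (j : 'I_m.+1) : exists2 k, k \in K & row 0 (GLval k) = delta_mx 0 j.
  have [->|j0] := eqVneq j 0.
    by exists 1%g; rewrite ?group1 // GL_1E -[1]/(1%:M) row1.
  have d0 : delta_mx 0 i0 != 0 :> 'rV['F_2]_m.+1.
    apply/eqP => /rowP/(_ i0); rewrite !mxE !eqxx => /eqP; by rewrite oner_eq0.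
  rewrite eq_sym in j0; rewrite eq_sym in gi0.
  have [x [xi xj]] := GL_two_transitive j0 d0 (row0 g i0) gi0.
  have xN : (x^-1)%g \in ('N(K))%g by apply: (subsetP (normal_norm nK)); apply: in_setT.
  exists (g ^ x^-1)%g; first by rewrite (memJ_norm _ xN).
  rewrite conjgE invgK !GL_mulmx mulmxA rowE !mulmxA -rowE xi -rowE -xj rowE -mulmxA.
  by rewrite -GL_mulmx mulgV GL_1E mulmx1.
pose A := [set x : GL | [exists c : 'cV['F_2]_m.+1,
  (c 0 0 == 0) && (GLval x == 1%:M + c *m delta_mx 0 0)]].
have AP x : x \in A -> exists2 c : 'cV['F_2]_m.+1, c 0 0 = 0 &
    GLval x = 1%:M + c *m delta_mx 0 0.
  by rewrite inE => /existsP[c /andP[/eqP c0 /eqP xE]]; exists c.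
have Ac : {in A &, forall x y, commute x y}.
  move=> x y /AP[c c0 xE] /AP[d d0 yE]; apply: GLval_inj.
  have z (a : 'cV['F_2]_m.+1) : a 0 0 = 0 -> (delta_mx 0 0 : 'rV_m.+1) *m a = 0.
    by move=> a0; rewrite -rowE; apply/rowP => b; rewrite !mxE ord1 a0.
  have cd0 (a b : 'cV['F_2]_m.+1) : b 0 0 = 0 ->
      a *m delta_mx 0 0 *m (b *m delta_mx 0 0) = 0 :> M.
    by move=> b0; rewrite -mulmxA [delta_mx 0 0 *m _]mulmxA z // mul0mx mulmx0.
  rewrite [LHS]GL_mulmx [RHS]GL_mulmx xE yE !mulmxDl !mulmxDr !mul1mx !mulmx1 !cd0 //.
  by rewrite !addr0 addrAC.
have elemA i j : i != j -> exists2 k, k \in K & (elemGL j i ^ k^-1)%g \in A.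
  move=> ij; have [k kK k0] := trans i; exists k => //.
  rewrite inE; apply/existsP; exists (col j (GLval k)).
  have -> : col j (GLval k) 0 0 = 0.
    by move/rowP/(_ j): k0; rewrite !mxE eq_sym (negPf ij).
  have ki : (delta_mx 0 i : 'rV_m.+1) *m GLval k^-1%g = delta_mx 0 0.
    by rewrite -k0 rowE -mulmxA -GL_mulmx mulgV GL_1E mulmx1.
  rewrite eqxx andTb conjgE invgK [GLval _]GL_mulmx [GLval (_ * _)%g]GL_mulmx.
  rewrite elemGLE; last by rewrite eq_sym.
  rewrite /elem_mx mulmxDl mul1mx mulmxDr -GL_mulmx mulgV GL_1E; apply/eqP; congr (_ + _).
  by rewrite -[delta_mx j i](mul_delta_mx (0 : 'I_1)) -mulmxA ki mulmxA colE.
(* [K] conjugates every elementary matrix into the abelian group generated by [A], so GL / K is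
   abelian; elementary matrices are commutators and hence lie in [K]. *)
have full : K <*> <<A>> = [set: GL].
  apply: (@GL_generated (K <*> <<A>>)%G) => i j ij.
  have [|k kK TA] := elemA j i; first by rewrite eq_sym.
  have k' : k \in K <*> <<A>> by apply: (subsetP (joing_subl _ _)).
  have a' : (elemGL i j ^ k^-1)%g \in K <*> <<A>>.
    by apply: (subsetP (joing_subr _ _)); apply: mem_gen.
  by rewrite -(conjgKV k (elemGL i j)) groupJ.
have abA : abelian <<A>> by rewrite abelian_gen; apply/centsP => x xA y yA; apply: Ac.
have derK : ([set: GL]^`(1) \subset K)%g.
  apply: der1_min; first exact: normal_norm.
  rewrite /= -full quotientYidl ?quotient_abelian // gen_subG.
  by apply/subsetP => x _; apply: (subsetP (normal_norm nK)); apply: in_setT.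
apply: (@GL_generated K) => i k ik; have [j /andP[ij kj]] := third_index i k m2.
have jk : j != k by rewrite eq_sym.
apply: (subsetP derK).
have -> : elemGL i k = [~ (elemGL i j)^-1, (elemGL j k)^-1]%g.
  by rewrite commgEl conjgE !invgK mulgA elemGL_chain // -invMg mulgK.
exact: commg_in_der1.
Qed.

Lemma card_GL2 : #|[set: GL]| = gl2_order m.+1.
Proof.
rewrite (card_GL 'F_2 (ltn0Sn m)) card_Fp //.
elim: m => [|d IH]; first by rewrite /= bin_small // big_nat1.
rewrite -[gl2_order d.+2]/((2 ^ d.+2).-1 * (2 ^ d.+1 * gl2_order d.+1))%N -{}IH.
rewrite big_nat_recr //= binS bin1 expnD subn1 mulnA mulnAC -!mulnA.
by rewrite mulnCA [RHS]mulnCA; congr (_ * _)%N; apply: mulnCA.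
Qed.

End GL2.

(** * Quotients in which transvections are involutions *)

Lemma swp_inv n (i j : 'I_n) : i != j ->
  swp i j * swp j i = 1 :> autgroup (free_group n).
Proof.
move=> ij; have ji : j != i by rewrite eq_sym.
by apply: (mulIg (rho i j)); rewrite mul1g; aut_rel.
Qed.

Section InvolutiveQuotient.
Variables (n : nat) (gT : finGroupType) (G : {group gT}).
Variable Phi : autgroup (free_group n) -> gT.
Hypotheses (n3 : 2 < n) (PhiG : special_quotient G Phi).
Implicit Types i j k l : 'I_n.
Local Notation R i j := (Phi (rho i j)).
Local Notation L i j := (Phi (lam i j)).
Hypothesis R2 : forall i j, i != j -> R i j * R i j = 1.

Let PhiM a b : special_aut a -> special_aut b -> Phi (a * b) = Phi a * Phi b.
Proof. exact: (proj1 PhiG). Qed.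
Let sR i j : i != j -> special_aut (rho i j). Proof. exact: special_rho. Qed.
Let sL i j : i != j -> special_aut (lam i j). Proof. exact: special_lam. Qed.
Let sS i j : i != j -> special_aut (swp i j). Proof. exact: special_swp. Qed.

Lemma lam_sqr i j : i != j -> L i j * L i j = 1.
Proof.
move=> ij; have [k /andP[ik jk]] := third_index i j n3.
by rewrite (Phi_flip2 n3 PhiG ij ik jk) -conjMg R2 // conj1g.
Qed.

Lemma R_chain i j k : i != j -> i != k -> j != k -> R j k * R i j = R i j * R i k * R j k.
Proof. by move=> ij ik jk; rewrite -!PhiM ?rho_rho_chain ?specialM ?sR. Qed.

Lemma RL_chain i j k : i != j -> i != k -> j != k -> R j k * L i j = L i j * L i k * R j k.
Proof. by move=> ij ik jk; rewrite -!PhiM ?rho_lam_chain ?specialM ?sR ?sL. Qed.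

Lemma involutions_commute (x y : gT) : x * x = 1 -> y * y = 1 -> (x * y) * (x * y) = 1 ->
  commute x y.
Proof.
move=> x2 y2 xy2; apply: (mulgI (x * y)); rewrite xy2 -mulgA [y * (y * x)]mulgA y2 mul1g.
by rewrite x2.
Qed.

(** The product of the two involutions is conjugate to R_ij by the chain relation, hence an
    involution itself. *)
Lemma commute_RR i j k : i != j -> i != k -> commute (R i j) (R i k).
Proof.
move=> ij ik; have [->//|jk] := eqVneq j k.
apply: involutions_commute; rewrite ?R2 //.
have -> : R i j * R i k = R i j ^ (R j k)^-1 by rewrite conjgE invgK mulgA R_chain // mulgK.
by rewrite -conjMg R2 // conj1g.
Qed.

Lemma commute_LL i j k : i != j -> i != k -> commute (L i j) (L i k).
Proof.
move=> ij ik; have [->//|jk] := eqVneq j k.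
apply: involutions_commute; rewrite ?lam_sqr //.
have -> : L i j * L i k = L i j ^ (R j k)^-1 by rewrite conjgE invgK mulgA RL_chain // mulgK.
by rewrite -conjMg lam_sqr // conj1g.
Qed.

Lemma commute_LR i j k : i != j -> i != k -> commute (L i j) (R i k).
Proof.
by move=> ij ik; apply: (commute_Phi PhiG); rewrite ?sR ?sL //; apply: commute_lam_rho.
Qed.

Lemma Phi_swp1 i j : i != j -> Phi (swp i j) = R i j * R j i * L i j.
Proof.
move=> ij; have ji : j != i by rewrite eq_sym.
have E : Phi (swp i j) * L i j * R j i = R i j by rewrite -!PhiM ?swp_rho_lam ?specialM ?sR ?sL ?sS.
by rewrite -E -!mulgA [R j i * (R j i * _)]mulgA R2 // mul1g lam_sqr // mulg1.
Qed.

Lemma Phi_swp2 i j : i != j -> Phi (swp i j) = L i j * L j i * R i j.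
Proof.
move=> ij; have ji : j != i by rewrite eq_sym.
have E : L i j * Phi (swp i j) = L j i * R i j by rewrite -!PhiM ?swp_lam_rho ?specialM ?sR ?sL ?sS.
by rewrite -mulgA -E mulgA lam_sqr // mul1g.
Qed.

Section EqualSides.
Hypothesis RL : forall i j, i != j -> L i j = R i j.

(** With L = R the swap maps to the Weyl element, so Steinberg's hypotheses become relations between
    swaps and transvections. Symmetry of [weyl] comes from [swp_inv], as the Weyl elements are
    involutions. *)
Lemma level2_card_leq : #|G| <= gl2_order n.
Proof.
have n0 : 0 < n by apply: leq_trans n3.
pose e i j := R i j.
have weylE i j : i != j -> weyl e i j = Phi (swp i j).
  by move=> ij; rewrite Phi_swp1 // RL.
have e_comm i j k l : i != j -> k != l -> j != k -> i != l -> commute (e i j) (e k l).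
  move=> ij kl jk il; have [ik|ik] := eqVneq i k.
    by subst k; apply: commute_RR.
  apply: (commute_Phi PhiG); rewrite ?sR //; apply: commute_rho; rewrite // eq_sym //.
have weylC i j : i != j -> weyl e i j = weyl e j i.
  move=> ij; have ji : j != i by rewrite eq_sym.
  rewrite !weylE //; apply: (mulIg (Phi (swp j i))).
  rewrite -PhiM ?sS // swp_inv // (Phi1 PhiG) -weylE // /weyl !mulgA -(mulgA (e j i * e i j)).
  by rewrite R2 // mulg1 -(mulgA (e j i)) R2 // mulg1 R2.
have weylR i j k : i != j -> i != k -> j != k -> weyl e i j * e k i = e k j * weyl e i j.
  move=> ij ik jk; have [ki kj] : k != i /\ k != j by rewrite ![k == _]eq_sym.
  by rewrite weylE // -!PhiM ?swp_rhoR ?sR ?sS.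
have weylL i j k : i != j -> i != k -> j != k -> weyl e i j * e i k = e j k * weyl e i j.
  by move=> ij ik jk; rewrite weylE // -!PhiM ?swp_rhoL ?sR ?sS.
have [le _] := card_block (e := e) R2 R_chain e_comm weylC weylR weylL
  (p := Ordinal n0) (d := n.-1) (etrans (subn0 n) (esym (prednK n0))).
rewrite prednK // in le; apply: leq_trans le; apply: subset_leq_card.
apply: (special_quotient_sub n3 PhiG (H := [group of elementary_group e (block (Ordinal n0))])).
by move=> i j ij; rewrite RL //; split; apply: (@mem_elementary _ _ e).
Qed.

End EqualSides.

(** The image of the partial conjugation x_i -> x_j^-1 x_i x_j. *)
Definition conj_trans i j := R i j * L i j.
Local Notation K := conj_trans.

Lemma K_sqr i j : i != j -> K i j * K i j = 1.
Proof.
move=> ij; rewrite /K -mulgA [L i j * _]mulgA (commute_LR ij ij) -!mulgA lam_sqr // mulg1.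
by rewrite R2.
Qed.

Lemma K_R_chain i j k : i != j -> i != k -> j != k -> K i j ^ (R j k)^-1 = K i j * K i k.
Proof.
move=> ij ik jk; rewrite conjMg ![_ ^ (R j k)^-1]conjgE !invgK ![R j k * (_ * _)]mulgA.
rewrite R_chain // RL_chain // !mulgK /K -!mulgA; congr (_ * _).
by rewrite !mulgA (commute_LR ij ik).
Qed.

(** Obtained by equating the two expressions for the image of [swp i j]. *)
Lemma K_swap i j : i != j -> K i j * R j i = L j i * K i j.
Proof.
move=> ij; have ji : j != i by rewrite eq_sym.
have E : L i j * L j i * R i j = R i j * R j i * L i j by rewrite -Phi_swp1 // -Phi_swp2.
transitivity (L i j * (R i j * R j i * L i j) * L i j).
  by rewrite /K -(commute_LR ij ij) -!mulgA lam_sqr // mulg1.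
by rewrite -E !mulgA lam_sqr // mul1g -!mulgA.
Qed.

Lemma R_inv i j : i != j -> (R i j)^-1 = R i j.
Proof. by move=> ij; apply: (mulgI (R i j)); rewrite mulgV R2. Qed.

Lemma K_R_swap i j : i != j -> K i j ^ (R j i)^-1 = K j i * K i j.
Proof.
move=> ij; have ji : j != i by rewrite eq_sym.
by rewrite conjgE invgK R_inv // K_swap // mulgA.
Qed.

Lemma K_L_swap i j : i != j -> K i j ^ (L j i)^-1 = K j i * K i j.
Proof.
move=> ij; have ji : j != i by rewrite eq_sym.
have E : K i j * L j i = R j i * K i j.
  apply: (mulgI (K i j)); rewrite mulgA K_sqr // mul1g mulgA K_swap //.
  by rewrite -mulgA K_sqr // mulg1.
have LV : (L j i)^-1 = L j i by apply: (mulgI (L j i)); rewrite mulgV lam_sqr.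
by rewrite conjgE invgK LV E mulgA (commute_LR ji ji).
Qed.

Lemma lam_R_conj i j k : i != j -> i != k -> j != k -> R i j ^ (L j k)^-1 = R i j * R i k.
Proof.
move=> ij ik jk.
have E : R i k * (L j k * R i j) = R i j * L j k.
  by rewrite -!PhiM ?lam_rho_chain ?specialM ?sR ?sL.
rewrite conjgE invgK -(commute_RR ik ij) mulgA; apply: (mulgI (R i k)).
by rewrite mulgA E mulgK mulgA R2 // mul1g.
Qed.

Lemma lam_L_conj i j k : i != j -> i != k -> j != k -> L i j ^ (L j k)^-1 = L i j * L i k.
Proof.
move=> ij ik jk.
have E : L i k * (L j k * L i j) = L i j * L j k.
  by rewrite -!PhiM ?lam_lam_chain ?specialM ?sR ?sL.
rewrite conjgE invgK -(commute_LL ik ij) mulgA; apply: (mulgI (L i k)).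
by rewrite mulgA E mulgK mulgA lam_sqr // mul1g.
Qed.

Lemma K_L_chain i j k : i != j -> i != k -> j != k -> K i j ^ (L j k)^-1 = K i j * K i k.
Proof.
move=> ij ik jk; rewrite [K i j ^ _]conjMg lam_R_conj // lam_L_conj // /K -!mulgA; congr (_ * _).
by rewrite !mulgA (commute_LR ij ik).
Qed.

Lemma commuteP_conj (x y : gT) : x ^ y^-1 = x -> commute x y.
Proof. by move/conjg_fixP/commgP/commuteV; rewrite invgK. Qed.

Lemma commute_KK i j k : i != j -> i != k -> commute (K i j) (K i k).
Proof.
move=> ij ik; apply: commuteM; apply/commute_sym/commuteM.
- exact: commute_RR.
- exact/commute_sym/commute_LR.
- exact: commute_LR.
- exact: commute_LL.
Qed.

(* [r_k i] is moved to [r_k i r_k j] by both factors of [K i j]. *)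
Lemma commute_K_R i j k : i != j -> i != k -> j != k -> commute (K i j) (R k i).
Proof.
move=> ij ik jk; have [ki kj] : k != i /\ k != j by rewrite ![k == _]eq_sym.
apply/commute_sym/commuteP_conj; rewrite invMg conjgM lam_R_conj //.
have c : commute (R k j) (R i j).
  by apply: (commute_Phi PhiG); rewrite ?sR //; apply: commute_rho.
rewrite conjMg [R k j ^ _](_ : _ = R k j); last first.
  by apply/conjg_fixP/commgP/commuteV.
by rewrite conjgE invgK mulgA R_chain // mulgK -mulgA R2 // mulg1.
Qed.

Lemma commute_K_far i j k l : i != j -> k != l -> i != k -> j != k -> i != l ->
  commute (K i j) (R k l) /\ commute (K i j) (L k l).
Proof.
move=> ij kl ik jk il.
have [ki kj] : k != i /\ k != j by rewrite ![k == _]eq_sym.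
split; apply/commute_sym/commuteM; apply: (commute_Phi PhiG); rewrite ?sR ?sL //.
- by apply: commute_rho; rewrite // eq_sym.
- by apply/commute_sym/commute_lam_rho2; rewrite // eq_sym.
- by apply: commute_lam_rho2; rewrite // eq_sym.
- by apply: commute_lam; rewrite // eq_sym.
Qed.

(** The image of the basis-conjugating automorphisms. Since R_ij is an involution, killing R_ij L_ij
    identifies L_ij with R_ij. *)
Definition trans_core := <<[set K ij.1 ij.2 | ij : 'I_n * 'I_n & ij.1 != ij.2]>>.
Canonical trans_core_group := Eval hnf in [group of trans_core].
Local Notation D := trans_core.

Lemma mem_core i j : i != j -> K i j \in D.
Proof. by move=> ij; apply/mem_gen/imsetP; exists (i, j); rewrite ?inE. Qed.

Lemma core_sub (H : {group gT}) : (forall i j, i != j -> K i j \in H) -> D \subset H.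
Proof.
move=> KH; rewrite gen_subG; apply/subsetP => x /imsetP[[i j]].
by rewrite inE /= => ij ->; apply: KH.
Qed.

Lemma core_sub_G : D \subset G.
Proof. by apply: core_sub => i j ij; rewrite groupM // (Phi_in PhiG) ?sR ?sL. Qed.

Lemma core_normal : D <| G.
Proof.
rewrite /normal core_sub_G /=.
have RN i j : i != j -> R i j \in 'N(D).
  move=> ij; rewrite -groupV inE -genJ gen_subG; apply/subsetP => x /imsetP[y /imsetP[[k l]]].
  rewrite inE /= => kl -> ->.
  have fix_in : commute (K k l) (R i j) -> K k l ^ (R i j)^-1 \in D.
    by move=> c; rewrite (conjg_fixP _) ?mem_core //; apply/commgP/commuteV.
  have [ik|ik] := eqVneq i k.
    subst k; apply: fix_in; apply/commute_sym/commuteM; first exact: commute_RR.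
    exact/commute_sym/commute_LR.
  have ki : k != i by rewrite eq_sym.
  have [il|il] := eqVneq i l.
    subst l; have [kj|kj] := eqVneq k j.
      by subst k; rewrite K_R_swap // groupM // mem_core.
    by rewrite K_R_chain // groupM // mem_core.
  have li : l != i by rewrite eq_sym.
  have [jk|jk] := eqVneq k j; first by subst k; apply/fix_in/commute_K_R.
  by apply: fix_in; have [] := commute_K_far kl ij ki li jk.
apply: (special_quotient_sub n3 PhiG) => i j ij; split; first exact: RN.
have -> : L i j = (R i j)^-1 * K i j by rewrite mulKg.
by rewrite groupM ?groupV ?RN // (subsetP (normG _)) // mem_core.
Qed.

(** The factors [R b c] and [L b c] of [K b c] change [K a b] by the same involution [K a c], so the
    two changes cancel. The pair [K i j], [K j i] is handled in the same way. *)
Lemma core_abelian : abelian D.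
Proof.
rewrite /abelian; apply: core_sub => i j ij; rewrite /= /trans_core cent_gen.
apply/centP => x /imsetP[[k l]]; rewrite inE /= => kl ->.
have chain a b c : a != b -> b != c -> a != c -> commute (K a b) (K b c).
  move=> ab bc ac; apply: commuteP_conj; rewrite invMg conjgM K_L_chain //.
  rewrite [(K a b * K a c) ^ _]conjMg K_R_chain // [K a c ^ _](_ : _ = K a c).
    by rewrite -mulgA K_sqr // mulg1.
  apply/conjg_fixP/commgP/commuteV.
  have cb : c != b by rewrite eq_sym.
  by have [] := commute_K_far ac bc ab cb ac.
have [ik|ik] := eqVneq i k; first by subst k; apply: commute_KK.
have ki : k != i by rewrite eq_sym.
have [jk|jk] := eqVneq j k.
  subst k; have [il|il] := eqVneq i l; last exact: chain.
  subst l; apply: commuteP_conj; rewrite invMg conjgM K_L_swap // [(_ * _) ^ _]conjMg.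
  rewrite K_R_swap // [K j i ^ _](_ : _ = K j i); first by rewrite mulgA K_sqr ?mul1g.
  apply/conjg_fixP/commgP/commuteV/commute_sym/commuteM; first exact: commute_RR.
  exact/commute_sym/commute_LR.
have [il|il] := eqVneq i l; last by have [c1 c2] := commute_K_far ij kl ik jk il; apply: commuteM.
have kj : k != j by rewrite eq_sym.
by subst l; apply/commute_sym/chain.
Qed.

End InvolutiveQuotient.

Lemma special_quotient_coset n (gT : finGroupType) (G D : {group gT}) Phi : D <| G ->
  special_quotient (n := n) G Phi -> special_quotient (G / D)%G (fun a => coset D (Phi a)).
Proof.
move=> nDG PhiG; have nD := normal_norm nDG; split=> [a b sa sb|y].
  by rewrite (proj1 PhiG) // morphM //; apply: (subsetP nD); apply: (Phi_in PhiG).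
split=> [/morphimP[x xN xG ->]|[a sa <-]].
  by have /(proj2 PhiG)[a sa aE] := xG; exists a; rewrite ?aE.
by rewrite mem_quotient // (Phi_in PhiG).
Qed.

(** * Reduction modulo 2 *)

Section ToGL.
Variable m : nat.
Local Notation n := m.+1.
Local Notation F := (free_group m.+1).
Implicit Types (a b : autgroup F).

Definition aut_GL a : {'GL_n['F_2]} := GL_of (map_mx (intr : int -> 'F_2) (aut_mx a)).

Lemma aut_GLE a : GLval (aut_GL a) = map_mx (intr : int -> 'F_2) (aut_mx a).
Proof.
apply: GL_ofK; have : (map_mx (intr : int -> 'F_2) (aut_mx a) *m
    map_mx (intr : int -> 'F_2) (aut_mx a^-1%g) = 1%:M)%R.
  by rewrite -map_mxM -aut_mxM mulgV aut_mx1 map_mx1.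
by move=> /mulmx1_unit[].
Qed.

Lemma aut_GLM a b : aut_GL (a * b) = aut_GL a * aut_GL b.
Proof. by apply: GLval_inj; rewrite GL_mulmx !aut_GLE aut_mxM map_mxM. Qed.

(** The indices are exchanged because the images of the generators are the columns of [aut_mx]. *)
Lemma aut_GL_rho i j : i != j -> aut_GL (rho i j) = elemGL j i.
Proof.
move=> ij; apply: GLval_inj; rewrite aut_GLE elemGLE 1?eq_sym //; apply/matrixP => k l.
rewrite !mxE rhoE //; case: (eqVneq l i) => [->|li].
  by rewrite exp_sumM !exp_sum_gen !mxE !andbT rmorphD /= !rmorph_nat.
by rewrite exp_sum_gen !mxE !andbT andbF addr0 rmorph_nat.
Qed.

Lemma aut_GL_lam i j : i != j -> aut_GL (lam i j) = elemGL j i.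
Proof.
move=> ij; apply: GLval_inj; rewrite aut_GLE elemGLE 1?eq_sym //; apply/matrixP => k l.
rewrite !mxE lamE //; case: (eqVneq l i) => [->|li].
  rewrite exp_sumM exp_sumV !exp_sum_gen !mxE !andbT rmorphD rmorphN /= !rmorph_nat addrC.
  by congr (_ + _)%R; case: eqP => // _; apply: val_inj.
by rewrite exp_sum_gen !mxE !andbT andbF addr0 rmorph_nat.
Qed.

Lemma aut_GL_quotient : 2 < n -> special_quotient [group of [set: {'GL_n['F_2]}]] aut_GL.
Proof.
move=> n3; split=> [a b _ _|y]; first exact: aut_GLM.
split=> [_|_]; last by rewrite in_setT.
pose H := [set y | `[< exists2 a, special_aut a & aut_GL a = y >]].
have HG : group_set H.
  apply/group_setP; split.
    rewrite inE; apply/asboolP; exists 1; first exact: special1.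
    by apply: (mulgI (aut_GL 1)); rewrite -aut_GLM !mulg1.
  move=> u v; rewrite !inE => /asboolP[a sa <-] /asboolP[b sb <-]; apply/asboolP.
  by exists (a * b); rewrite ?aut_GLM // specialM.
have E : Group HG :=: [set: {'GL_n['F_2]}].
  apply: GL_generated => i j ij; rewrite inE; apply/asboolP; exists (rho j i).
    by apply: special_rho; rewrite // eq_sym.
  by rewrite aut_GL_rho // eq_sym.
have : y \in Group HG by rewrite E in_setT.
by rewrite inE => /asboolP.
Qed.

End ToGL.

Section LevelTwo.
Variables (m : nat) (gT : finGroupType) (G : {group gT}).
Local Notation n := m.+1.
Variable Phi : autgroup (free_group m.+1) -> gT.
Hypotheses (n3 : 2 < n) (PhiG : special_quotient G Phi).
Local Notation R i j := (Phi (rho i j)).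
Local Notation L i j := (Phi (lam i j)).
Local Notation GL := {'GL_n['F_2]}.

(* The image of SAut F_n in GL_n(F_2) x G has order at most |GL_n(F_2)|, hence is the
   graph of a homomorphism GL_n(F_2) -> G. *)
Lemma level2_isog : (forall i j, i != j -> R i j * R i j = 1) ->
  (forall i j, i != j -> L i j = R i j) -> G :!=: 1 -> G \isog [set: GL].
Proof.
move=> R2 RL G1; have GLq := aut_GL_quotient n3.
pose Theta a : GL * gT := (aut_GL a, Phi a).
have ThetaM a b : special_aut a -> special_aut b -> Theta (a * b) = Theta a * Theta b.
  by move=> sa sb; rewrite /Theta aut_GLM (proj1 PhiG).
pose H := [set y | `[< exists2 a, special_aut a & Theta a = y >]].
have HP y : reflect (exists2 a, special_aut a & Theta a = y) (y \in H).
  by rewrite inE; apply: asboolP.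
have HG : group_set H.
  apply/group_setP; split.
    apply/HP; exists 1; first exact: special1.
    by apply: (mulgI (Theta 1)); rewrite -ThetaM ?mulg1 ?special1.
  move=> u v /HP[a sa <-] /HP[b sb <-]; apply/HP.
  by exists (a * b); rewrite ?ThetaM // specialM.
pose Gam := Group HG.
have TG : special_quotient Gam Theta.
  by split=> // y; split=> [/HP|h]; [|apply/HP].
have cG : #|Gam| <= gl2_order n.
  apply: (level2_card_leq n3 TG) => i j ij.
    rewrite /Theta -[_ * _]/(aut_GL (rho i j) * aut_GL (rho i j), R i j * R i j) R2 //.
    rewrite aut_GL_rho //; congr (_, _); apply: GLval_inj.
    by rewrite GL_mulmx elemGLE 1?eq_sym // elem_mx_sqr 1?eq_sym.
  by rewrite /Theta aut_GL_rho // aut_GL_lam // RL.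
have fM : {in Gam &, {morph (fst : GL * gT -> GL) : x y / x * y}} by [].
have hM : {in Gam &, {morph (snd : GL * gT -> gT) : x y / x * y}} by [].
pose f := Morphism fM; pose h := Morphism hM.
have fim : f @* Gam = [set: GL].
  apply/setP => y; rewrite in_setT; have : y \in [group of [set: GL]] by rewrite in_setT.
  move=> /(proj2 GLq)[a sa <-]; apply/morphimP; exists (Theta a) => //; by apply/HP; exists a.
have him : h @* Gam = G.
  apply/setP => y; apply/morphimP/idP => [[x /HP[a sa <-] _ ->]|/(proj2 PhiG)[a sa <-]].
    exact: (Phi_in PhiG).
  by exists (Theta a) => //; apply/HP; exists a.
have finj : 'injm f.
  by rewrite -card_im_injm eqn_leq leq_morphim fim card_GL2.
have isoGL : Gam \isog [set: GL] by apply/isogP; exists f.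
suff hinj : 'injm h.
  by apply: isog_trans isoGL; rewrite isog_sym; apply/isogP; exists h.
(* By simplicity the kernel of the second projection is trivial or everything, and in the latter
   case [G] would be trivial. *)
have [K1|K1] := eqVneq (f @* 'ker h) 1.
  by rewrite subG1 -(morphim_injm_eq1 finj) ?subsetIl // K1.
have nK : f @* 'ker h <| [set: GL].
  by have := morphim_normal f (ker_normal h); rewrite fim.
have E := GL_normal_full n3 nK K1.
have sGk : Gam \subset 'ker h by rewrite -(injmSK finj) // fim E.
by move: G1; rewrite -him -subG1; move: sGk; rewrite ker_trivg_morphim => /andP[_ ->].
Qed.

End LevelTwo.

(** SAut F_n is perfect: the chain relations make every transvection a commutator up to
    conjugation. *)
Lemma special_quotient_abelian n (gT : finGroupType) (G : {group gT}) Phi : 2 < n ->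
  special_quotient (n := n) G Phi -> abelian G -> G :=: 1.
Proof.
move=> n3 PhiG aG; apply/trivgP.
have PhiM := proj1 PhiG; have cG a b : special_aut a -> special_aut b -> commute (Phi a) (Phi b).
  by move=> sa sb; apply: (centsP aG); apply: (Phi_in PhiG).
have triv a b c : special_aut a -> special_aut b -> special_aut c ->
    a * b = b * c * a -> Phi c = 1.
  move=> sa sb sc /(congr1 Phi); rewrite !PhiM ?specialM // (cG a b) // -mulgA => /mulgI.
  by rewrite (cG c a) // -[LHS]mulg1 => /mulgI.
apply: (special_quotient_sub n3 PhiG (H := 1%G)) => i k ik; rewrite !inE.
have [j /andP[ij kj]] := third_index i k n3; have jk : j != k by rewrite eq_sym.
rewrite (triv _ _ _ _ _ _ (rho_rho_chain ij ik jk)) ?special_rho //.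
by rewrite (triv _ _ _ _ _ _ (rho_lam_chain ij ik jk)) ?special_rho ?special_lam ?eqxx.
Qed.

Section Minimal.
Variables (m : nat) (gT : finGroupType) (G : {group gT}).
Local Notation n := m.+1.
Variable Phi : autgroup (free_group m.+1) -> gT.
Hypotheses (n3 : 2 < n) (PhiG : special_quotient G Phi).
Local Notation GL := {'GL_n['F_2]}.

Lemma involutive_quotient_minimal :
  (forall i j, i != j -> Phi (rho i j) * Phi (rho i j) = 1) -> G :!=: 1 ->
  #|[set: GL]| <= #|G| /\ (#|G| = #|[set: GL]| -> G \isog [set: GL]).
Proof.
move=> R2 G1; pose D := trans_core_group Phi.
have nD : D <| G := core_normal n3 PhiG R2.
have aD : abelian D := core_abelian n3 PhiG R2.
have Q := special_quotient_coset nD PhiG.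
have inN a : special_aut a -> Phi a \in 'N(D).
  by move=> sa; apply: (subsetP (normal_norm nD)); apply: (Phi_in PhiG).
(* Otherwise [G] would equal the abelian group [D], and an abelian quotient of SAut F_n is
   trivial. *)
have Q1 : (G / D)%G :!=: 1.
  apply: contra G1 => /eqP Q1; apply/eqP/(special_quotient_abelian n3 PhiG).
  by apply: abelianS aD; rewrite -quotient_sub1 ?normal_norm // Q1.
have isoQ : (G / D)%G \isog [set: GL].
  apply: (level2_isog n3 Q) => // i j ij.
    by rewrite -morphM ?inN ?special_rho // R2 // morph1.
  have rl : coset D (Phi (rho i j)) * coset D (Phi (lam i j)) = 1.
    rewrite -morphM ?inN ?special_rho ?special_lam //; apply: coset_id.
    exact: mem_core.
  have r2 : coset D (Phi (rho i j)) * coset D (Phi (rho i j)) = 1.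
    by rewrite -morphM ?inN ?special_rho // R2 // morph1.
  by apply: (mulgI (coset D (Phi (rho i j)))); rewrite rl r2.
have cG : #|G| = (#|[set: GL]| * #|D|)%N.
  by rewrite -(card_isog isoQ) card_quotient ?normal_norm // mulnC Lagrange ?normal_sub.
split=> [|E]; first by rewrite cG leq_pmulr ?cardG_gt0.
have D1 : D :=: 1.
  apply: card1_trivg; apply/eqP; rewrite -(eqn_pmul2l (cardG_gt0 [group of [set: GL]])) /=.
  by rewrite -cG E muln1.
apply: isog_trans isoQ; rewrite /= D1; exact: quotient1_isog.
Qed.

Lemma special_quotient_minimal : n = 3 \/ n = 4 -> G :!=: 1 ->
  #|[set: GL]| <= #|G| /\ (#|G| = #|[set: GL]| -> G \isog [set: GL]).
Proof.
move=> n34 G1.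
case: (pselect (forall i j, i != j -> Phi (rho i j) * Phi (rho i j) = 1)) => [R2|].
  exact: involutive_quotient_minimal.
move=> /existsNP[i] /existsNP[j] /not_implyP[ij /eqP r2].
have lt : #|[set: GL]| < #|G|.
  rewrite card_GL2; case: n34 => nE; rewrite nE.
    exact: (special_quotient_bound3 n3 PhiG nE ij).
  exact: (special_quotient_bound4 n3 PhiG nE ij).
by split=> [|E]; [apply: ltnW | rewrite E ltnn in lt].
Qed.

End Minimal.

(** * PSL_n(F_2) as a quotient of Out F_n and SOut F_n *)

Section PSL2.
Variable m : nat.
Local Notation n := m.+1.
Hypothesis n3 : 2 < n.
Local Notation GL := {'GL_n['F_2]}.

Lemma GL_nonabelian : ~~ abelian [set: GL].
Proof.
apply/negP => aG; have := special_quotient_abelian n3 (aut_GL_quotient n3) aG => /= G1.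
pose i : 'I_n := Ordinal (ltn0Sn m); pose j : 'I_n := Ordinal (ltn_trans (ltnSn 1) n3).
have ij : i != j by [].
have : elemGL i j \in [set: GL] by rewrite in_setT.
rewrite G1 => /set1P e1; have := congr1 (fun g : GL => GLval g i j) e1.
rewrite elemGLE // GL_1E !mxE !eqxx (negPf ij) => /(congr1 val).
by [].
Qed.

Lemma SL_F2 : SLgroup n 'F_2 = [set: GL].
Proof.
by apply/setP => u; rewrite !inE; apply/eqP/F2_neq0; apply: GL_det.
Qed.

Lemma center_SL_F2 : 'Z(SLgroup n 'F_2) = 1.
Proof.
apply/eqP; apply: contraR GL_nonabelian => Z1.
have nZ : 'Z(SLgroup n 'F_2) <| [set: GL] by rewrite -SL_F2 center_normal.
by rewrite -(GL_normal_full n3 nZ Z1) center_abelian.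
Qed.

Lemma PSL_isog : PSLgroup n 'F_2 \isog [set: GL].
Proof. by rewrite isog_sym /PSLgroup /= center_SL_F2 SL_F2 quotient1_isog. Qed.

End PSL2.

(** * Quotients as images of homomorphisms *)

Section FactorHom.
Variables (Q : groupType) (gT : finGroupType) (G : {group gT}).

Lemma is_quotient_hom (h : Q -> gT) : {morph h : x y / x * y} ->
  (forall y, y \in G <-> exists x, h x = y) -> is_quotient Q G.
Proof.
move=> hM hG.
have h1 : h 1 = 1 by apply: (mulgI (h 1)); rewrite -hM !mulg1.
have hV x : h x^-1 = (h x)^-1 by apply: (mulgI (h x)); rewrite -hM !mulgV.
pose K : {pred Q} := [pred x | h x == 1].
have KG : group_closed K.
  split=> [|x y]; rewrite !inE ?h1 // => /eqP hx /eqP hy.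
  by rewrite hM hV hx hy invg1 mulg1.
have KJ x y : x \in K -> x ^ y \in K.
  by rewrite !inE => /eqP hx; rewrite /conjg !hM hV hx mul1g mulVg.
pose N := NormalSubgroup KG KJ.
pose f (a : factor_group N) : gT := h (repr a).
have fpi x : f (\pi_(factor_group N) x)%qT = h x.
  have := factor_reprP N x; rewrite inE hM hV => /eqP E.
  by apply: (mulgI (h x)^-1); rewrite mulVg.
have fM : {morph f : a b / a * b}.
  move=> a b; rewrite -[a]reprK -[b]reprK.
  rewrite (_ : _ * _ = (\pi_(factor_group N) (repr a * repr b)%g)%qT); last exact: factor_mul_pi.
  by rewrite !fpi hM.
pose ff : {multiplicative factor_group N -> gT} :=
  HB.pack f (isMultiplicative.Build _ _ f fM).
exists N, ff; split.
  move=> a b /= E; rewrite -[a]reprK -[b]reprK; apply/factor_eqP.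
  by rewrite inE hM hV [h (repr a)]E mulVg.
move=> y; split=> [/hG[x <-]|[a <-]]; first by exists (\pi_(factor_group N) x)%qT; apply: fpi.
by apply/hG; exists (repr a).
Qed.

Lemma hom_is_quotient : is_quotient Q G ->
  exists h : Q -> gT, {morph h : x y / x * y} /\ (forall y, y \in G <-> exists x, h x = y).
Proof.
case=> N [f [_ fG]]; exists (fun x => f (\pi_(factor_group N) x)%qT); split.
  move=> x y; rewrite -gmulfM; congr (f _); apply/esym; exact: factor_mul_pi.
move=> y; split=> [/fG[a <-]|[x <-]]; first by exists (repr a); rewrite reprK.
by apply/fG; exists (\pi_(factor_group N) x)%qT.
Qed.

End FactorHom.

Section Out.
Variable n : nat.
Local Notation F := (free_group n).
Implicit Types a b : autgroup F.

Definition out_pi a : outgroup F := (\pi_(outgroup F) a)%qT.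

Lemma out_piM a b : out_pi (a * b) = out_pi a * out_pi b.
Proof. by apply/esym; apply: factor_mul_pi. Qed.

Lemma out_pi_SOut a : (out_pi a \in SOut_pred (n := n)) = special_aut a.
Proof. by rewrite inE out_mxE. Qed.

(** Automorphisms of determinant -1 get the default value 1, which [special_quotient] never
    inspects. *)
Definition sout_pi a : SOut_free n := insubd (1 : SOut_free n) (out_pi a).

Lemma val_sout_pi a : special_aut a -> val (sout_pi a) = out_pi a.
Proof. by move=> sa; rewrite val_insubd out_pi_SOut sa. Qed.

Lemma sout_special_quotient (gT : finGroupType) (G : {group gT}) :
  is_quotient (SOut_free n) G -> exists Phi, special_quotient (n := n) G Phi.
Proof.
move=> /hom_is_quotient[h [hM hG]]; exists (fun a => h (sout_pi a)); split.
  move=> a b sa sb; rewrite -hM; congr h; apply: val_inj.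
  by rewrite val_sout_pi ?specialM // out_piM valM !val_sout_pi.
move=> y; split=> [/hG[s <-]|[a _ <-]]; last by apply/hG; exists (sout_pi a).
have piE : out_pi (repr (val s)) = val s by rewrite /out_pi reprK.
have ss : special_aut (repr (val s)) by rewrite -out_pi_SOut piE; apply: valP.
by exists (repr (val s)) => //; congr h; apply: val_inj; rewrite val_sout_pi.
Qed.

(* Commutators have determinant 1, so a quotient of Out F_n in which SAut F_n dies is
   abelian. *)
Lemma out_special_quotient (gT : finGroupType) (G : {group gT}) : ~~ abelian G ->
  is_quotient (outgroup F) G ->
  exists Phi (H : {group gT}), [/\ special_quotient (n := n) H Phi, H \subset G & H :!=: 1].
Proof.
move=> nab /hom_is_quotient[h [hM hG]]; pose Phi a := h (out_pi a).
have PhiM a b : Phi (a * b) = Phi a * Phi b by rewrite /Phi out_piM hM.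
pose S := [set y | `[< exists2 a, special_aut a & Phi a = y >]].
have SP y : reflect (exists2 a, special_aut a & Phi a = y) (y \in S).
  by rewrite inE; apply: asboolP.
have SG : group_set S.
  apply/group_setP; split.
    by apply/SP; exists 1; [apply: special1 | apply: (mulgI (Phi 1)); rewrite -PhiM !mulg1].
  move=> u v /SP[a sa <-] /SP[b sb <-]; apply/SP.
  by exists (a * b); rewrite ?PhiM // specialM.
exists Phi, (Group SG); split.
- by split=> // y; split=> [/SP|s]; [|apply/SP].
- by apply/subsetP => _ /SP[a _ <-]; apply/hG; exists (out_pi a).
apply: contra nab => /eqP S1; apply/centsP => u /hG[x <-] v /hG[y <-].
have comm a b : Phi a * Phi b = Phi b * Phi a.
  have sab : special_aut (a * b * (b * a)^-1).
    rewrite /special_aut aut_mxM det_mulmx.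
    have -> : (\det (aut_mx (a * b)%g) = \det (aut_mx (b * a)%g))%R.
      by rewrite !aut_mxM !det_mulmx mulrC.
    by rewrite aut_detV.
  have : Phi (a * b * (b * a)^-1) \in S by apply/SP; exists (a * b * (b * a)^-1).
  rewrite -[S]/(gval (Group SG)) S1 => /set1P c1.
  by rewrite -!PhiM -[a * b](mulgVK (b * a)) [LHS]PhiM c1 mul1g.
rewrite /commute -[x]reprK -[y]reprK; exact: (comm (repr x) (repr y)).
Qed.

End Out.

Section OutGL.
Variable m : nat.
Local Notation n := m.+1.
Local Notation F := (free_group m.+1).
Hypothesis n3 : 2 < n.

Definition out_GL (x : outgroup F) : {'GL_n['F_2]} := aut_GL (repr x).

Lemma out_GLM : {morph out_GL : x y / x * y}.
Proof.
move=> x y; apply: GLval_inj; rewrite GL_mulmx /out_GL !aut_GLE -map_mxM.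
by rewrite -[aut_mx (repr (x * y))]/(out_mx (x * y)) out_mxM.
Qed.

Lemma out_GL_pi (a : autgroup F) : out_GL (out_pi a) = aut_GL a.
Proof. by apply: GLval_inj; rewrite /out_GL !aut_GLE -[aut_mx (repr _)]/(out_mx _) out_mxE. Qed.

Definition out_PSL (x : outgroup F) := coset 'Z(SLgroup n 'F_2) (out_GL x).

Lemma in_normZ (u : {'GL_n['F_2]}) : u \in 'N('Z(SLgroup n 'F_2)).
Proof. by rewrite center_SL_F2 // norm1 in_setT. Qed.

Lemma out_PSLM : {morph out_PSL : x y / x * y}.
Proof. by move=> x y; rewrite /out_PSL out_GLM morphM // in_normZ. Qed.

Lemma out_PSL_in x : out_PSL x \in PSLgroup n 'F_2.
Proof. by apply: mem_quotient; rewrite /= SL_F2; apply: in_setT. Qed.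

Lemma out_PSL_surj y : y \in PSLgroup n 'F_2 ->
  exists2 a : autgroup F, special_aut a & out_PSL (out_pi a) = y.
Proof.
case/morphimP => u _ _ ->.
have /(proj2 (aut_GL_quotient n3))[a sa <-] : u \in [group of [set: {'GL_n['F_2]}]].
  by rewrite in_setT.
by exists a; rewrite // /out_PSL out_GL_pi.
Qed.

Lemma PSL_quotient_out : is_quotient (outgroup F) (PSLgroup n 'F_2).
Proof.
apply: is_quotient_hom out_PSLM _ => y; split=> [/out_PSL_surj[a _ <-]|[x <-]].
  by exists (out_pi a).
exact: out_PSL_in.
Qed.

Lemma PSL_quotient_sout : is_quotient (SOut_free n) (PSLgroup n 'F_2).
Proof.
apply: (@is_quotient_hom _ _ _ (fun s : SOut_free n => out_PSL (val s))) => [s t|y].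
  by rewrite valM out_PSLM.
split=> [/out_PSL_surj[a sa <-]|[x <-]]; last exact: out_PSL_in.
by exists (sout_pi a); rewrite val_sout_pi.
Qed.

Lemma PSL_minimal (gT : finGroupType) (G : {group gT}) Phi : n = 3 \/ n = 4 ->
  special_quotient (n := n) G Phi -> G :!=: 1 ->
  #|PSLgroup n 'F_2| <= #|G| /\ (#|G| = #|PSLgroup n 'F_2| -> G \isog PSLgroup n 'F_2).
Proof.
move=> n34 PhiG G1; have iso := PSL_isog n3.
have [le eq] := special_quotient_minimal n3 PhiG n34 G1.
rewrite (card_isog iso); split=> // /eq isoG.
by apply: isog_trans isoG _; rewrite isog_sym.
Qed.

Lemma PSL_nonabelian : ~~ abelian (PSLgroup n 'F_2).
Proof. by rewrite (isog_abelian (PSL_isog n3)) GL_nonabelian. Qed.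

End OutGL.

Theorem mainTheorem1 (n : nat) (hn : n = 3 \/ n = 4) :
  (is_quotient (SOut_free n) (PSLgroup n 'F_2) /\
   PSLgroup n 'F_2 :!=: 1 /\
   forall (gT : finGroupType) (G : {group gT}),
     is_quotient (SOut_free n) G -> G :!=: 1 ->
     #|PSLgroup n 'F_2| <= #|G| /\
     (#|G| = #|PSLgroup n 'F_2| -> G \isog PSLgroup n 'F_2)) /\
  (is_quotient (outgroup (free_group n)) (PSLgroup n 'F_2) /\
   ~~ abelian (PSLgroup n 'F_2) /\
   forall (gT : finGroupType) (G : {group gT}),
     is_quotient (outgroup (free_group n)) G -> ~~ abelian G ->
     #|PSLgroup n 'F_2| <= #|G| /\
     (#|G| = #|PSLgroup n 'F_2| -> G \isog PSLgroup n 'F_2)).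
Proof.
have [m nE] : exists m, n = m.+1 by exists n.-1; case: hn => ->.
subst n; have n3 : 2 < m.+1 by case: hn => ->.
split; split.
- exact: PSL_quotient_sout.
- split=> [|gT G /sout_special_quotient[Phi PhiG] G1]; last exact: PSL_minimal PhiG G1.
  by apply: contraNneq (PSL_nonabelian n3) => ->; apply: abelian1.
- exact: PSL_quotient_out.
- split=> [|gT G qG nab]; first exact: PSL_nonabelian.
  (* The bound applies to the image [H] of SAut F_n; if |G| attains it, then H = G. *)
  have [Phi [H [PhiH sHG H1]]] := out_special_quotient nab qG.
  have [le eq] := PSL_minimal n3 hn PhiH H1.
  split; first by apply: leq_trans le (subset_leq_card sHG).
  move=> E; have HG : H :=: G by apply/eqP; rewrite eqEcard sHG E.
  by rewrite -HG; apply: eq; rewrite HG.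
Qed.
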